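(* Let $X\neq\{0\}$ be a complex Banach space with open unit ball $\mathbb{B}$ and let $\frac12\le\lambda\le 1$. Let $F$ be a locally biholomorphic mapping on $\mathbb{B}$ such that, for each $k=1,2,3$, there is a complex-valued homogeneous polynomial $H_{F,k}:X\to\mathbb{C}$ of degree $k$ with $$\frac{D^{k+1}F(0)(x^{k+1})}{(k+1)!}=H_{F,k}(x)\,x\qquad\text{for all }x\in X .$$ If $F\in\widehat{\mathcal{F}}_{\lambda}(\mathbb{B})$, then for every $x_0\in X$ with $\|x_0\|=1$ (and every $T_{x_0}\in T(x_0)$), $$-\frac{(2\lambda-1)^2(2\lambda+5)^2}{64\lambda(2\lambda+3)}\le T_{3,1}(F)\le\begin{cases}1,&\lambda\in\left[\frac12,\frac{\sqrt{153}-5}{8}\right],\\[1mm] 1+\dfrac{(1+2\lambda)^2(4\lambda^2+5\lambda-8)}{18},&\lambda\in\left(\frac{\sqrt{153}-5}{8},1\right].\end{cases}$$ The inequalities are sharp: for every $\lambda\in[\frac12,1]$ and for each of the lower and the upper bound there exist such an $F$, $x_0$ and $T_{x_0}$ for which equality holds.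
   Context: $X$ is a complex Banach space with norm $\|\cdot\|$ and $\mathbb{B}=\{x\in X:\|x\|<1\}$. For $x\in X\setminus\{0\}$, $T(x)$ is the set of bounded linear functionals $T_x:X\to\mathbb{C}$ with $T_x(x)=\|x\|$ and $\|T_x\|=1$. $D^nF(x)$ denotes the $n$th Fréchet derivative of $F$ at $x$ (a bounded symmetric $n$-linear map $X^n\to X$), and $D^nF(0)(x^n)=D^nF(0)(x,\ldots,x)$. A holomorphic map $F:\mathbb{B}\to X$ is normalized if $F(0)=0$ and $DF(0)=I$; it is locally biholomorphic if $DF(x)$ is invertible with bounded inverse for every $x\in\mathbb{B}$. For $\frac12\le\lambda\le1$, $\widehat{\mathcal{F}}_{\lambda}(\mathbb{B})$ is the class of normalized locally biholomorphic maps $F:\mathbb{B}\to X$ such that $$\operatorname{Re}\left\{T_x\left(\frac{(DF(x))^{-1}\bigl(D^2F(x)(x,x)+DF(x)x\bigr)}{\|x\|}\right)\right\}\ge\frac12-\lambda$$ for every $x\in\mathbb{B}\setminus\{0\}$ and every $T_x\in T(x)$. For $\|x_0\|=1$ and $T_{x_0}\in T(x_0)$, put $A_n=\frac{1}{n!}T_{x_0}\bigl(D^nF(0)(x_0,\ldots,x_0)\bigr)$ for $n=2,3$, and define the Hermitian–Toeplitz determinant $$T_{3,1}(F)=\begin{vmatrix}1&A_2&A_3\\\overline{A_2}&1&A_2\\\overline{A_3}&\overline{A_2}&1\end{vmatrix}=1-2|A_2|^2+2\operatorname{Re}(A_2^2\overline{A_3})-|A_3|^2 .$$ *)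

(* Defs.v *)
From HB Require Import structures.
From mathcomp Require Import all_boot all_order all_algebra.
From mathcomp Require Import all_classical all_reals all_analysis.
From mathcomp Require Import complex.

Set Implicit Arguments.
Unset Strict Implicit.
Unset Printing Implicit Defensive.

Import Order.TTheory GRing.Theory Num.Theory.
Import numFieldNormedType.Exports.

Local Open Scope classical_set_scope.
Local Open Scope complex_scope.
Local Open Scope ring_scope.

Section Multilinear.
Context {K : numFieldType}.

Definition multilinear (V W : lmodType K) n (L : ('I_n -> V) -> W) : Prop :=
  forall (i : 'I_n) (v : 'I_n -> V), linear (fun u : V => L (dfwith (T := fun=> V) v i u)).

(* Boundedness of the multilinear map is not part of the definition. *)
Definition homogeneous_polynomial (V W : lmodType K) k (H : V -> W) : Prop :=
  exists2 L : ('I_k -> V) -> W, multilinear L & forall x, H x = L (fun=> x).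

Definition vcons (V : Type) n (h : V) (v : 'I_n -> V) : 'I_n.+1 -> V :=
  fun j => if unlift ord0 j is Some k then v k else h.

(* The operator-valued map [G], with values in the bounded n-linear maps, is
   Fréchet differentiable at [x] with derivative [L].  A bounded linear map
   from [V] to the bounded n-linear maps is identified with a bounded
   (n+1)-linear map, and [‖A‖ <= c] for the norm of an n-linear map [A] is
   written as [`|A v| <= c * \prod_i `|v i|] for all [v]. *)
Definition is_frechet_derivative (V W : normedModType K) n
    (G : V -> ('I_n -> V) -> W) (x : V) (L : ('I_n.+1 -> V) -> W) : Prop :=
  [/\ multilinear L,
      exists M : K, forall v, `|L v| <= M * \prod_(i < n.+1) `|v i| &
      forall e : K, 0 < e -> \forall h \near nbhs (0 : V),
        forall v : 'I_n -> V,
          `|G (x + h) v - G x v - L (vcons h v)|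
             <= e * `|h| * \prod_(i < n) `|v i| ].

(* [nderiv F n x v] is D^n F (x) (v_0, ..., v_(n-1)); it is a junk value
   (the zero map) where the derivative does not exist. *)
Fixpoint nderiv (V W : normedModType K) (F : V -> W) (n : nat) (x : V) :
    ('I_n -> V) -> W :=
  match n return ('I_n -> V) -> W with
  | 0 => fun=> F x
  | m.+1 => xget (fun=> 0)
      [set L | is_frechet_derivative (fun y => nderiv F (n := m) y) x L]
  end.

End Multilinear.
Arguments nderiv {K V W} F n x _.

Lemma vconsK (V : Type) n (w : 'I_n.+1 -> V) :
  vcons (w ord0) (fun i => w (lift ord0 i)) = w.
Proof.
apply/funext => j; rewrite /vcons; case: unliftP => [k ->|->] //.
Qed.

Lemma multilinear_vconsZ (K : numFieldType) (V W : lmodType K) n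
    (L : ('I_n.+1 -> V) -> W) (a : K) h v :
  multilinear L -> L (vcons (a *: h) v) = a *: L (vcons h v).
Proof.
move=> /(_ ord0 (vcons h v)) Ll.
have E u : dfwith (T := fun=> V) (vcons h v) ord0 u = vcons u v.
  apply/funext => j; rewrite /vcons; case: unliftP => [k ->|->].
    by rewrite dfwithout // /vcons ?neq_lift // liftK.
  by rewrite dfwithin.
have L0 : L (vcons 0 v) = 0.
  by have := Ll (-1) 0 0; rewrite scaler0 addr0 !E scaleN1r addNr.
have := Ll a h 0; rewrite /= addr0 !E => ->; by rewrite L0 addr0.
Qed.

Lemma frechet_unique (K : numFieldType) (V W : normedModType K) n
  (G : V -> ('I_n -> V) -> W) x L L' :
  is_frechet_derivative G x L -> is_frechet_derivative G x L' -> L = L'.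
Proof.
move=> [mL _ dL] [mL' _ dL']; apply/funext => w.
rewrite -(vconsK w); set h := w _; set v := (X in vcons _ X).
apply/eqP; rewrite -subr_eq0 -normr_eq0; apply/eqP/le_anti; rewrite normr_ge0 andbT.
set c := `|h| * \prod_(i < n) `|v i|.
have c0 : 0 <= c by rewrite mulr_ge0 // prodr_ge0.
suff H e : 0 < e -> `|L (vcons h v) - L' (vcons h v)| <= e * c + e * c.
  apply/ler_addgt0Pl => e e0; rewrite addr0.
  have c1 : 0 < c + 1 by rewrite ltr_wpDl.
  apply: (le_trans (H (e / 2 / (c + 1)) _)); first by rewrite !divr_gt0.
  rewrite -mulrDl -mulrDl -splitr -mulrA ger_pMr //.
  by rewrite ler_pdivrMl // mulr1 lerDl.
move=> e0.
have [d /= d0 Hd] := nbhs_norm0P.1 (filterI (dL _ e0) (dL' _ e0)).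
pose a := d / 2 / (`|h| + 1).
have h1 : 0 < `|h| + 1 by rewrite ltr_wpDl.
have a0 : 0 < a by rewrite /a !divr_gt0.
have [|A B] := Hd (a *: h).
  rewrite /= normrZ gtr0_norm // /a mulrAC ltr_pdivrMr // -mulrA ltr_pM2l //.
  rewrite mulrC ltr_pdivrMr // mulr_natr mulr2n.
  by rewrite -addrA ltrDl addr_gt0.
move: (A v) (B v); rewrite !multilinear_vconsZ // => {}A {}B.
clearbody a; set g := G (x + a *: h) v - G x v in A B.
rewrite -(ler_pM2l a0) -{1}(gtr0_norm a0) -normrZ scalerBr.
have -> : a *: L (vcons h v) - a *: L' (vcons h v) =
  (g - a *: L' (vcons h v)) - (g - a *: L (vcons h v)).
  by rewrite opprB [RHS]addrC addrA subrK.
apply: le_trans (ler_normB _ _) _.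
have E : a * (e * c) = e * (a * `|h|) * \prod_(i < n) `|v i|.
  by rewrite /c -!mulrA mulrCA.
rewrite mulrDr E; move: A B; rewrite normrZ gtr0_norm // => A B.
exact: lerD.
Qed.

Lemma nderivSE (K : numFieldType) (V W : normedModType K) (F : V -> W) n x L :
  is_frechet_derivative (nderiv F n) x L -> nderiv F n.+1 x = L.
Proof.
move=> H; apply: frechet_unique (H) => /=.
exact: (@xgetI _ _ [set L | is_frechet_derivative (nderiv F n) x L] _ H).
Qed.

Lemma nderiv1E (K : numFieldType) (V W : normedModType K) (F : V -> W) x :
  differentiable F x -> nderiv F 1 x = fun v => 'd F x (v ord0).
Proof.
move=> dF; apply: nderivSE; split.
- move=> i v a u w /=; rewrite (ord1 i) !dfwithin; exact: linearP.
- have /pinfty_ex_gt0[M M0 H] :=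
    (linear_boundedP _).1 ((linear_bounded_continuous _).2 (diff_continuous dF)).
  by exists M => v; rewrite big_ord1.
- move=> e e0.
  have [_ H0] := (diff_locallyxP _ _).1 dF.
  have := (eqaddoP (nbhs (0:V)) (fun h => F (h + x)) (fun h => F x + 'd F x h) id).1.
  move=> /(_ (funext H0)) H.
  near=> h => v; rewrite big_ord0 mulr1 /= (_ : vcons h v ord0 = h); last first.
    by rewrite /vcons unlift_none.
  by rewrite [x + h]addrC -addrA -opprD; near: h; exact: H.
Unshelve. all: by end_near. Qed.

Section Banach.
Context {R : realType} {X : completeNormedModType R[i]}.

(* The norm of a normed module over [R[i]] takes its values in [R[i]], where
   they are nonnegative reals; [complex.Re] brings them back to [R]. *)
Definition opnorm (T : X -> R[i]) : R :=
  sup [set complex.Re `|T y| | y in [set y : X | `|y| <= 1]].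

Definition supporting (x : X) : set {linear X -> R[i]^o} :=
  [set T : {linear X -> R[i]^o} |
    [/\ continuous (T : X -> R[i]^o), T x = `|x| & opnorm T = 1] ].

(* Set-theoretic inverse of DF(x); meaningful when DF(x) is bijective. *)
Definition diff_inv (F : X -> X) (x : X) : X -> X :=
  'pinv_(fun=> 0) setT ('d F x : X -> X).

Definition holomorphic_on_ball (F : X -> X) : Prop :=
  forall x : X, `|x| < 1 -> differentiable F x.

Definition normalized (F : X -> X) : Prop :=
  F 0 = 0 /\ ('d F 0 : X -> X) = id.

Definition locally_biholomorphic (F : X -> X) : Prop :=
  holomorphic_on_ball F /\
  forall x : X, `|x| < 1 ->
    bijective ('d F x : X -> X) /\ continuous (diff_inv F x).

Definition Fhat (lam : R) : set (X -> X) :=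
  [set F | [/\ normalized F, locally_biholomorphic F &
    forall x : X, x != 0 -> `|x| < 1 -> forall T, supporting x T ->
      complex.Re (T (`|x|^-1 *:
        diff_inv F x (nderiv F 2 x (fun=> x) + 'd F x x)))
      >= 2^-1 - lam] ].

(* D^(k+1)F(0)(x^(k+1)) / (k+1)! = H_(F,k)(x) x for k = 1, 2, 3. *)
Definition scalar_type_coefficients (F : X -> X) : Prop :=
  forall k : nat, (1 <= k <= 3)%N ->
    exists2 H : X -> R[i]^o, homogeneous_polynomial k H &
      forall x : X,
        (k.+1`!%:R : R[i])^-1 *: nderiv F k.+1 0 (fun=> x) = H x *: x.

Definition coef (F : X -> X) (T : X -> R[i]) (x0 : X) (n : nat) : R[i] :=
  (n`!%:R)^-1 * T (nderiv F n 0 (fun=> x0)).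

Definition hermitian_toeplitz31 (F : X -> X) (T : X -> R[i]) (x0 : X) : R[i] :=
  let A2 := coef F T x0 2 in
  let A3 := coef F T x0 3 in
  \det (\matrix_(i < 3, j < 3)
    nth 0 (nth [::] [:: [:: 1;      A2;     A3];
                        [:: A2^*%R; 1;      A2];
                        [:: A3^*%R; A2^*%R; 1]] i) j).

End Banach.

Section Bounds.
Context {R : realType}.

Definition lower_bound31 (lam : R) : R :=
  - ((2 * lam - 1) ^+ 2 * (2 * lam + 5) ^+ 2 / (64 * lam * (2 * lam + 3))).

Definition upper_bound31 (lam : R) : R :=
  if lam <= (Num.sqrt 153 - 5) / 8 then 1
  else 1 + (1 + 2 * lam) ^+ 2 * (4 * lam ^+ 2 + 5 * lam - 8) / 18.

End Bounds.

(* Main.v *)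
Require Import Defs.
From HB Require Import structures.
From mathcomp Require Import all_boot all_order all_algebra.
From mathcomp Require Import all_classical all_reals all_analysis.
From mathcomp Require Import complex.
From mathcomp Require Import ring lra.
Set Implicit Arguments.
Unset Strict Implicit.
Unset Printing Implicit Defensive.
Import Order.TTheory GRing.Theory Num.Theory.
Import numFieldNormedType.Exports.
Local Open Scope classical_set_scope.
Local Open Scope complex_scope.
Local Open Scope ring_scope.

(** Put beta = 1/2 + lambda.  Along the line z |-> z x0 the function
    p(z) = (T (DF(z x0)^-1 (z D^2F(z x0)(x0, x0) + DF(z x0) x0)) - (1 - beta)) / beta
    has positive real part, and the hypothesis on the coefficients of F gives
    A_2 = beta p_1 / 2 and A_3 = (beta p_2 + beta^2 p_1^2) / 6.  Since
    T_{3,1} = (1 - |A_2|^2)^2 - |A_3 - A_2^2|^2, the Caratheodory inequality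
    |2 p_2 - p_1^2| <= 4 - |p_1|^2 turns both bounds into the optimisation of a
    quadratic polynomial in |A_2|^2.

    The extremal maps are F(x) = g(l x) x, where l is a supporting functional
    given by the Hahn-Banach theorem and (z g)' = P = (1 - c z + z^2)^(-beta).
    Since Re (P (1 - c z + z^2)) > 0, the real part of a multiple of z g increases
    along the preimage of a segment under a primitive of 1 / (1 - c z + z^2), so
    that g has no zero in the disc.

    Contour integrals are avoided: Goursat's bisection is applied to Riemann sums,
    and Cauchy's formula is replaced by limits of means over the 2^n-th roots of
    unity. *)

(** * Linear identities in modules *)

(** Holomorphy is given only as pointwise Fréchet differentiability, possibly in infinite dimension,
    while [nderiv] is a choice that is meaningful only once the derivative has been shown to exist
    as a bounded multilinear map. Much of the analysis therefore derives, from complex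
    differentiability on lines, Cauchy estimates strong enough to iterate differentiation.

    The hypothesis on the coefficients makes D^2F(0)(x0, x0) a multiple of x0, so that the mixed
    term D^2F(0)(x0, DF(0)^-1 D^2F(0)(x0, x0)), which comes from differentiating the inverse, can be
    read on the line through x0.

    With s = |A_2|^2 and d = |A_3 - A_2^2|, two triangle inequalities turn the Caratheodory
    inequality into 3 beta d <= beta^2 - (2 - beta) s and s - beta <= 3 d. The first gives the lower
    bound as the vertex value of a parabola in s; the map with c = 2 r has s = beta^2 r^2, and r is
    tuned to the vertex. With the second, convexity leaves two candidates for the upper bound: 1,
    attained by the identity, and the value at s = beta^2, attained for c = 2. They coincide at the
    threshold for lambda. *)

Inductive vexpr (K : Type) : Type :=
  | VVar of nat | VZero | VAdd of vexpr K & vexpr K | VOpp of vexpr K | VScale of K & vexpr K.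
Arguments VVar {K} _.
Arguments VZero {K}.

Section ModuleReflection.
Variables (K : comNzRingType) (V : lmodType K).

Fixpoint veval (env : seq V) (e : vexpr K) : V :=
  match e with
  | VVar i => nth 0 env i
  | VZero => 0
  | VAdd e1 e2 => veval env e1 + veval env e2
  | VOpp e1 => - veval env e1
  | VScale k e1 => k *: veval env e1
  end.

(** The test is [eqn] rather than [==] so that [cbn] computes it on numerals inside [vmod]. *)
Fixpoint vcoef (e : vexpr K) (i : nat) : K :=
  match e with
  | VVar j => if eqn i j then 1 else 0
  | VZero => 0
  | VAdd e1 e2 => vcoef e1 i + vcoef e2 i
  | VOpp e1 => - vcoef e1 i
  | VScale k e1 => k * vcoef e1 i
  end.

Fixpoint vcoef_eq (n : nat) (e1 e2 : vexpr K) : Prop :=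
  if n is m.+1 then vcoef e1 m = vcoef e2 m /\ vcoef_eq m e1 e2 else True.

Lemma veval_sum env e : veval env e = \sum_(i < size env) vcoef e i *: env`_i.
Proof.
elim: e => [j||e1 IH1 e2 IH2|e IH|k e IH] /=.
- have [jlt|jge] := ltnP j (size env); last first.
    rewrite nth_default // big1 // => i _; rewrite (_ : eqn i j = false) ?scale0r //.
    by apply/negbTE/eqP => ij; move: (ltn_ord i); rewrite ij ltnNge jge.
  rewrite (bigD1 (Ordinal jlt)) //= (_ : eqn j j); last exact/eqP.
  rewrite scale1r big1 ?addr0 // => i ij; rewrite (_ : eqn i j = false) ?scale0r //.
  by apply/negbTE; apply: contraNN ij => /eqP ij; apply/eqP/val_inj.
- by rewrite big1 // => i _; rewrite scale0r.
- by rewrite IH1 IH2 -big_split; apply: eq_bigr => i _; rewrite scalerDl.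
- by rewrite IH -sumrN; apply: eq_bigr => i _; rewrite scaleNr.
- by rewrite IH scaler_sumr; apply: eq_bigr => i _; rewrite scalerA.
Qed.

Lemma vcoef_eqP env e1 e2 : vcoef_eq (size env) e1 e2 -> veval env e1 = veval env e2.
Proof.
move=> H; rewrite !veval_sum; apply: eq_bigr => i _; congr (_ *: _).
elim: (size env) H (val i) (ltn_ord i) => // n IH [H1 H2] j.
by rewrite ltnS leq_eqVlt => /predU1P[->|] //; apply: IH.
Qed.

End ModuleReflection.

Ltac vatom_index x l :=
  lazymatch l with
  | ?y :: ?l' => match l with
      | _ => let _ := match l with _ => constr_eq x y end in constr:(O)
      | _ => let n := vatom_index x l' in constr:(S n) end
  end.
Ltac vatom_add x l :=
  lazymatch l with
  | nil => constr:(x :: nil)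
  | ?y :: ?l' => match l with
      | _ => let _ := match l with _ => constr_eq x y end in l
      | _ => let l2 := vatom_add x l' in constr:(y :: l2) end
  end.
Ltac vatoms e l :=
  lazymatch e with
  | (?a + ?b)%R => let l1 := vatoms a l in vatoms b l1
  | (- ?a)%R => vatoms a l
  | (_ *: ?a)%R => vatoms a l
  | 0%R => l
  | ?x => vatom_add x l
  end.
Ltac vreify K e l :=
  lazymatch e with
  | (?a + ?b)%R => let x := vreify K a l in let y := vreify K b l in constr:(@VAdd K x y)
  | (- ?a)%R => let x := vreify K a l in constr:(@VOpp K x)
  | (?k *: ?a)%R => let x := vreify K a l in constr:(@VScale K k x)
  | 0%R => constr:(@VZero K)
  | ?x => let n := vatom_index x l in constr:(@VVar K n)
  end.
(* The identity is reduced to one equation in [K] per atom, left to [tac]. *)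
Ltac vmod_with K V tac :=
  lazymatch goal with
  | |- @eq _ ?x ?y =>
    let l0 := vatoms x (@nil V) in let l := vatoms y l0 in
    let e1 := vreify K x l in let e2 := vreify K y l in
    refine (@vcoef_eqP _ V l e1 e2 _); cbn [vcoef_eq vcoef eqn size];
    repeat (split; [tac |]); try exact I
  end.
Tactic Notation "vmod" constr(K) constr(V) := vmod_with K V ltac:(ring).
Tactic Notation "vmod" constr(K) constr(V) "by" tactic3(tac) := vmod_with K V tac.

(** * Complex differentiability and Goursat's lemma *)

(** Norms take values in [R[i]], whose order is partial; as elements of [R] they are accessible to
    [lra] and to suprema. *)
Definition nm (R : realType) (V : normedZmodType R[i]) (x : V) : R :=
  complex.Re `|x|.

Section RealNorm.
Context {R : realType}.
Local Notation K := R[i].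

Lemma nmE (V : normedZmodType K) (x : V) : `|x| = (nm x)%:C.
Proof. by rewrite /nm RRe_real // normr_real. Qed.

Lemma nm_ge0 (V : normedZmodType K) (x : V) : 0 <= nm x.
Proof. by rewrite -ler0c -nmE. Qed.
Hint Resolve nm_ge0 : core.

Lemma nm0 (V : normedZmodType K) : nm (0 : V) = 0.
Proof. by rewrite /nm normr0. Qed.

Lemma nm_eq0 (V : normedZmodType K) (x : V) : (nm x == 0) = (x == 0).
Proof. by rewrite -(normr_eq0 x) nmE -(inj_eq (@complexI R)). Qed.

Lemma nm_gt0 (V : normedZmodType K) (x : V) : (0 < nm x) = (x != 0).
Proof. by rewrite lt_def nm_ge0 nm_eq0 andbT. Qed.

Lemma nmN (V : normedZmodType K) (x : V) : nm (- x) = nm x.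
Proof. by rewrite /nm normrN. Qed.

Lemma ler_nmD (V : normedZmodType K) (x y : V) : nm (x + y) <= nm x + nm y.
Proof. by rewrite -lecR rmorphD /= -!nmE ler_normD. Qed.

Lemma ler_nmB (V : normedZmodType K) (x y : V) : nm (x - y) <= nm x + nm y.
Proof. by rewrite -(nmN y) ler_nmD. Qed.

Lemma nm_distC (V : normedZmodType K) (x y : V) : nm (x - y) = nm (y - x).
Proof. by rewrite -nmN opprB. Qed.

Lemma nm_dist_tri (V : normedZmodType K) (x y z : V) :
  nm (x - z) <= nm (x - y) + nm (y - z).
Proof. by rewrite (le_trans _ (ler_nmD _ _)) // addrA subrK. Qed.

Lemma nm_lower (V : normedZmodType K) (x y : V) : nm x - nm y <= nm (x - y).
Proof. by rewrite lerBlDr (le_trans _ (ler_nmD _ _)) // subrK. Qed.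

Lemma ler_nm_sum (V : normedZmodType K) (I : Type) (r : seq I) (P : pred I) (F : I -> V) :
  nm (\sum_(i <- r | P i) F i) <= \sum_(i <- r | P i) nm (F i).
Proof.
elim/big_rec2 : _ => [|i y x _ H]; first by rewrite nm0.
by rewrite (le_trans (ler_nmD _ _)) // lerD2l.
Qed.

Lemma nmZ (V : normedModType K) (a : K) (x : V) : nm (a *: x) = nm a * nm x.
Proof. by apply: (@complexI R); rewrite rmorphM /= -!nmE normrZ. Qed.

Lemma nmM (a b : K) : nm (a * b) = nm a * nm b.
Proof. by apply: (@complexI R); rewrite rmorphM /= -!nmE normrM. Qed.

Lemma nm1 : nm (1 : K) = 1.
Proof. by rewrite /nm normr1. Qed.

Lemma nmV (a : K) : nm a^-1 = (nm a)^-1.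
Proof. by apply: (@complexI R); rewrite fmorphV /= -!nmE normfV. Qed.

Lemma nmX (a : K) n : nm (a ^+ n) = nm a ^+ n.
Proof. by apply: (@complexI R); rewrite rmorphXn /= -!nmE normrX. Qed.

Lemma nm_real (x : R) : nm x%:C = `|x|.
Proof. by rewrite /nm normc_def /= expr0n addr0 sqrtr_sqr. Qed.

Lemma nmr (x : R) : 0 <= x -> nm x%:C = x.
Proof. by move=> x0; rewrite nm_real ger0_norm. Qed.

Lemma normc_nm (x : K) : nm x ^+ 2 = complex.Re x ^+ 2 + complex.Im x ^+ 2.
Proof. by apply: (@complexI R); rewrite rmorphXn /= -nmE add_Re2_Im2. Qed.

Lemma ler_Re_nm (x : K) : complex.Re x <= nm x.
Proof. by rewrite (le_trans (ler_norm _)) // -lecR -nmE normc_ge_Re. Qed.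

End RealNorm.
#[global] Hint Extern 0 (is_true (0 <= nm _)%R) => solve [apply: nm_ge0] : core.

(** For functions of one complex variable the derivative is kept as a vector, with an explicit
    radius, so that estimates can be combined without filters. *)
Definition cderiv (R : realType) (V : normedModType R[i]) (f : R[i] -> V) (z : R[i]) (d : V) :=
  forall e : R, 0 < e -> exists2 r : R, 0 < r &
    forall h, nm h < r -> nm (f (z + h) - f z - h *: d) <= e * nm h.

Section Goursat.
Context {R : realType} {V : normedModType R[i]}.
Local Notation K := R[i].
Implicit Types (f g : K -> V) (z a b : K).

(* The left Riemann sum of [f] along [z, z + a], with 2^n steps. *)
Fixpoint segsum f n z a : V :=
  if n is m.+1 then segsum f m z (a / 2) + segsum f m (z + a / 2) (a / 2)
  else a *: f z.

(** The boundary sum of the parallelogram spanned by [a] and [b] at [z]. Opposite sides are summed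
    in the same direction and subtracted, so that the errors of the left Riemann sums cancel. *)
Definition loopsum f n z a b :=
  segsum f n z a + segsum f n (z + a) b - segsum f n (z + b) a - segsum f n z b.

Lemma nm_half (a : K) : nm (a / 2) = nm a / 2.
Proof. by rewrite nmM nmV (_ : 2 = 2%:C) ?nmr // rmorph_nat. Qed.

Lemma segsum_le f n z a (C : R) :
  (forall t : R, 0 <= t <= 1 -> nm (f (z + t%:C * a)) <= C) ->
  nm (segsum f n z a) <= nm a * C.
Proof.
elim: n z a => [|n IH] z a H /=.
  by rewrite nmZ ler_wpM2l //; move: (H 0); rewrite lexx ler01 mul0r addr0; apply.
rewrite (le_trans (ler_nmD _ _)) //.
have -> : nm a * C = nm (a / 2) * C + nm (a / 2) * C by rewrite nm_half; lra.
apply: lerD; apply: IH => t t01.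
  have -> : z + t%:C * (a / 2) = z + (t / 2)%:C * a.
    by rewrite rmorphM fmorphV /= rmorph_nat; field.
  by apply: H; lra.
have -> : z + a / 2 + t%:C * (a / 2) = z + ((1 + t) / 2)%:C * a.
  by rewrite rmorphM fmorphV rmorphD /= rmorph1 rmorph_nat; field.
by apply: H; lra.
Qed.

Lemma segsumB f g n z a :
  segsum (fun w => f w - g w) n z a = segsum f n z a - segsum g n z a.
Proof.
by elim: n z a => [|n IH] z a /=; [rewrite scalerBr|rewrite !IH opprD addrACA].
Qed.

Lemma loopsumB f g n z a b :
  loopsum (fun w => f w - g w) n z a b = loopsum f n z a b - loopsum g n z a b.
Proof.
by rewrite /loopsum !segsumB; vmod K V.
Qed.

Definition affine (c : V) (w0 : K) (d : V) := fun w : K => c + (w - w0) *: d.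

Lemma segsum_affine c w0 d n z a s :
  segsum (affine c w0 d) n (z + s) a =
  segsum (affine c w0 d) n z a + (a * s) *: d.
Proof.
elim: n z a => [|n IH] z a /=.
  by rewrite /affine; vmod K V.
rewrite IH (_ : z + s + a / 2 = z + a / 2 + s); last by ring.
by rewrite IH; vmod K V by (by field).
Qed.

(** Translating a side adds [(a * b) *: d] to its sum in either direction. The loop therefore
    vanishes at every [n], not only in the limit. *)
Lemma loopsum_affine c w0 d n z a b : loopsum (affine c w0 d) n z a b = 0.
Proof.
by rewrite /loopsum !segsum_affine; vmod K V.
Qed.

(** The sums over the inner sides cancel exactly, because a sum with 2^(n+1) steps is by definition
    two sums with 2^n steps. *)
Lemma loopsumS f n z a b :
  loopsum f n.+1 z a b =
    loopsum f n z (a / 2) (b / 2) + loopsum f n (z + a / 2) (a / 2) (b / 2)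
  + (loopsum f n (z + b / 2) (a / 2) (b / 2)
     + loopsum f n (z + a / 2 + b / 2) (a / 2) (b / 2)).
Proof.
rewrite /loopsum /=.
have -> : z + a / 2 + a / 2 = z + a by field.
have -> : z + b / 2 + b / 2 = z + b by field.
have -> : z + a / 2 + b / 2 + a / 2 = z + a + b / 2 by field.
have -> : z + a / 2 + b / 2 + b / 2 = z + b + a / 2 by field.
have -> : z + b / 2 + a / 2 = z + a / 2 + b / 2 by ring.
by vmod K V.
Qed.

Definition par z a b (x y : R) : K := z + x%:C * a + y%:C * b.

Lemma par_sub z a b x0 y0 s t x y :
  par (par z a b x0 y0) (s%:C * a) (t%:C * b) x y = par z a b (x0 + s * x) (y0 + t * y).
Proof. by rewrite /par !rmorphD !rmorphM /=; ring. Qed.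

Lemma loopsum_le f n z a b (C : R) :
  (forall x y : R, 0 <= x <= 1 -> 0 <= y <= 1 -> nm (f (par z a b x y)) <= C) ->
  nm (loopsum f n z a b) <= 2 * (nm a + nm b) * C.
Proof.
move=> H; rewrite /loopsum.
have i0 : 0 <= (0 : R) <= 1 by rewrite lexx ler01.
have i1 : 0 <= (1 : R) <= 1 by rewrite lexx ler01.
have h1 : nm (segsum f n z a) <= nm a * C.
  apply: segsum_le => t t01.
  by rewrite (_ : _ + _ = par z a b t 0) ?H // /par rmorph0; ring.
have h2 : nm (segsum f n (z + a) b) <= nm b * C.
  apply: segsum_le => t t01.
  by rewrite (_ : _ + _ = par z a b 1 t) ?H // /par rmorph1; ring.
have h3 : nm (segsum f n (z + b) a) <= nm a * C.
  apply: segsum_le => t t01.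
  by rewrite (_ : _ + _ = par z a b t 1) ?H // /par rmorph1; ring.
have h4 : nm (segsum f n z b) <= nm b * C.
  apply: segsum_le => t t01.
  by rewrite (_ : _ + _ = par z a b 0 t) ?H // /par rmorph0; ring.
have := ler_nmB (segsum f n z a + segsum f n (z + a) b - segsum f n (z + b) a) (segsum f n z b).
have := ler_nmB (segsum f n z a + segsum f n (z + a) b) (segsum f n (z + b) a).
have := ler_nmD (segsum f n z a) (segsum f n (z + a) b).
lra.
Qed.

(** An upper limit bounded by [e]; the sums themselves are not claimed to converge. *)
Definition small_loop f z a b (e : R) :=
  exists N, forall n, (N <= n)%N -> nm (loopsum f n z a b) <= e.

Lemma small_loop_quarters f z a b (e : bool -> bool -> R) :
  (forall k l : bool,
     small_loop f (par z a b (k%:R / 2) (l%:R / 2)) (a / 2) (b / 2) (e k l)) ->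
  small_loop f z a b (e false false + e true false + (e false true + e true true)).
Proof.
move=> H; have half : (2^-1 : R)%:C = 2^-1 :> K by rewrite fmorphV rmorph_nat.
have [N1 H1] := H false false; have [N2 H2] := H true false.
have [N3 H3] := H false true; have [N4 H4] := H true true.
exists (maxn (maxn N1 N2) (maxn N3 N4)).+1 => -[//|n].
rewrite ltnS !geq_max => /andP[/andP[/H1 + /H2 +] /andP[/H3 + /H4 +]].
rewrite loopsumS /par !mul0r !mul1r ?rmorph0 !half ?mul0r !addr0 !(mulrC 2^-1) => h1 h2 h3 h4.
rewrite (le_trans (ler_nmD _ _)) // lerD //.
  by rewrite (le_trans (ler_nmD _ _)) // lerD.
by rewrite (le_trans (ler_nmD _ _)) // lerD.
Qed.

(** Bisection: if the loop is not small, one of the quarters is not small for a quarter of the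
    bound, and so on. The nested parallelograms shrink to a point where [f] is nearly affine; the
    affine part contributes nothing, and the remainder is at most perimeter times diameter times a
    small constant. *)
Lemma goursat f z a b :
  (forall x y : R, 0 <= x <= 1 -> 0 <= y <= 1 -> exists d, cderiv f (par z a b x y) d) ->
  forall e : R, 0 < e -> small_loop f z a b e.
Proof.
move=> df e e0; apply: contrapT => bad.
pose h m : R := 2^-1 ^+ m.
have h0 m : 0 < h m by rewrite exprn_gt0 // invr_gt0.
have hS m : h m.+1 = h m / 2 by rewrite /h exprSr.
(* [p] holds the coordinates of the corner of the current parallelogram, whose sides are scaled by
   [h m]; the admissible error scales like the area. *)
pose P m (p : R * R) := ~ small_loop f (par z a b p.1 p.2) ((h m)%:C * a) ((h m)%:C * b)
   (e * h m ^+ 2).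
pose in2 m (x y : R) := (y = x) \/ (y = x + h m.+1).
have step m p : exists q, P m p -> P m.+1 q /\ in2 m p.1 q.1 /\ in2 m p.2 q.2.
  have [Pp|nPp] := pselect (P m p); last by exists p.
  apply: contrapT => nq; apply: Pp.
  have good i j : in2 m p.1 i -> in2 m p.2 j -> small_loop f (par z a b i j)
      ((h m)%:C * a / 2) ((h m)%:C * b / 2) (e * h m.+1 ^+ 2).
    move=> hi hj; apply: contrapT => nP; apply: nq; exists (i, j) => _; split => //.
    move: nP; rewrite /P /= !hS !(mulrAC _ _ 2^-1) rmorphM fmorphV rmorph_nat //.
  have -> : e * h m ^+ 2 = e * h m.+1 ^+ 2 + e * h m.+1 ^+ 2 + (e * h m.+1 ^+ 2 + e * h m.+1 ^+ 2).
    by rewrite !hS; field.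
  have q2 : (h m.+1)%:C = (h m)%:C / 2 :> K by rewrite hS rmorphM fmorphV rmorph_nat.
  apply: (@small_loop_quarters _ _ _ _ (fun _ _ => e * h m.+1 ^+ 2)) => k l.
  rewrite (_ : par _ _ _ _ _ = par z a b (p.1 + k%:R * h m.+1) (p.2 + l%:R * h m.+1)); last first.
    by rewrite /par !(rmorphM, rmorphD) /= q2 fmorphV !rmorph_nat; field.
  by apply: good; [case: k|case: l]; rewrite ?mul1r ?mul0r ?addr0; [right|left|right|left].
have [g gP] := choice (fun mp : nat * (R * R) => step mp.1 mp.2).
pose s := fix s m := if m is k.+1 then g (k, s k) else (0, 0).
have sP m : P m (s m).
  elim: m => [|m IH]; last by have [] := gP (m, s m) IH.
  by rewrite /P /= /par /h expr0 expr1n mulr1 rmorph0 rmorph1 !mul1r !mul0r !addr0.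
have s1 m : in2 m (s m).1 (s m.+1).1 by have [_ []] := gP (m, s m) (sP m).
have s2 m : in2 m (s m).2 (s m.+1).2 by have [_ []] := gP (m, s m) (sP m).
have nested (u : nat -> R) : u 0%N = 0 -> (forall m, in2 m (u m) (u m.+1)) ->
    exists2 x, 0 <= x <= 1 & forall m, u m <= x <= u m + h m.
  move=> u0 us.
  have up m k : u m <= u (m + k)%N <= u m + h m - h (m + k)%N.
    elim: k => [|k IH]; first by rewrite addn0 addrK lexx.
    rewrite addnS; have := h0 (m + k)%N; have := hS (m + k)%N.
    by case: (us (m + k)%N) => ->; lra.
  have ub m k : u k <= u m + h m.
    have [mk|/ltnW km] := leqP m k.
      by have := up m (k - m)%N; rewrite subnKC //; have := h0 k; lra.
    by have := up k (m - k)%N; rewrite subnKC //; have := h0 m; lra.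
  have sup_u : has_sup (range u).
    split; first by exists (u 0%N), 0%N.
    by exists (u 0%N + h 0%N) => _ [k _ <-].
  have B m : u m <= sup (range u) <= u m + h m.
    apply/andP; split; first by apply: sup_upper_bound => //; exists m.
    by apply: ge_sup; [case: sup_u|move=> _ [k _ <-]].
  by exists (sup (range u)) => //; have := B 0%N; rewrite u0 /h expr0 add0r.
have [x x01 xP] := nested (fun m => (s m).1) erefl s1.
have [y y01 yP] := nested (fun m => (s m).2) erefl s2.
have [d dP] := df x y x01 y01.
pose L := nm a + nm b.
have L0 : 0 <= L by rewrite addr_ge0.
(* Chosen so that 2 (h L) (e' h L) <= e h^2 with h = [h m]; [L + 1] guards against a degenerate
   parallelogram. *)
pose e' := e / (2 * (L + 1) ^+ 2).
have e'0 : 0 < e' by rewrite divr_gt0 // mulr_gt0 // exprn_gt0 // ltr_wpDl.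
have [r r0 rP] := dP e' e'0.
have [m hm] : exists m, h m * (L + 1) < r.
  have : h m @[m --> \oo] --> 0 by apply: cvg_expr; rewrite ger0_norm ?invr_ge0 // invf_lt1 // ltr1n.
  have q0 : 0 < r / (L + 1) by rewrite divr_gt0 // ltr_wpDl.
  move=> /cvgr0Pnorm_lt /(_ _ q0) [m _ /(_ m (leqnn m)) /=].
  by rewrite gtr0_norm // ltr_pdivlMr ?ltr_wpDl // => hm; exists m.
(* Once the parallelogram lies in the disc where the affine approximation is good, the bound holds
   for every [n], which contradicts [sP m]. *)
apply: (sP m); exists 0%N => n _.
set w0 := par z a b x y in dP rP.
pose aff := affine (f w0) w0 d.
have -> : loopsum f n (par z a b (s m).1 (s m).2) ((h m)%:C * a) ((h m)%:C * b) =
   loopsum (fun w => f w - aff w) n (par z a b (s m).1 (s m).2) ((h m)%:C * a) ((h m)%:C * b).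
  by rewrite loopsumB loopsum_affine subr0.
have hmL : h m * L <= h m * (L + 1) by rewrite ler_pM2l // lerDl.
apply: (le_trans (@loopsum_le _ n _ _ _ (e' * (h m * L)) _)).
  move=> x' y' x'01 y'01; rewrite par_sub.
  set w := par _ _ _ _ _.
  have ww0 : nm (w - w0) <= h m * L.
    have -> : w - w0 = ((s m).1 + h m * x' - x)%:C * a + ((s m).2 + h m * y' - y)%:C * b.
      by rewrite /w /w0 /par !rmorphB /=; ring.
    rewrite (le_trans (ler_nmD _ _)) // !nmM !nm_real mulrDr lerD // ler_wpM2r //.
      have := xP m; have := h0 m; rewrite ler_norml => h0m xm.
      have : 0 <= h m * x' <= h m by rewrite mulr_ge0 ?ler_piMr //; lra.
      lra.
    have := yP m; have := h0 m; rewrite ler_norml => h0m ym.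
    have : 0 <= h m * y' <= h m by rewrite mulr_ge0 ?ler_piMr //; lra.
    lra.
  have := rP (w - w0) (le_lt_trans ww0 (le_lt_trans hmL hm)).
  have -> : w0 + (w - w0) = w by rewrite addrC subrK.
  have -> : f w - f w0 - (w - w0) *: d = f w - aff w by rewrite /aff /affine; vmod K V.
  by move=> H; rewrite (le_trans H) // ler_pM2l.
rewrite !nmM !nmr ?(ltW (h0 m)) // -mulrDr.
have -> : 2 * (h m * (nm a + nm b)) * (e' * (h m * L)) = h m ^+ 2 * (2 * e' * L ^+ 2).
  by rewrite -/L; ring.
rewrite mulrC ler_wpM2r ?exprn_ge0 ?(ltW (h0 m)) //.
have -> : e = 2 * e' * (L + 1) ^+ 2.
  by rewrite /e'; field; rewrite gt_eqF // ltr_wpDl.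
have e'20 : 0 < 2 * e' by rewrite mulr_gt0.
by rewrite (ler_pM2l e'20) ler_sqr ?nnegrE ?addr_ge0 // lerDl.
Qed.

End Goursat.

(** * Calculus of complex derivatives *)

Section Calculus.
Context {R : realType} {V : normedModType R[i]}.
Local Notation K := R[i].
Implicit Types (f g : K -> V) (z : K).

Lemma cderiv_cst (v : V) z : cderiv (fun=> v) z 0.
Proof.
by move=> e e0; exists 1 => // h _; rewrite subrr scaler0 subrr nm0 mulr_ge0 // ltW.
Qed.

Lemma cderiv_id z : cderiv (id : K -> R[i]^o) z 1.
Proof.
move=> e e0; exists 1 => // h _.
by rewrite [z + h - z]addrC addKr [_ *: _]mulr1 subrr nm0 mulr_ge0 // ltW.
Qed.

Lemma cderiv_local f g z d (r : R) : 0 < r ->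
  (forall h, nm h < r -> f (z + h) = g (z + h)) -> cderiv f z d -> cderiv g z d.
Proof.
move=> r0 fg df e e0; have [r' r'0 H] := df e e0.
exists (Num.min r r'); first by rewrite lt_min r0.
move=> h; rewrite lt_min => /andP[hr hr'].
by rewrite -fg // (_ : g z = f z) ?H //; have := fg 0; rewrite nm0 addr0 => ->.
Qed.

Lemma eq_cderiv f g z d : f =1 g -> cderiv f z d -> cderiv g z d.
Proof. by move=> fg; apply: (@cderiv_local _ _ _ _ 1). Qed.

Lemma cderivD f g z df dg : cderiv f z df -> cderiv g z dg ->
  cderiv (fun w => f w + g w) z (df + dg).
Proof.
move=> Hf Hg e e0; have e20 : 0 < e / 2 by rewrite divr_gt0.
have [r r0 H] := Hf _ e20; have [r' r'0 H'] := Hg _ e20.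
exists (Num.min r r'); first by rewrite lt_min r0.
move=> h; rewrite lt_min => /andP[/H{}H /H'{}H'].
have -> : f (z + h) + g (z + h) - (f z + g z) - h *: (df + dg) =
  (f (z + h) - f z - h *: df) + (g (z + h) - g z - h *: dg) by vmod K V.
by rewrite (le_trans (ler_nmD _ _)) //; lra.
Qed.

Lemma cderiv_lip f z d : cderiv f z d -> exists2 r : R, 0 < r &
  forall h, nm h < r -> nm (f (z + h) - f z) <= (nm d + 1) * nm h.
Proof.
move=> /(_ 1 ltr01)[r r0 H]; exists r => // h /H{}H.
have -> : f (z + h) - f z = (f (z + h) - f z - h *: d) + h *: d by rewrite subrK.
rewrite (le_trans (ler_nmD _ _)) // nmZ; lra.
Qed.

Lemma cderiv_cont f z d : cderiv f z d -> forall e : R, 0 < e ->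
  exists2 r : R, 0 < r & forall h, nm h < r -> nm (f (z + h) - f z) <= e.
Proof.
move=> /cderiv_lip[r r0 H] e e0.
have d0 : 0 < nm d + 1 by rewrite ltr_wpDl.
exists (Num.min r (e / (nm d + 1))); first by rewrite lt_min r0 divr_gt0.
move=> h; rewrite lt_min ltr_pdivlMr // => /andP[/H{}H he]; lra.
Qed.

End Calculus.

Section CalculusZ.
Context {R : realType} {V : normedModType R[i]}.
Local Notation K := R[i].
Implicit Types (f g : K -> V) (z : K).

Lemma cderivZ (k : K -> K) f z dk df :
  cderiv (k : K -> R[i]^o) z dk -> cderiv f z df ->
  cderiv (fun w => k w *: f w) z (dk *: f z + k z *: df).
Proof.
move=> Hk Hf e e0.
pose M := nm (k z) + nm (f z) + nm df + 1.
have M0 : 0 < M by rewrite ltr_wpDl // !addr_ge0.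
(* One third of the error for each term of the decomposition below; [M] dominates all the
   factors. *)
pose e1 := e / (3 * M).
have e10 : 0 < e1 by rewrite divr_gt0 // mulr_gt0.
have [r1 r10 H1] := Hk _ e10; have [r2 r20 H2] := Hf _ e10.
have [r3 r30 H3] := cderiv_cont Hk e10.
have [r4 r40 H4] := cderiv_cont Hk ltr01.
exists (Num.min (Num.min r1 r2) (Num.min r3 r4)); first by rewrite !lt_min r10 r20 r30.
move=> h; rewrite !lt_min => /andP[/andP[/H1{}H1 /H2{}H2] /andP[/H3{}H3 /H4{}H4]].
have -> : k (z + h) *: f (z + h) - k z *: f z - h *: (dk *: f z + k z *: df) =
  k (z + h) *: (f (z + h) - f z - h *: df) + ((k (z + h) - k z - h * dk) *: f z
   + (h * (k (z + h) - k z)) *: df) by vmod K V.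
have kM : nm (k (z + h)) <= M.
  rewrite -[k (z + h)](subrK (k z)) (le_trans (ler_nmD _ _)) //.
  by rewrite /M; have := nm_ge0 (f z); have := nm_ge0 df; lra.
have fM : nm (f z) <= M.
  by rewrite /M; have := nm_ge0 (k z); have := nm_ge0 df; lra.
have dM : nm df <= M.
  by rewrite /M; have := nm_ge0 (k z); have := nm_ge0 (f z); lra.
have -> : e * nm h = M * (e1 * nm h) + ((e1 * nm h) * M + (nm h * e1) * M).
  by rewrite /e1; field; rewrite gt_eqF.
rewrite (le_trans (ler_nmD _ _)) // lerD //; first by rewrite nmZ ler_pM.
rewrite (le_trans (ler_nmD _ _)) // lerD //; first by rewrite nmZ ler_pM.
by rewrite nmZ nmM !ler_pM // mulr_ge0.
Qed.

Lemma cderiv_comp f (g : K -> K) z dg d :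
  cderiv (g : K -> R[i]^o) z dg -> cderiv f (g z) d -> cderiv (fun w => f (g w)) z (dg *: d).
Proof.
move=> Hg Hf e e0.
pose M := nm dg + nm d + 1.
have M0 : 0 < M by rewrite ltr_wpDl // !addr_ge0.
pose e1 := e / (2 * M).
have e10 : 0 < e1 by rewrite divr_gt0 // mulr_gt0.
have [r1 r10 H1] := Hf _ e10; have [r2 r20 H2] := Hg _ e10.
have r120 : 0 < r1 / 2 by rewrite divr_gt0.
have [r3 r30 H3] := cderiv_cont Hg r120.
have [r4 r40 H4] := cderiv_lip Hg.
exists (Num.min r2 (Num.min r3 r4)); first by rewrite !lt_min r20 r30.
move=> h; rewrite !lt_min => /andP[/H2{}H2 /andP[/H3{}H3 /H4{}H4]].
set k := g (z + h) - g z in H3 H4.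
have kr1 : nm k < r1 by rewrite (le_lt_trans H3) //; lra.
have := H1 _ kr1; rewrite (_ : g z + k = g (z + h)); last by rewrite /k addrC subrK.
move=> {}H1.
have -> : f (g (z + h)) - f (g z) - h *: (dg *: d) =
  (f (g (z + h)) - f (g z) - k *: d) + (k - h * dg) *: d by vmod K V.
have -> : e * nm h = e1 * (M * nm h) + (e1 * nm h) * M by rewrite /e1; field; rewrite gt_eqF.
have gM : nm dg + 1 <= M by rewrite /M; have := nm_ge0 d; lra.
have dM : nm d <= M by rewrite /M; have := nm_ge0 dg; lra.
rewrite (le_trans (ler_nmD _ _)) // lerD //.
  rewrite (le_trans H1) // ler_pM2l // (le_trans H4) // ler_wpM2r //.
by rewrite nmZ ler_pM.
Qed.

Lemma cderiv_unique f z d d' : cderiv f z d -> cderiv f z d' -> d = d'.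
Proof.
move=> H H'; apply/eqP; rewrite -subr_eq0 -nm_eq0; apply/eqP/le_anti.
rewrite nm_ge0 andbT; apply/ler_addgt0Pl => e e0; rewrite addr0.
have e20 : 0 < e / 2 by rewrite divr_gt0.
have [r r0 {}H] := H _ e20; have [r' r'0 {}H'] := H' _ e20.
pose s := Num.min r r' / 2.
have s0 : 0 < s by rewrite divr_gt0 // lt_min r0.
have smin : s < Num.min r r' by rewrite /s ltr_pdivrMr // ltr_pMr ?ltr1n // lt_min r0.
have hs : nm s%:C = s by rewrite nmr // ltW.
move: smin; rewrite lt_min -hs => /andP[/H{}H /H'{}H'].
rewrite -(ler_pM2l s0) -{1}hs -nmZ.
have -> : s%:C *: (d - d') = (f (z + s%:C) - f z - s%:C *: d') - (f (z + s%:C) - f z - s%:C *: d) by vmod K V.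
rewrite (le_trans (ler_nmB _ _)) // ; rewrite hs in H H'; lra.
Qed.

End CalculusZ.

Section Calculus2.
Context {R : realType} {V : normedModType R[i]}.
Local Notation K := R[i].
Implicit Types (f g : K -> V) (z : K).

Lemma cderivZr (a : K) f z d : cderiv f z d -> cderiv (fun w => a *: f w) z (a *: d).
Proof.
move=> H; have := cderivZ (@cderiv_cst R R[i]^o a z) H.
by rewrite scale0r add0r.
Qed.

Lemma cderivZl (k : K -> K) (v : V) z d : cderiv (k : K -> R[i]^o) z d ->
  cderiv (fun w => k w *: v) z (d *: v).
Proof.
move=> H; have := cderivZ H (cderiv_cst v z).
by rewrite scaler0 addr0.
Qed.

Lemma cderivN f z d : cderiv f z d -> cderiv (fun w => - f w) z (- d).
Proof.
move=> /(cderivZr (-1)); rewrite scaleN1r; apply: eq_cderiv => w.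
by rewrite scaleN1r.
Qed.

Lemma cderivB f g z df dg : cderiv f z df -> cderiv g z dg ->
  cderiv (fun w => f w - g w) z (df - dg).
Proof. by move=> Hf /cderivN Hg; apply: cderivD. Qed.

Lemma cderivM (k l : K -> K) z dk dl :
  cderiv (k : K -> R[i]^o) z dk -> cderiv (l : K -> R[i]^o) z dl ->
  cderiv (fun w => k w * l w : R[i]^o) z (dk * l z + k z * dl).
Proof. exact: cderivZ. Qed.

Lemma cderiv_inv z : z != 0 -> cderiv (fun w => w^-1 : R[i]^o) z (- z ^- 2).
Proof.
move=> z0 e e0; have nz0 : 0 < nm z by rewrite nm_gt0.
exists (Num.min (nm z / 2) (e * nm z ^+ 3 / 2)).
  by rewrite lt_min !divr_gt0 // mulr_gt0 // exprn_gt0.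
move=> h; rewrite lt_min => /andP[h1 h2].
have zh : nm z / 2 <= nm (z + h).
  by have := nm_lower z (- h); rewrite opprK nmN; lra.
have zh0 : z + h != 0 by rewrite -nm_gt0; lra.
rewrite [h *: _]/(h * _).
have -> : (z + h)^-1 - z^-1 - h * - z ^- 2 = h * (h / (z ^+ 2 * (z + h))).
  by field; rewrite z0 zh0.
rewrite nmM mulrC ler_wpM2r // nmM nmV nmM nmX ler_pdivrMr ?mulr_gt0 ?exprn_gt0 // ?nm_gt0 //.
rewrite (le_trans (ltW h2)) //.
have -> : e * nm z ^+ 3 / 2 = e * (nm z ^+ 2 * (nm z / 2)) by ring.
by rewrite ler_pM2l // ler_pM2l // exprn_gt0.
Qed.

Lemma cderivV (k : K -> K) z d : k z != 0 -> cderiv (k : K -> R[i]^o) z d ->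
  cderiv (fun w => (k w)^-1 : R[i]^o) z (- d / k z ^+ 2).
Proof.
move=> kz H; have := cderiv_comp H (cderiv_inv kz).
by rewrite [_ *: _]mulrN mulNr.
Qed.

Lemma cderivX (k : K -> K) n z d : cderiv (k : K -> R[i]^o) z d ->
  exists d', cderiv (fun w => k w ^+ n : R[i]^o) z d'.
Proof.
move=> H; elim: n => [|n [d' IH]].
  by exists 0; apply: eq_cderiv (@cderiv_cst R R[i]^o 1 z) => w; rewrite expr0.
by eexists; apply: eq_cderiv (cderivM H IH) => w; rewrite exprS.
Qed.

Lemma cderiv_sum n (F : 'I_n -> K -> V) z (D : 'I_n -> V) :
  (forall i, cderiv (F i) z (D i)) ->
  cderiv (fun w => \sum_(i < n) F i w) z (\sum_(i < n) D i).
Proof.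
elim: n F D => [|n IH] F D H.
  by rewrite big_ord0; apply: eq_cderiv (cderiv_cst 0 z) => w; rewrite big_ord0.
rewrite big_ord_recl; apply: eq_cderiv (cderivD (H ord0) (IH _ _ (fun i => H (lift ord0 i)))) => w.
by rewrite big_ord_recl.
Qed.

End Calculus2.

Section CderivAffine.
Context {R : realType} {V : normedModType R[i]}.
Local Notation K := R[i].
Implicit Types (f g : K -> V) (z : K).

Lemma cderiv_affine (a b : K) f z d : cderiv f (a + z * b) d ->
  cderiv (fun w => f (a + w * b)) z (b *: d).
Proof.
apply: (@cderiv_comp _ _ f (fun w => a + w * b)).
have := cderivD (@cderiv_cst R R[i]^o a z) (cderivZl (b : R[i]^o) (cderiv_id z)).
by rewrite add0r scale1r.
Qed.

End CderivAffine.

(** * The complex exponential *)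

Section Cexp.
Context {R : realType}.
Local Notation K := R[i].
Implicit Types (z w : K).

Lemma real_deriv_eps (f : R -> R) (x d : R) : is_derive x 1 f d ->
  forall e : R, 0 < e -> exists2 r : R, 0 < r &
    forall h, `|h| < r -> `|f (x + h) - f x - h * d| <= e * `|h|.
Proof.
move=> [df <-] e e0; have /derivable_nbhs/eqaddoP/(_ e e0) := df.
move=> /nbhs_norm0P[r r0 H]; exists r => // h hr.
have := H h hr; rewrite /= !fctE /= scaler1.
by rewrite opprD addrA (addrC h) [h *: _]/(h * _).
Qed.

Definition cexp (z : K) : K := (expR (complex.Re z))%:C * (cos (complex.Im z) +i* sin (complex.Im z)).

Lemma cexp0 : cexp 0 = 1.
Proof. by rewrite /cexp /= expR0 cos0 sin0 mul1r. Qed.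

Lemma cexpD z w : cexp (z + w) = cexp z * cexp w.
Proof.
case: z w => [x y] [x' y']; rewrite /cexp /= expRD sinD cosD; simpc.
by apply/eqP; rewrite eq_complex /=; apply/andP; split; apply/eqP; ring.
Qed.

Lemma nm_cis (t : R) : nm (cos t +i* sin t) = 1.
Proof.
apply/eqP; rewrite -(@eqrXn2 _ 2) ?ler01 // normc_nm /= cos2Dsin2 expr1n //.
Qed.

Lemma nm_cexp z : nm (cexp z) = expR (complex.Re z).
Proof. by rewrite nmM nm_cis mulr1 nmr ?expR_ge0. Qed.

Lemma cexp_neq0 z : cexp z != 0.
Proof. by rewrite -nm_gt0 nm_cexp expR_gt0. Qed.

Lemma cexpN z : cexp (- z) = (cexp z)^-1.
Proof. by apply: (mulIf (cexp_neq0 z)); rewrite -cexpD addNr cexp0 mulVf // cexp_neq0. Qed.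

Definition ipi2 : K := (pi *+ 2) *i.

Lemma cexp_ipi2 : cexp ipi2 = 1.
Proof. by rewrite /cexp /= expR0 cos2pi sin2pi mul1r. Qed.

Lemma nm_le_ReIm z : nm z <= `|complex.Re z| + `|complex.Im z|.
Proof.
rewrite -(@ler_pXn2r _ 2) ?nnegrE ?addr_ge0 // normc_nm sqrrD !real_normK ?num_real //.
by rewrite lerD2r lerDl mulrn_wge0 // mulr_ge0.
Qed.

Lemma nm_ge_Re z : `|complex.Re z| <= nm z.
Proof. by rewrite -lecR -nmE normc_ge_Re. Qed.

Lemma nm_ge_Im z : `|complex.Im z| <= nm z.
Proof.
rewrite -(@ler_pXn2r _ 2) ?nnegrE // normc_nm real_normK ?num_real //.
by rewrite lerDr sqr_ge0.
Qed.

Lemma cderiv_cexp0 : cderiv (cexp : K -> R[i]^o) 0 1.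
Proof.
(* The four errors below are at most 3, 1, 3 and 2 times [e1 * N]; [e1 <= 1] keeps [expR x] below
   3. *)
move=> e e0; pose e1 := Num.min (e / 9) 1.
have e10 : 0 < e1 by rewrite lt_min ltr01 divr_gt0.
have e11 : e1 <= 1 by rewrite /e1 ge_min lexx orbT.
have e1e : e1 <= e / 9 by rewrite /e1 ge_min lexx.
have [r1 r10 H1] := real_deriv_eps (is_derive_expR 0) e10.
have [r2 r20 H2] := real_deriv_eps (is_derive_cos 0) e10.
have [r3 r30 H3] := real_deriv_eps (is_derive_sin 0) e10.
clearbody e1; exists (Num.min (Num.min r1 r2) (Num.min r3 e1)); first by rewrite !lt_min r10 r20 r30.
move=> [x y]; rewrite !lt_min => /andP[/andP[h1 h2] /andP[h3 h4]].
have xh := nm_ge_Re (x +i* y); have yh := nm_ge_Im (x +i* y).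
set N := nm _ in h1 h2 h3 h4 xh yh *; rewrite /= in xh yh.
have := H1 _ (le_lt_trans xh h1); have := H2 _ (le_lt_trans yh h2).
have := H3 _ (le_lt_trans yh h3).
rewrite !add0r expR0 sin0 cos0 oppr0 !mulr0 !mulr1 !subr0 ?addr0 => {}H3 {}H2 {}H1.
have N0 : 0 <= N by exact: nm_ge0.
have e1x : e1 * `|x| <= e1 * N by rewrite ler_pM2l.
have e1y : e1 * `|y| <= e1 * N by rewrite ler_pM2l.
have ex2 : expR x <= 3.
  have x1 : `|x| <= 1 := ltW (le_lt_trans xh (lt_le_trans h4 e11)).
  have : e1 * `|x| <= 1 by rewrite mulr_ile1 // ltW.
  move: H1 x1; rewrite !ler_norml; lra.
have ex0 : 0 <= expR x by exact: expR_ge0.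
have ex1 : `|expR x - 1| <= 2 * N.
  have -> : expR x - 1 = (expR x - 1 - x) + x by ring.
  rewrite (le_trans (ler_normD _ _)) //.
  have : e1 * N <= N by rewrite ler_piMl.
  lra.
rewrite cexp0 [_ *: 1]mulr1.
rewrite (le_trans (nm_le_ReIm _)) // /cexp /=; simpc.
have -> : expR x * cos y - 1 - x = expR x * (cos y - 1) + (expR x - 1 - x) by ring.
have -> : expR x * sin y - y = expR x * (sin y - y) + (expR x - 1) * y by ring.
have p1 : `|expR x * (cos y - 1)| <= 3 * (e1 * N).
  by rewrite normrM ger0_norm // ler_pM // (le_trans H2).
have p2 : `|expR x * (sin y - y)| <= 3 * (e1 * N).
  by rewrite normrM ger0_norm // ler_pM // (le_trans H3).
have p3 : `|(expR x - 1) * y| <= 2 * (e1 * N).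
  rewrite normrM (_ : 2 * _ = (2 * N) * e1); last by ring.
  by rewrite ler_pM // (le_trans yh) // ltW.
have n1 := ler_normD (expR x * (cos y - 1)) (expR x - 1 - x).
have n2 := ler_normD (expR x * (sin y - y)) ((expR x - 1) * y).
have e1N : e1 * N <= e / 9 * N by rewrite ler_wpM2r.
apply: (le_trans (lerD n1 n2)); apply: (le_trans (lerD (lerD p1 H1) (lerD p2 p3))).
by lra.
Qed.

Lemma cderiv_cexp z : cderiv (cexp : K -> R[i]^o) z (cexp z).
Proof.
have H : cderiv (cexp : K -> R[i]^o) (- z + z * 1) 1 by rewrite mulr1 addNr; exact: cderiv_cexp0.
have := cderivZr (cexp z) (cderiv_affine H).
rewrite scale1r [_ *: 1]mulr1; apply: eq_cderiv => w.
have -> : cexp w = cexp z * cexp (- z + w * 1) by rewrite -cexpD; congr cexp; ring.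
by [].
Qed.

End Cexp.

(** * Goursat's lemma with exceptional corners, and explicit Riemann sums *)

Section GoursatCorners.
Context {R : realType} {V : normedModType R[i]}.
Local Notation K := R[i].
Implicit Types (f g : K -> V) (z a b : K).

Lemma small_loop_le f z a b (e e' : R) : e <= e' -> small_loop f z a b e -> small_loop f z a b e'.
Proof. by move=> ee' [N H]; exists N => n /H /le_trans; apply. Qed.

Lemma par_half z a b (k l : bool) x y :
  par (par z a b (k%:R / 2) (l%:R / 2)) (a / 2) (b / 2) x y =
  par z a b ((k%:R + x) / 2) ((l%:R + y) / 2).
Proof.
have h : (2^-1 : R)%:C = 2^-1 :> K by rewrite fmorphV rmorph_nat.
by rewrite /par !rmorphM !rmorphD /= h; ring.
Qed.

Lemma half_itv (k : bool) (x : R) : 0 <= x <= 1 -> 0 <= (k%:R + x) / 2 <= 1.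
Proof. by case: k => /=; lra. Qed.

(** Cut [m] times towards the corner [(i, j)]. The quarters away from it fall under [goursat]; the
    last one, whose perimeter has shrunk by 2^-m, is estimated by the bound [C] on [f]. *)
Lemma goursat_corner_pow f (i j : bool) (C : R) m z a b :
  (forall x y : R, 0 <= x <= 1 -> 0 <= y <= 1 -> (x, y) != (i%:R, j%:R) ->
     exists d, cderiv f (par z a b x y) d) ->
  (forall x y : R, 0 <= x <= 1 -> 0 <= y <= 1 ->
     `|x - i%:R| <= 2^-1 ^+ m -> `|y - j%:R| <= 2^-1 ^+ m -> nm (f (par z a b x y)) <= C) ->
  forall e : R, 0 < e -> small_loop f z a b (2 * (nm a + nm b) * C * 2^-1 ^+ m + e).
Proof.
elim: m z a b => [|m IH] z a b df bf e e0.
  exists 0%N => n _; rewrite expr0 mulr1.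
  rewrite (le_trans (@loopsum_le _ _ f n z a b C _)) ?lerDl ?ltW // => x y x01 y01.
  apply: bf => //; rewrite expr0 ler_norml; [case: (i)|case: (j)]; move=> /=; lra.
pose E k l := if (k == i) && (l == j) then
   2 * (nm (a / 2) + nm (b / 2)) * C * 2^-1 ^+ m + e / 4 else e / 4.
have e40 : 0 < e / 4 by rewrite divr_gt0.
apply: (@small_loop_le _ _ _ _ (E false false + E true false + (E false true + E true true))).
  rewrite /E !nm_half exprS; move: (2^-1 ^+ m) => p.
  by case: (i); case: (j) => /=; lra.
apply: small_loop_quarters => k l; rewrite /E.
have [/andP[/eqP -> /eqP ->]|nkl] := ifPn.
  apply: IH => //.
    move=> x y x01 y01 xy; rewrite par_half; apply: df; rewrite ?half_itv //.
    by apply: contraNN xy => /eqP[h1 h2]; apply/eqP; congr pair; lra.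
  move=> x y x01 y01 hx hy; rewrite par_half; apply: bf; rewrite ?half_itv //.
    rewrite (_ : _ - _ = (x - i%:R) / 2); last by lra.
    by rewrite normrM exprSr (ger0_norm (_ : 0 <= 2^-1)) ?invr_ge0 // ler_wpM2r ?invr_ge0.
  rewrite (_ : _ - _ = (y - j%:R) / 2); last by lra.
  by rewrite normrM exprSr (ger0_norm (_ : 0 <= 2^-1)) ?invr_ge0 // ler_wpM2r ?invr_ge0.
apply: goursat => // x y x01 y01; rewrite par_half; apply: df; rewrite ?half_itv //.
apply: contraNN nkl => /eqP[h1 h2].
by move: h1 h2; case: (k); case: (l); case: (i); case: (j) => //= h1 h2; lra.
Qed.

Lemma exp_half_lt (e : R) : 0 < e -> exists m, 2^-1 ^+ m < e.
Proof.
move=> e0; have : (2^-1 : R) ^+ m @[m --> \oo] --> 0.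
  by apply: cvg_expr; rewrite ger0_norm ?invr_ge0 // invf_lt1 // ltr1n.
move=> /cvgr0Pnorm_lt /(_ _ e0) [m _ /(_ m (leqnn m)) /=].
by rewrite gtr0_norm ?exprn_gt0 ?invr_gt0 // => hm; exists m.
Qed.

Lemma goursat_corner f (i j : bool) z a b :
  (forall x y : R, 0 <= x <= 1 -> 0 <= y <= 1 -> (x, y) != (i%:R, j%:R) ->
     exists d, cderiv f (par z a b x y) d) ->
  (exists C r : R, 0 < r /\ forall x y : R,
     `|x - i%:R| <= r -> `|y - j%:R| <= r -> nm (f (par z a b x y)) <= C) ->
  forall e : R, 0 < e -> small_loop f z a b e.
Proof.
move=> df [C [r [r0 bf]]] e e0.
have C0 : 0 <= C.
  by rewrite (le_trans (nm_ge0 _) (bf i%:R j%:R _ _)) // subrr normr0 ltW.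
pose L := 2 * (nm a + nm b) * C.
have L0 : 0 <= L by rewrite !mulr_ge0 // addr_ge0.
have e20 : 0 < e / 2 by rewrite divr_gt0.
have q0 : 0 < Num.min r (e / 2 / (L + 1)) by rewrite lt_min r0 divr_gt0 // ltr_wpDl.
have [m] := exp_half_lt q0; rewrite lt_min => /andP[mr mL].
apply: (small_loop_le _ (@goursat_corner_pow f i j C m z a b df _ (e / 2) e20)).
  rewrite -/L; move: mL; rewrite ltr_pdivlMr ?ltr_wpDl // => mL.
  have : L * 2^-1 ^+ m <= 2^-1 ^+ m * (L + 1).
    by rewrite mulrC ler_wpM2l ?exprn_ge0 ?invr_ge0 // lerDl.
  lra.
by move=> x y _ _ hx hy; apply: bf; apply: le_trans (ltW mr).
Qed.

(** Each quarter contains a single exceptional corner. All four are needed later: in logarithmic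
    coordinates a point of a circle occurs at both ends of a period, and two circles are
    involved. *)
Lemma goursat_corners f z a b :
  (forall x y : R, 0 <= x <= 1 -> 0 <= y <= 1 -> (0 < x < 1) || (0 < y < 1) ->
     exists d, cderiv f (par z a b x y) d) ->
  (forall i j : bool, exists C r : R, 0 < r /\ forall x y : R,
     `|x - i%:R| <= r -> `|y - j%:R| <= r -> nm (f (par z a b x y)) <= C) ->
  forall e : R, 0 < e -> small_loop f z a b e.
Proof.
move=> df bf e e0; have e40 : 0 < e / 4 by rewrite divr_gt0.
apply: (@small_loop_le _ _ _ _ (e / 4 + e / 4 + (e / 4 + e / 4))); first by lra.
apply: (@small_loop_quarters _ _ _ _ _ _ (fun _ _ => e / 4)) => k l.
apply: (@goursat_corner f k l) => //.
  move=> x y x01 y01 xy; rewrite par_half; apply: df; rewrite ?half_itv //.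
  apply/orP; move: xy; rewrite xpair_eqE negb_and => /orP[xk|yl]; [left|right].
    by move: xk; case: (k) => xk; rewrite -[X in _ < X < _]addr0; move: xk => /=;
      rewrite neq_lt => /orP[]; lra.
  by move: yl; case: (l) => yl; rewrite -[X in _ < X < _]addr0; move: yl => /=;
    rewrite neq_lt => /orP[]; lra.
have [C [r [r0 H]]] := bf k l; exists C, r; split => // x y hx hy.
rewrite par_half; apply: H.
  rewrite (_ : _ - _ = (x - k%:R) / 2); last by lra.
  rewrite normrM (ger0_norm (_ : 0 <= 2^-1)) ?invr_ge0 //; have := normr_ge0 (x - k%:R); lra.
rewrite (_ : _ - _ = (y - l%:R) / 2); last by lra.
rewrite normrM (ger0_norm (_ : 0 <= 2^-1)) ?invr_ge0 //; have := normr_ge0 (y - l%:R); lra.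
Qed.

Lemma cvg0_nmP (u : nat -> V) :
  u n @[n --> \oo] --> (0 : V) <->
  forall e : R, 0 < e -> exists N, forall n, (N <= n)%N -> nm (u n) <= e.
Proof.
split=> [/cvgr0Pnorm_le H e e0|H].
  have e0' : 0 < e%:C by rewrite ltcR.
  have [N _ HN] := H _ e0'; exists N => n Nn.
  by have := HN n Nn; rewrite /= nmE lecR.
apply/cvgr0Pnorm_le => e; case: e => x y; rewrite ltcE /= => /andP[/eqP -> x0].
by have [N HN] := H x x0; exists N => // n Nn /=; rewrite nmE lecR HN.
Qed.

Lemma segsumE f n z a : segsum f n z a =
  (a / 2 ^+ n) *: \sum_(0 <= k < 2 ^ n) f (z + k%:R / 2 ^+ n * a).
Proof.
elim: n z a => [|n IH] z a /=.
  by rewrite expr0 divr1 expn0 big_nat1 mul0r mul0r addr0.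
have split_sum (F : nat -> V) m : \sum_(0 <= k < m + m) F k =
    \sum_(0 <= k < m) F k + \sum_(0 <= k < m) F (k + m)%N.
  by rewrite (@big_cat_nat _ _ _ m) //= ?leq_addr // -{2}[m]add0n big_addn addnK.
rewrite !IH expnS mul2n -addnn split_sum scalerDr exprS invfM mulrA.
by congr (_ *: _ + _ *: _); apply: eq_bigr => k _; congr f;
  rewrite ?natrD ?natrX; field; rewrite expf_neq0.
Qed.

End GoursatCorners.

(** * Circular means and Cauchy's formula *)

Section CircleMeans.
Context {R : realType} {V : normedModType R[i]}.
Local Notation K := R[i].
Implicit Types (f g : K -> V) (z a b c : K).

(** The discrete form of (1 / (2 pi i)) times the integral of f(z) dz / z over the circle through
    [c]. The argument of [c] fixes where the sampling starts, which matters when an exceptional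
    point lies on the circle. *)
Definition cmean f n c : V :=
  (2 ^+ n)^-1 *: \sum_(0 <= k < 2 ^ n) f (c * cexp (k%:R / 2 ^+ n * ipi2)).

(** The exponential unrolls the circle onto a vertical segment of length 2 pi, whose dyadic
    subdivision points go to rotated roots of unity. *)
Lemma segsum_circle f n c z :
  segsum (fun w => f (c * cexp w)) n z ipi2 = ipi2 *: cmean f n (c * cexp z).
Proof.
rewrite segsumE /cmean scalerA; congr (_ *: _); apply: eq_bigr => k _.
by rewrite cexpD mulrA.
Qed.

Lemma cexpD_ipi2 z : cexp (z + ipi2) = cexp z.
Proof. by rewrite cexpD cexp_ipi2 mulr1. Qed.

(** By periodicity of [cexp], the two sides in direction [a] carry the same sum; only the two
    circles remain. *)
Lemma loopsum_circle f n c a :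
  loopsum (fun w => f (c * cexp w)) n 0 a ipi2 = ipi2 *: (cmean f n (c * cexp a) - cmean f n c).
Proof.
rewrite /loopsum !segsum_circle add0r cexp0 mulr1.
rewrite (_ : segsum _ n (0 + ipi2) a = segsum (fun w => f (c * cexp w)) n 0 a); last first.
  by rewrite !segsumE; congr (_ *: _); apply: eq_bigr => k _; rewrite !add0r (addrC ipi2) cexpD_ipi2.
by vmod K V.
Qed.

Lemma ipi2_gt0 : 0 < nm (ipi2 : K).
Proof.
by rewrite nm_gt0 /ipi2 eq_complex /= negb_and mulrn_eq0 /= (gt_eqF (pi_gt0 R)) orbT.
Qed.

Lemma loop_cmean f c a :
  (forall e : R, 0 < e -> small_loop (fun w => f (c * cexp w)) 0 a ipi2 e) ->
  cmean f n (c * cexp a) - cmean f n c @[n --> \oo] --> (0 : V).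
Proof.
move=> H; apply/cvg0_nmP => e e0; have [|N HN] := H (nm (ipi2 : K) * e).
  by rewrite mulr_gt0 // ipi2_gt0.
exists N => n /HN; rewrite loopsum_circle nmZ ler_pM2l //; exact: ipi2_gt0.
Qed.

Lemma cderiv_circle f c w d : cderiv f (c * cexp w) d ->
  cderiv (fun w => f (c * cexp w)) w ((c * cexp w) *: d).
Proof. by apply: (@cderiv_comp _ _ f (fun w => c * cexp w)); exact: cderivZr (cderiv_cexp w). Qed.

Lemma cis_polar (z : K) : nm z = 1 -> exists t, z = cos t +i* sin t.
Proof.
case: z => x y h; have xy : x ^+ 2 + y ^+ 2 = 1 by rewrite -(normc_nm (x +i* y)) h expr1n.
have y2 : y ^+ 2 = 1 - x ^+ 2 by rewrite -xy addrC addKr.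
have x1 : -1 <= x <= 1.
  have : x ^+ 2 <= 1 by rewrite -xy lerDl sqr_ge0.
  by move=> x21; apply/andP; split; nra.
have [y0|y0] := leP 0 y.
  exists (acos x); rewrite acosK // sin_acos // -y2 sqrtr_sqr ger0_norm //.
exists (- acos x); rewrite cosN sinN acosK // sin_acos // -y2 sqrtr_sqr.
by rewrite ltr0_norm // opprK.
Qed.

Lemma cexp_surj z : z != 0 -> exists2 w, cexp w = z & complex.Re w = ln (nm z).
Proof.
move=> z0; have nz : 0 < nm z by rewrite nm_gt0.
have [|t zt] := @cis_polar (z / (nm z)%:C).
  by rewrite nmM nmV nmr ?(ltW nz) // divff // gt_eqF.
exists (ln (nm z) +i* t) => //; rewrite /cexp /= lnK ?posrE // -zt mulrC divfK //.
by rewrite -nm_gt0 nmr // ltW.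
Qed.

Lemma nm_circle c a x y :
  nm (c * cexp (par 0 a ipi2 x y)) = nm c * expR (x * complex.Re a).
Proof.
rewrite nmM nm_cexp; congr (_ * expR _); case: a => a1 a2.
by rewrite /par /ipi2 /=; ring.
Qed.

(** The annulus is the image of a parallelogram under w |-> c exp w, with sides 2 pi i and a
    logarithm [a] of c' / c; it is oblique when [c] and [c'] have different arguments. *)
Lemma cmean_annulus f c c' : c != 0 -> nm c <= nm c' ->
  (forall w, nm c <= nm w <= nm c' -> exists d, cderiv f w d) ->
  cmean f n c' - cmean f n c @[n --> \oo] --> (0 : V).
Proof.
move=> c0 cc' df.
have nc0 : 0 < nm c by rewrite nm_gt0.
have [|a ca ra] := @cexp_surj (c' / c).
  by rewrite mulf_neq0 ?invr_eq0 // -nm_gt0 (lt_le_trans nc0).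
have -> : c' = c * cexp a by rewrite ca mulrC divfK.
apply: loop_cmean => e e0; apply: goursat => // x y x01 y01.
have [|d hd] := df (c * cexp (par 0 a ipi2 x y)); last first.
  by exists ((c * cexp (par 0 a ipi2 x y)) *: d); apply: cderiv_circle.
have ra0 : 0 <= complex.Re a by rewrite ra ln_ge0 // nmM nmV ler_pdivlMr // mul1r.
have era : expR (complex.Re a) = nm c' / nm c.
  by rewrite -nm_cexp ca nmM nmV.
rewrite nm_circle; apply/andP; split.
  by rewrite ler_peMr // -expR0 ler_expR mulr_ge0 //; case/andP: x01.
rewrite mulrC -ler_pdivlMr // -era ler_expR ler_piMl //; by case/andP: x01.
Qed.

Definition locally_bounded f z :=
  exists C r : R, 0 < r /\ forall h, nm h < r -> nm (f (z + h)) <= C.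

Lemma cderiv_locally_bounded f z d : cderiv f z d -> locally_bounded f z.
Proof.
move=> /cderiv_cont/(_ 1 ltr01)[r r0 H]; exists (nm (f z) + 1), r; split => // h /H{}H.
by rewrite -[f (z + h)](subrK (f z)) (le_trans (ler_nmD _ _)) // addrC lerD2l.
Qed.

Lemma cexp_ipi2_neq1 (y : R) : 0 < y < 1 -> cexp (y%:C * ipi2) != 1.
Proof.
move=> /andP[y0 y1]; have -> : y%:C * ipi2 = 0 +i* ((y * pi) *+ 2).
  by apply/eqP; rewrite eq_complex /=; apply/andP; split; apply/eqP; ring.
rewrite /cexp /= expR0 mul1r.
rewrite eq_complex /= negb_and; apply/orP; left.
rewrite cos_mulr2n cos2sin2 mulrnBl lt_eqF //.
have : 0 < sin (y * pi) ^+ 2.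
  by rewrite exprn_gt0 // sin_gt0_pi // mulr_gt0 ?pi_gt0 //= gtr_pMl // pi_gt0.
rewrite !mulr2n; lra.
Qed.

Lemma corner_bounded f c a (p : K) (i j : bool) :
  c * cexp (par 0 a ipi2 i%:R j%:R) = p -> locally_bounded f p ->
  exists C r : R, 0 < r /\ forall x y : R,
    `|x - i%:R| <= r -> `|y - j%:R| <= r -> nm (f (c * cexp (par 0 a ipi2 x y))) <= C.
Proof.
move=> cp [C [r [r0 H]]]; set w0 := par _ _ _ _ _ in cp.
have r20 : 0 < r / 2 by rewrite divr_gt0.
have [r' r'0 H'] := cderiv_cont (@cderivZr R R[i]^o c _ _ _ (cderiv_cexp w0)) r20.
pose L := nm a + nm (ipi2 : K) + 1.
have L0 : 0 < L by rewrite ltr_wpDl // addr_ge0.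
exists C, (r' / (2 * L)); split; first by rewrite divr_gt0 // mulr_gt0.
move=> x y hx hy.
have -> : c * cexp (par 0 a ipi2 x y) = p + (c * cexp (par 0 a ipi2 x y) - p) by ring.
apply: H; apply: (le_lt_trans _ (_ : r / 2 < r)); last by lra.
have -> : par 0 a ipi2 x y = w0 + ((x - i%:R)%:C * a + (y - j%:R)%:C * ipi2).
  by rewrite /w0 /par !rmorphB /=; ring.
rewrite -cp; apply: H'; apply: (le_lt_trans (ler_nmD _ _)).
rewrite !nmM !nm_real.
have h1 : `|x - i%:R| * nm a <= r' / (2 * L) * nm a by rewrite ler_wpM2r.
have h2 : `|y - j%:R| * nm (ipi2 : K) <= r' / (2 * L) * nm (ipi2 : K) by rewrite ler_wpM2r.
apply: (le_lt_trans (lerD h1 h2)); rewrite -mulrDr.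
have -> : r' / (2 * L) * (nm a + nm (ipi2 : K)) = r' * ((nm a + nm (ipi2 : K)) / (2 * L)).
  by field; rewrite gt_eqF.
rewrite gtr_pMr // ltr_pdivrMr ?mulr_gt0 // /L.
by have := nm_ge0 a; have := nm_ge0 (ipi2 : K); lra.
Qed.

(** Since c' / c is a positive real, [a] is real and the exceptional points [c] and [c'] are met
    only at the corners of the rectangle, where boundedness is enough. *)
Lemma cmean_annulus_exc f c c' : c != 0 -> nm c < nm c' -> (c' / c = (nm c' / nm c)%:C) ->
  (forall w, nm c <= nm w <= nm c' -> w != c -> w != c' -> exists d, cderiv f w d) ->
  locally_bounded f c -> locally_bounded f c' ->
  cmean f n c' - cmean f n c @[n --> \oo] --> (0 : V).
Proof.
move=> c0 cc' quot df bc bc'.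
have nc0 : 0 < nm c by rewrite nm_gt0.
have nc'0 : 0 < nm c' by rewrite (lt_trans nc0).
pose s := ln (nm c' / nm c); pose a : K := s%:C.
have s0 : 0 < s by rewrite ln_gt0 // ltr_pdivlMr // mul1r.
have ca : cexp a = c' / c.
  by rewrite quot /cexp /= cos0 sin0 lnK ?posrE ?divr_gt0 // mulr1.
have ec' : c' = c * cexp a by rewrite ca mulrC divfK.
have es : expR s = nm c' / nm c by rewrite lnK // posrE divr_gt0.
rewrite {1}ec'; apply: loop_cmean => e e0; apply: goursat_corners => //; last first.
  move=> i j; apply: (@corner_bounded f c a (if i then c' else c)); last by case: ifP.
  rewrite /par add0r cexpD (_ : cexp (j%:R%:C * ipi2) = 1) ?mulr1; last first.
    by case: j; rewrite ?rmorph1 ?mul1r ?cexp_ipi2 // rmorph0 mul0r cexp0.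
  by case: i; rewrite ?rmorph1 ?mul1r -?ec' // rmorph0 mul0r cexp0 mulr1.
move=> x y x01 y01 xy.
have [|||d hd] := df (c * cexp (par 0 a ipi2 x y)); last first.
- by exists ((c * cexp (par 0 a ipi2 x y)) *: d); apply: cderiv_circle.
(* Comparing moduli gives x = 1; then exp(2 pi i y) = 1 excludes 0 < y < 1, so that the point is a
   corner. *)
- apply: contraTneq xy => H.
  have x1 : x = 1.
    have := congr1 (@nm R K) H; rewrite nm_circle /= => H2.
    have : expR (x * s) = expR s by rewrite es -H2; field; rewrite gt_eqF.
    by move=> /expR_inj; rewrite -[RHS]mul1r => /(mulIf (lt0r_neq0 s0)).
  rewrite x1 ltxx andbF /=; apply/negP => /cexp_ipi2_neq1/eqP; apply.
  apply: (mulfI (cexp_neq0 a)); apply: (mulfI c0); rewrite mulr1 -ec' -H x1.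
  by rewrite /par rmorph1 cexpD mul1r add0r.
- apply: contraTneq xy => H.
  have x1 : x = 0.
    have := congr1 (@nm R K) H; rewrite nm_circle /= => H2.
    have : expR (x * s) = expR 0 by rewrite expR0; apply: (mulfI (lt0r_neq0 nc0)); rewrite mulr1.
    by move=> /expR_inj /eqP; rewrite mulf_eq0 (gt_eqF s0) orbF => /eqP.
  rewrite x1 ltxx /=; apply/negP => /cexp_ipi2_neq1/eqP; apply.
  apply: (mulfI c0); rewrite mulr1 -[RHS]H x1.
  by rewrite /par rmorph0 mul0r !add0r.
rewrite nm_circle /=; apply/andP; split.
  by rewrite ler_peMr // -expR0 ler_expR mulr_ge0 ?(ltW s0) //; case/andP: x01.
rewrite mulrC -ler_pdivlMr // -es ler_expR ler_piMl ?(ltW s0) //; by case/andP: x01.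
Qed.

End CircleMeans.

Section Limits.
Context {R : realType} {V : normedModType R[i]}.
Local Notation K := R[i].

Lemma cvg_nmP (u : nat -> V) (l : V) :
  u n @[n --> \oo] --> l <->
  forall e : R, 0 < e -> exists N, forall n, (N <= n)%N -> nm (u n - l) <= e.
Proof.
by rewrite -subr_cvg0; exact: cvg0_nmP.
Qed.

Lemma cvg_nm_le (u : nat -> V) l (C : R) :
  u n @[n --> \oo] --> l -> (forall n, nm (u n) <= C) -> nm l <= C.
Proof.
move=> /cvg_nmP H uC; apply/ler_addgt0Pr => e e0; have [N /(_ N (leqnn N)) HN] := H e e0.
by have := nm_lower l (u N); rewrite nm_distC; have := uC N; lra.
Qed.

Lemma cvg_nm_le_near (u : nat -> V) l (C : R) N :
  u n @[n --> \oo] --> l -> (forall n, (N <= n)%N -> nm (u n) <= C) -> nm l <= C.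
Proof.
move=> ul uC; apply: (@cvg_nm_le [sequence u (n + N)%N]_n); first by rewrite cvg_shiftn.
by move=> n; apply: uC; rewrite leq_addl.
Qed.

End Limits.

Lemma nm_cauchy_cvg (R : realType) (V : completeNormedModType R[i]) (u : nat -> V) :
  (forall e : R, 0 < e -> exists N, forall n m, (N <= n)%N -> (N <= m)%N ->
     nm (u n - u m) <= e) -> exists l : V, u n @[n --> \oo] --> l.
Proof.
move=> H; suff : cvg (u n @[n --> \oo]) by move=> /cvg_ex[l ul]; exists l.
apply: cauchy_cvg; apply/(cauchy_ballP (u n @[n --> \oo])) => e.
case: e => x y; rewrite ltcE /= => /andP[/eqP -> x0].
have [|N HN] := H (x / 2); first by rewrite divr_gt0.
pose A := [set v | exists2 n, (N <= n)%N & v = u n].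
exists (A, A); first by split; exists N => // n Nn; exists n.
move=> [_ _] /= [[n Nn ->] [m Nm ->]]; rewrite -ball_normE /= nmE ltcR.
by apply: (le_lt_trans (HN _ _ Nn Nm)); lra.
Qed.

(** * The mean value property *)

Section MeanValue.
Context {R : realType} {V : normedModType R[i]}.
Local Notation K := R[i].
Implicit Types (f g : K -> V) (z w c : K).

Lemma cmeanB f g n c : cmean (fun w => f w - g w) n c = cmean f n c - cmean g n c.
Proof. by rewrite /cmean -scalerBr -sumrB. Qed.

Lemma cmeanD f g n c : cmean (fun w => f w + g w) n c = cmean f n c + cmean g n c.
Proof. by rewrite /cmean -scalerDr -big_split. Qed.

Lemma cmeanZ (k : K) f n c : cmean (fun w => k *: f w) n c = k *: cmean f n c.
Proof. by rewrite /cmean -scaler_sumr !scalerA mulrC. Qed.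

Lemma cmean_cst (v : V) n c : cmean (fun=> v) n c = v.
Proof.
rewrite /cmean big_const_nat iter_addr_0 subn0.
have -> : v *+ 2 ^ n = (2 ^+ n : K) *: v by rewrite -natrX scaler_nat.
by rewrite scalerA mulVf ?scale1r // expf_neq0.
Qed.

Lemma nm_root_of_unity (k n : nat) : nm (cexp (k%:R / 2 ^+ n * ipi2) : K) = 1.
Proof.
have -> : k%:R / 2 ^+ n * ipi2 = par 0 0 ipi2 0 (k%:R / 2 ^+ n) :> K.
  by rewrite /par !(rmorphM, rmorph_nat, fmorphV, rmorphXn, mulr0, add0r).
by have := @nm_circle R 1 0 0 (k%:R / 2 ^+ n); rewrite !mul1r mul0r expR0 nm1 mulr1.
Qed.

Lemma eq_cmean f g n c : (forall w, nm w = nm c -> f w = g w) -> cmean f n c = cmean g n c.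
Proof.
move=> fg; congr (_ *: _); apply: eq_bigr => k _; apply: fg.
by rewrite nmM nm_root_of_unity mulr1.
Qed.

Lemma cmean_le f n c (C : R) : (forall w, nm w = nm c -> nm (f w) <= C) -> nm (cmean f n c) <= C.
Proof.
move=> fC; have n0 : 0 < (2 : R) ^+ n by rewrite exprn_gt0.
rewrite nmZ nmV nmX (_ : nm (2 : K) = 2); last first.
  by rewrite -(rmorph_nat (real_complex R)) nmr.
rewrite ler_pdivrMl // (le_trans (ler_nm_sum _ _ _)) //.
apply: (@le_trans _ _ (\sum_(0 <= k < 2 ^ n) C)).
  by apply: ler_sum => k _; apply: fC; rewrite nmM nm_root_of_unity mulr1.
by rewrite big_const_nat iter_addr_0 subn0 -[C *+ _]mulr_natl natrX.
Qed.

(** A limit through nonzero arguments: it applies to difference quotients, whose value at 0 is the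
    default one given by [0^-1 = 0]. *)
Definition has_limit0 f (v : V) := forall e : R, 0 < e ->
  exists2 r : R, 0 < r & forall h, 0 < nm h < r -> nm (f h - v) <= e.

Lemma nm_scale (t : R) c : 0 <= t -> nm (t%:C * c) = t * nm c.
Proof. by move=> t0; rewrite nmM nmr. Qed.

(** The circle is shrunk until [f] is within e / 2 of [v] on it; this controls the mean on the small
    circle for all [n] at once, and the two means differ by a null sequence. *)
Lemma cmean_mvp f (v : V) c : c != 0 ->
  (forall w, 0 < nm w <= nm c -> exists d, cderiv f w d) -> has_limit0 f v ->
  cmean f n c @[n --> \oo] --> v.
Proof.
move=> c0 df fv; have nc0 : 0 < nm c by rewrite nm_gt0.
apply/cvg_nmP => e e0; have e20 : 0 < e / 2 by rewrite divr_gt0.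
have [r r0 H] := fv _ e20.
pose t := Num.min 1 (r / 2 / nm c).
have t0 : 0 < t by rewrite lt_min ltr01 !divr_gt0.
have t1 : t <= 1 by rewrite ge_min lexx.
have tr : t * nm c < r.
  apply: (@le_lt_trans _ _ (r / 2)); last by lra.
  by rewrite -ler_pdivlMr // ge_min lexx orbT.
clearbody t; pose c' := t%:C * c.
have nc' : nm c' = t * nm c by rewrite nm_scale // ltW.
have c'0 : 0 < nm c' by rewrite nc' mulr_gt0.
have [|||] // := (cvg0_nmP _).1 (@cmean_annulus _ _ f c' c _ _ _) (e / 2) e20.
- by rewrite -nm_gt0.
- by rewrite nc' ler_piMl // ltW.
- by move=> w /andP[w1 w2]; apply: df; rewrite w2 (lt_le_trans c'0).
move=> N HN; exists N => n /HN {}HN.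
rewrite (le_trans (nm_dist_tri _ (cmean f n c') _)) //.
have : nm (cmean f n c' - v) <= e / 2; last by lra.
rewrite -[v in _ - v](cmean_cst v n c') -cmeanB; apply: cmean_le => w wc'.
by apply: H; rewrite wc' c'0 nc'.
Qed.

(** The circle has to cross [w], where [f] is only bounded. It is rotated so as to start on the ray
    through [w], contracted to the circle starting at [w], and then to one inside; on the last two
    moves [w] is a corner. *)
Lemma cmean_mvp_exc f (v : V) c w : w != 0 -> nm w < nm c ->
  (forall z, 0 < nm z <= nm c -> z != w -> exists d, cderiv f z d) ->
  locally_bounded f w -> has_limit0 f v ->
  cmean f n c @[n --> \oo] --> v.
Proof.
move=> w0 wc df bw fv; have nw0 : 0 < nm w by rewrite nm_gt0.
(* The point of the circle of [c] on the ray through [w]. *)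
pose c' := (nm c / nm w)%:C * w.
have nc' : nm c' = nm c by rewrite nm_scale ?divr_ge0 // divfK // gt_eqF.
have c'w : c' != w by apply/eqP => c'w; move: wc; rewrite -nc' c'w ltxx.
have bd z : 0 < nm z <= nm c -> z != w -> locally_bounded f z.
  by move=> z1 z2; have [d /cderiv_locally_bounded] := df z z1 z2.
have nc0 : 0 < nm c by rewrite (lt_trans nw0).
apply: (cvg_sub0 (g := fun n => cmean f n c')).
  apply: cmean_annulus; rewrite ?nc' // -?nm_gt0 ?nc' // => z zc; apply: df.
    by rewrite -(le_anti zc) nc0 lexx.
  by apply: contraTneq wc => <-; rewrite (le_anti zc) ltxx.
apply: (cvg_sub0 (g := fun n => cmean f n w)).
  apply: cmean_annulus_exc => //; rewrite ?nc' //.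
  - by rewrite /c' mulfK.
  - by move=> z /andP[z1 z2] zw zc'; apply: df; rewrite // z2 (lt_le_trans nw0).
  - by apply: bd; rewrite // nc' lexx nc0.
pose w' := (2^-1)%:C * w.
have nw' : nm w' = nm w / 2 by rewrite nm_scale ?invr_ge0 // mulrC.
have w'0 : w' != 0 by rewrite -nm_gt0 nw' divr_gt0.
have w'w : w' != w by apply/eqP => w'w; move: nw'; rewrite w'w; lra.
apply: (cvg_sub0 (g := fun n => cmean f n w')).
  apply: cmean_annulus_exc => //; rewrite ?nw' //.
  - by lra.
  - rewrite -[w in w / _]mul1r /w' invfM mulrACA divff // mulr1 mul1r -fmorphV /= invrK.
    by congr (_ %:C); field; rewrite gt_eqF.
  - move=> z /andP[z1 z2] zw' zw; apply: df => //; lra.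
  - apply: bd => //; rewrite nw'; lra.
apply: cmean_mvp => // z; rewrite nw' => /andP[z0 z1]; apply: df; first by lra.
by apply: contraTneq z1 => ->; rewrite -ltNge; lra.
Qed.

End MeanValue.

(** * Cauchy's formula for divided differences and its estimates *)

Section CauchyKernel.
Context {R : realType}.
Local Notation K := R[i].

Lemma cderiv_sub (w z : K) : cderiv (fun z => z - w : R[i]^o) z 1.
Proof. by have := cderivB (cderiv_id z) (@cderiv_cst R R[i]^o w z); rewrite subr0. Qed.

Lemma cderiv_sub_inv (w z : K) : z != w -> exists d, cderiv (fun z => (z - w)^-1 : R[i]^o) z d.
Proof.
by move=> zw; eexists; apply: cderivV (cderiv_sub w z); rewrite subr_eq0.
Qed.

(** The circle is pushed outwards until [f] is small on it. *)
Lemma cmean_decay (V : normedModType R[i]) (f : K -> V) c : c != 0 ->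
  (forall z, nm c <= nm z -> exists d, cderiv f z d) ->
  (forall e : R, 0 < e -> exists M : R, forall z, M <= nm z -> nm (f z) <= e) ->
  cmean f n c @[n --> \oo] --> (0 : V).
Proof.
move=> c0 df dec; apply/cvg0_nmP => e e0; have e20 : 0 < e / 2 by rewrite divr_gt0.
have nc0 : 0 < nm c by rewrite nm_gt0.
have [M HM] := dec _ e20.
pose t := 1 + `|M| / nm c.
have t1 : 1 <= t by rewrite lerDl divr_ge0.
pose c' := t%:C * c.
have nc' : nm c' = nm c + `|M|.
  by rewrite nm_scale ?(le_trans ler01) // /t; field; rewrite gt_eqF.
have cc' : nm c <= nm c' by rewrite nc' lerDl.
have [|N HN] := (cvg0_nmP _).1 (@cmean_annulus _ _ f c c' c0 cc' _) (e / 2) e20.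
  by move=> z /andP[z1 _]; apply: df.
exists N => n /HN {}HN; rewrite -(subr0 (cmean _ _ _)).
rewrite (le_trans (nm_dist_tri _ (cmean f n c') _)) //.
rewrite subr0; apply: (@le_trans _ _ (e / 2 + e / 2)); last by lra.
rewrite lerD // 1?nm_distC //; apply: cmean_le => z zc'; apply: HM.
by rewrite zc' nc' (le_trans (ler_norm M)) // lerDr.
Qed.

Lemma cmean_sub_inv (w c : K) : nm w < nm c ->
  cmean (fun z => (z - w)^-1 : R[i]^o) n c @[n --> \oo] --> (0 : R[i]^o).
Proof.
move=> wc; apply: cmean_decay.
- by rewrite -nm_gt0 (le_lt_trans _ wc).
- by move=> z zc; apply: cderiv_sub_inv; apply: contraTneq wc => <-; rewrite -leNgt.
move=> e e0; exists (nm w + e^-1) => z zM.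
have p0 : 0 < e^-1 by rewrite invr_gt0.
have : e^-1 <= nm (z - w) by have := nm_lower z w; lra.
by move=> H; rewrite nmV -[e]invrK lef_pV2 // posrE (lt_le_trans p0).
Qed.

End CauchyKernel.

Section Cauchy.
Context {R : realType} {V : normedModType R[i]}.
Local Notation K := R[i].
Implicit Types (f g : K -> V) (z w c : K).

Lemma cvgZ_nm (a : nat -> R[i]^o) (k : K) (v : V) :
  a n @[n --> \oo] --> (k : R[i]^o) -> a n *: v @[n --> \oo] --> k *: v.
Proof. by move=> H; exact: cvgZr_tmp. Qed.

Lemma cmeanZl (k : K -> K) (v : V) n c :
  cmean (fun z => k z *: v) n c = cmean (k : K -> R[i]^o) n c *: v.
Proof. by rewrite /cmean -scaler_suml scalerA. Qed.

(** Circular means integrate against dz / z, so the kernel 1 / (z - w) picks up residues both at [w]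
    and at 0; their sum is a divided difference. The function [G] is bounded near [w] and tends to 0
    at 0, hence has mean 0 in the limit. *)
Lemma cauchy_kernel f c w : w != 0 -> nm w < nm c ->
  (forall z, 0 < nm z <= nm c -> exists d, cderiv f z d) -> has_limit0 f (f 0) ->
  cmean (fun z => (z - w)^-1 *: f z) n c @[n --> \oo] --> w^-1 *: (f w - f 0).
Proof.
move=> w0 wc df f0; have nw0 : 0 < nm w by rewrite nm_gt0.
have c0 : c != 0 by rewrite -nm_gt0 (lt_trans nw0).
pose G z := (z * (z - w)^-1) *: (f z - f w).
have [|d fd] := df w; first by rewrite nw0 ltW.
have G0 : cmean G n c @[n --> \oo] --> (0 : V).
  apply: (@cmean_mvp_exc _ _ _ _ _ w) => //.
  - move=> z zc zw; have [d' fd'] := df z zc; have [e he] := cderiv_sub_inv zw.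
    eexists; apply: cderivZ; first exact: cderivM (cderiv_id z) he.
    exact: cderivB fd' (cderiv_cst _ _).
  - have [r r0 H] := cderiv_lip fd.
    exists ((nm w + r) * (nm d + 1)), r; split => // h hr.
    rewrite /G (_ : w + h - w = h) ?(addrC w) ?addrK // nmZ nmM nmV -mulrA ler_pM //.
    + by rewrite mulr_ge0 // invr_ge0.
    + by rewrite (le_trans (ler_nmD _ _)) // addrC lerD2l ltW.
    have [->|h0] := eqVneq h 0; first by rewrite nm0 invr0 mul0r addr_ge0.
    by rewrite ler_pdivrMl ?nm_gt0 // mulrC addrC H.
  - move=> e e0; have [r r0 H] := f0 1 ltr01.
    pose M := 1 + nm (f 0 - f w).
    have M0 : 0 < M by rewrite ltr_pwDl.
    exists (Num.min r (Num.min (nm w / 2) (e * nm w / (2 * M)))).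
      by rewrite !lt_min r0 !divr_gt0 // mulr_gt0.
    move=> h; rewrite !lt_min => /andP[h0 /andP[hr /andP[hw he]]].
    have nG : nm (f h - f w) <= M.
      by rewrite (le_trans (nm_dist_tri _ (f 0) _)) // lerD2r H // h0.
    have hw2 : nm w / 2 <= nm (h - w) by rewrite nm_distC; have := nm_lower w h; lra.
    have hw0 : 0 < nm (h - w) by lra.
    rewrite subr0 /G nmZ nmM nmV mulrAC ler_pdivrMr //.
    apply: (@le_trans _ _ (nm h * M)); first by rewrite ler_wpM2l.
    apply: (@le_trans _ _ (e * (nm w / 2))); last by rewrite ler_pM2l.
    by move: he; rewrite ltr_pdivlMr ?mulr_gt0 //; lra.
have f00 : cmean f n c @[n --> \oo] --> f 0 by apply: cmean_mvp.
have k0 := cvgZ_nm (v := f w) (cmean_sub_inv wc).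
(* From z / (z - w) - 1 = w / (z - w). *)
have -> : (fun n => cmean (fun z => (z - w)^-1 *: f z) n c) = (fun n =>
    w^-1 *: (cmean G n c - cmean f n c + f w) + cmean (fun z => (z - w)^-1 : R[i]^o) n c *: f w).
  apply/funext => n.
  transitivity (cmean (fun z => w^-1 *: (G z - f z + f w) + (z - w)^-1 *: f w) n c); last first.
    by rewrite cmeanD cmeanZ cmeanD cmeanB cmean_cst cmeanZl.
  apply: eq_cmean => z zc; rewrite /G.
  have zw : z - w != 0 by rewrite subr_eq0; apply: contraTneq wc => <-; rewrite zc ltxx.
  by vmod K V by (by field; rewrite w0 zw).
have := cvgD (cvgZl_tmp (k := w^-1) (cvgD (cvgB G0 f00) (cvg_cst (f w)))) k0.
rewrite scale0r addr0 sub0r (addrC (- f 0)). by apply.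
Qed.

(** The difference of the two kernels is (w - w') / ((z - w) (z - w')), and both factors of the
    denominator are at least r / 2 on the circle. The estimate involves values of [f] only, so it
    survives pointwise limits. *)
Lemma divided_diff_lip f (r C : R) w w' : 0 < r ->
  w != 0 -> nm w <= r / 2 -> w' != 0 -> nm w' <= r / 2 ->
  (forall z, 0 < nm z <= r -> exists d, cderiv f z d) -> has_limit0 f (f 0) ->
  (forall z, nm z = r -> nm (f z) <= C) ->
  nm (w^-1 *: (f w - f 0) - w'^-1 *: (f w' - f 0)) <= 4 * C / r ^+ 2 * nm (w - w').
Proof.
move=> r0 w0 wr w'0 w'r df f0 fC; pose c : K := r%:C.
have nc : nm c = r by rewrite nmr // ltW.
have C0 : 0 <= C by rewrite (le_trans (nm_ge0 _) (fC c nc)).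
have h1 : nm w < nm c by rewrite nc; lra.
have h2 : nm w' < nm c by rewrite nc; lra.
rewrite -nc in df.
apply: (cvg_nm_le (cvgB (cauchy_kernel w0 h1 df f0) (cauchy_kernel w'0 h2 df f0))) => n.
rewrite -cmeanB; apply: cmean_le => z; rewrite nc => zr.
have a1 : r / 2 <= nm (z - w) by have := nm_lower z w; rewrite zr; lra.
have a2 : r / 2 <= nm (z - w') by have := nm_lower z w'; rewrite zr; lra.
have n1 : z - w != 0 by rewrite -nm_gt0; lra.
have n2 : z - w' != 0 by rewrite -nm_gt0; lra.
rewrite -scalerBl (_ : _ - _ = (w - w') / ((z - w) * (z - w'))); last by field; rewrite n1 n2.
rewrite nmZ nmM nmV nmM -mulrA mulrC ler_wpM2r //.
rewrite ler_pdivrMl ?mulr_gt0 ?nm_gt0 //.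
apply: (le_trans (fC z zr)).
have -> : nm (z - w) * nm (z - w') * (4 * C / r ^+ 2) = C * ((4 / r ^+ 2) * (nm (z - w) * nm (z - w'))).
  by ring.
rewrite ler_peMr // mulrAC ler_pdivlMr ?exprn_gt0 // mul1r.
have -> : r ^+ 2 = 4 * ((r / 2) * (r / 2)) by field.
by rewrite ler_pM2l // ler_pM // divr_ge0 // ltW.
Qed.

Lemma divided_diff_cvg f z d : cderiv f z d ->
  has_limit0 (fun h => h^-1 *: (f (z + h) - f z)) d.
Proof.
move=> fd e e0; have [r r0 H] := fd e e0; exists r => // h /andP[h0 /H {}H].
have hn : h != 0 by rewrite -nm_gt0.
have -> : h^-1 *: (f (z + h) - f z) - d = h^-1 *: (f (z + h) - f z - h *: d).
  by vmod K V by (by field; rewrite hn).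
by rewrite nmZ nmV ler_pdivrMl // mulrC.
Qed.

Lemma nm_half_scale (t : R) (e : R) : 0 < e -> 0 < t -> exists2 h : K, 0 < nm h < e & nm h <= t.
Proof.
move=> e0 t0; exists (Num.min (e / 2) t)%:C; rewrite nmr ?le_min ?ge_min ?lt_min ?divr_ge0 ?(ltW e0) ?(ltW t0) //.
  by rewrite divr_gt0 // t0 gt_min; apply/orP; left; lra.
by rewrite lexx orbT.
Qed.

(** The Lipschitz estimate for divided differences, as the second point tends to 0. *)
Lemma cderiv_quadratic f (r C : R) d w : 0 < r -> nm w <= r / 2 ->
  (forall z, 0 < nm z <= r -> exists d, cderiv f z d) -> cderiv f 0 d ->
  (forall z, nm z = r -> nm (f z) <= C) ->
  nm (f w - f 0 - w *: d) <= 4 * C / r ^+ 2 * nm w ^+ 2.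
Proof.
move=> r0 wr df fd fC.
have [->|w0] := eqVneq w 0; first by rewrite subrr scale0r subr0 !nm0 expr0n mulr0.
have f0 : has_limit0 f (f 0).
  by move=> e e0; have [r' r'0 H] := cderiv_cont fd e0; exists r' => // h /andP[_ /H]; rewrite add0r.
pose L := 4 * C / r ^+ 2.
have nC : 0 <= C by rewrite (le_trans (nm_ge0 _) (fC r%:C _)) // nmr // ltW.
have L0 : 0 <= L by apply: divr_ge0; [apply: mulr_ge0|apply: sqr_ge0].
suff H : nm (w^-1 *: (f w - f 0) - d) <= L * nm w.
  have -> : f w - f 0 - w *: d = w *: (w^-1 *: (f w - f 0) - d) by vmod K V by (by field).
  by rewrite nmZ (le_trans (ler_wpM2l (nm_ge0 w) H)) // expr2 mulrCA.
apply/ler_addgt0Pr => e e0.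
pose e1 := e / (L + 2); have L2 : 0 < L + 2 by rewrite ltr_wpDl.
have e10 : 0 < e1 by rewrite divr_gt0.
have [r1 r10 H] := divided_diff_cvg fd e10.
have q0 : 0 < Num.min (r / 2) e1 by rewrite lt_min e10 divr_gt0.
have [h /andP[h0 hr1]] := nm_half_scale r10 q0; rewrite le_min => /andP[hr he1].
have {}H := H h; rewrite add0r h0 hr1 in H; have {}H := H isT.
have hn : h != 0 by rewrite -nm_gt0.
rewrite (le_trans (nm_dist_tri _ (h^-1 *: (f h - f 0)) _)) //.
have := divided_diff_lip r0 w0 wr hn hr df f0 fC; rewrite -/L => Hl.
have wh : L * nm (w - h) <= L * (nm w + e1).
  by rewrite ler_wpM2l // (le_trans (ler_nmB _ _)) // lerD2l.
have -> : e = (L + 2) * e1 by rewrite /e1; field; rewrite gt_eqF.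
lra.
Qed.

(** Mean value property of the difference quotient at 0; the factor 2 comes from bounding f h and f
    0 separately. *)
Lemma cderiv_le f (r C : R) d : 0 < r ->
  (forall z, 0 < nm z <= r -> exists d, cderiv f z d) -> cderiv f 0 d ->
  (forall z, nm z = r -> nm (f z) <= C) -> nm (f 0) <= C -> nm d <= 2 * C / r.
Proof.
move=> r0 df fd fC f0C.
have nc : nm (r%:C : K) = r by rewrite nmr // ltW.
have H0 := divided_diff_cvg fd.
have : cmean (fun h => h^-1 *: (f (0 + h) - f 0)) n r%:C @[n --> \oo] --> d.
  apply: cmean_mvp => //; first by rewrite -nm_gt0 nc.
  move=> z; rewrite nc => zr; have [d' fd'] := df z zr.
  have z0 : z != 0 by rewrite -nm_gt0; case/andP: zr.
  eexists; apply: cderivZ; first exact: cderiv_inv.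
  apply: cderivB (cderiv_cst _ _); apply: eq_cderiv fd' => w; by rewrite add0r.
move=> /cvg_nm_le; apply => n; apply: cmean_le => z; rewrite nc => zr.
rewrite add0r nmZ nmV zr mulrC ler_wpM2r ?invr_ge0 ?(ltW r0) //.
by rewrite (le_trans (ler_nmB _ _)) // mulr_natl mulr2n lerD // fC.
Qed.

Lemma cderiv_has_limit0 f d : cderiv f 0 d -> has_limit0 f (f 0).
Proof.
move=> fd e e0; have [r r0 H] := cderiv_cont fd e0.
by exists r => // h /andP[_ /H]; rewrite add0r.
Qed.

End Cauchy.

(** * Differentiability of bounded pointwise limits *)

Section Removable.
Context {R : realType} {V : completeNormedModType R[i]}.
Local Notation K := R[i].
Implicit Types (f g : K -> V) (z w c : K).

(** A Lipschitz difference quotient is Cauchy along r 2^-n; completeness of [V] provides its limit,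
    which is the derivative. *)
Lemma lipschitz_quotient_cderiv f (r L : R) : 0 < r -> 0 <= L ->
  (forall w w', w != 0 -> nm w <= r -> w' != 0 -> nm w' <= r ->
    nm (w^-1 *: (f w - f 0) - w'^-1 *: (f w' - f 0)) <= L * nm (w - w')) ->
  exists2 d, cderiv f 0 d & forall w, nm w <= r -> nm (f w - f 0 - w *: d) <= L * nm w ^+ 2.
Proof.
move=> r0 L0 H.
pose u n : K := (r * 2^-1 ^+ n)%:C.
have nu n : nm (u n) = r * 2^-1 ^+ n by rewrite nmr // mulr_ge0 ?exprn_ge0 ?invr_ge0 // ltW.
have u0 n : u n != 0 by rewrite -nm_gt0 nu mulr_gt0 // exprn_gt0 // invr_gt0.
have p1 n : (2^-1 : R) ^+ n <= 1 by rewrite exprn_ile1 ?invr_ge0 // invf_le1 // ler1n.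
have ur n : nm (u n) <= r by rewrite nu ler_piMr // ltW.
pose D w := w^-1 *: (f w - f 0).
have usmall (e : R) : 0 < e -> exists N, forall n, (N <= n)%N -> nm (u n) <= e.
  move=> e0; have er0 : 0 < e / r by rewrite divr_gt0.
  have [N HN] := exp_half_lt er0; exists N => n Nn.
  rewrite nu -ler_pdivlMl // mulrC (le_trans _ (ltW HN)) // -(subnK Nn) exprD.
  by rewrite ler_piMl // exprn_ge0 // invr_ge0.
have Du n m : nm (D (u n) - D (u m)) <= L * (nm (u n) + nm (u m)).
  by rewrite (le_trans (H _ _ _ _ _ _)) // ler_wpM2l // ler_nmB.
have [|d Dd] := @nm_cauchy_cvg _ V (fun n => D (u n)).
  move=> e e0; have e20 : 0 < e / (2 * (L + 1)) by rewrite divr_gt0 // mulr_gt0 // ltr_wpDl.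
  have [N HN] := usmall _ e20; exists N => n m Nn Nm.
  rewrite (le_trans (Du n m)) //.
  rewrite (@le_trans _ _ ((L + 1) * (nm (u n) + nm (u m)))) //.
    by rewrite ler_wpM2r ?addr_ge0 // lerDl.
  rewrite mulrC -ler_pdivlMr ?ltr_wpDl //.
  have -> : e / (L + 1) = e / (2 * (L + 1)) + e / (2 * (L + 1)).
    by field; rewrite gt_eqF // ltr_wpDl.
  by rewrite lerD // HN.
have quad w : nm w <= r -> nm (f w - f 0 - w *: d) <= L * nm w ^+ 2.
  move=> wr; have [->|w0] := eqVneq w 0.
    by rewrite subrr scale0r subr0 !nm0 expr0n mulr0.
  have -> : f w - f 0 - w *: d = w *: (D w - d) by rewrite /D; vmod K V by (by field).
  rewrite nmZ expr2 mulrCA ler_wpM2l //.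
  apply/ler_addgt0Pr => e e0.
  have e20 : 0 < e / (L + 1) by rewrite divr_gt0 // ltr_wpDl.
  have [N HN] := usmall _ e20.
  apply: (cvg_nm_le_near (N := N) (cvgB (cvg_cst (D w)) Dd)) => n /HN {}HN.
  rewrite (le_trans (H _ _ _ _ _ _)) //.
  rewrite (@le_trans _ _ (L * (nm w + nm (u n)))) ?ler_wpM2l ?ler_nmB // mulrDr lerD2l.
  rewrite (@le_trans _ _ ((L + 1) * nm (u n))) ?ler_wpM2r ?lerDl //.
  by rewrite mulrC -ler_pdivlMr // ltr_wpDl.
exists d => // e e0.
have e20 : 0 < e / (L + 1) by rewrite divr_gt0 // ltr_wpDl.
exists (Num.min r (e / (L + 1))); first by rewrite lt_min r0.
move=> h; rewrite lt_min => /andP[hr he]; rewrite add0r (le_trans (quad h (ltW hr))) //.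
rewrite expr2 mulrA ler_wpM2r // (@le_trans _ _ ((L + 1) * nm h)) ?ler_wpM2r ?lerDl //.
by rewrite mulrC -ler_pdivlMr ?ltr_wpDl // ltW.
Qed.

(** A form of Weierstrass' theorem in which a uniform bound replaces uniform convergence: the common
    Lipschitz bound on divided differences passes to the limit. *)
Lemma cderiv_pointwise_limit (fs : nat -> K -> V) f (rho C : R) (ds : nat -> V) : 0 < rho ->
  (forall j z, nm z < rho -> exists d, cderiv (fs j) z d) ->
  (forall j z, nm z < rho -> nm (fs j z) <= C) ->
  (forall z, nm z < rho -> fs j z @[j --> \oo] --> f z) ->
  (forall j, cderiv (fs j) 0 (ds j)) ->
  exists d, [/\ cderiv f 0 d, ds j @[j --> \oo] --> d &
    forall w, nm w <= rho / 4 -> nm (f w - f 0 - w *: d) <= 16 * C / rho ^+ 2 * nm w ^+ 2].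
Proof.
move=> rho0 dfs fsC fsf fsd.
have C0 : 0 <= C by rewrite (le_trans (nm_ge0 _) (fsC 0%N 0 _)) // nm0.
pose r := rho / 2; have r0 : 0 < r by rewrite divr_gt0.
have rr : r < rho by rewrite /r; lra.
have r4 : rho / 4 = r / 2 by rewrite /r; field.
pose L := 16 * C / rho ^+ 2.
have LE : L = 4 * C / r ^+ 2 by rewrite /L /r; field; rewrite gt_eqF.
have L0 : 0 <= L by apply: divr_ge0; [apply: mulr_ge0|apply: sqr_ge0].
rewrite -/L r4; have r20 : 0 < r / 2 by rewrite divr_gt0.
have f00 : fs j 0 @[j --> \oo] --> f 0 by apply: fsf; rewrite nm0.
have [|d fd quad] := lipschitz_quotient_cderiv (f := f) r20 L0.
  move=> w w' w0 wr w'0 w'r.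
  have fw : fs j w @[j --> \oo] --> f w by apply: fsf; lra.
  have fw' : fs j w' @[j --> \oo] --> f w' by apply: fsf; lra.
  apply: (cvg_nm_le (cvgB (cvgZl_tmp (k := w^-1) (cvgB fw f00)) (cvgZl_tmp (k := w'^-1) (cvgB fw' f00)))) => j.
  rewrite LE; apply: divided_diff_lip => //.
  - by move=> z /andP[_ zr]; apply: dfs; lra.
  - exact: cderiv_has_limit0 (fsd j).
  - by move=> z zr; apply: fsC; lra.
exists d; split => //; apply/cvg_nmP => e e0.
(* [w] is fixed first, so small that both quadratic remainders are at most a quarter of e |w|; only
   then is [j] taken large. *)
have q0 : 0 < Num.min (r / 2) (e / (4 * (L + 1))).
  by rewrite lt_min r20 divr_gt0 // mulr_gt0 // ltr_wpDl.
have [w /andP[w0 wr] we] := nm_half_scale (R := R) r0 q0.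
move: we; rewrite le_min => /andP[wr2 we].
have wn0 : w != 0 by rewrite -nm_gt0.
have ew0 : 0 < e / 4 * nm w by rewrite mulr_gt0 // divr_gt0.
have fw : fs j w @[j --> \oo] --> f w by apply: fsf; lra.
have [N1 H1] := (cvg_nmP _ _).1 fw _ ew0.
have [N2 H2] := (cvg_nmP _ _).1 f00 _ ew0.
exists (maxn N1 N2) => j; rewrite geq_max => /andP[/H1 {}H1 /H2 {}H2].
rewrite -(ler_pM2l w0) -nmZ.
have -> : w *: (ds j - d) = (fs j w - f w) + (f w - f 0 - w *: d) - ((fs j 0 - f 0) + (fs j w - fs j 0 - w *: ds j)).
  by vmod K V.
have Q1 := quad w wr2.
have Q2 : nm (fs j w - fs j 0 - w *: ds j) <= L * nm w ^+ 2.
  rewrite LE; apply: cderiv_quadratic => //.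
  - by move=> z /andP[_ zr]; apply: dfs; lra.
  - by move=> z zr; apply: fsC; lra.
rewrite (le_trans (ler_nmB _ _)) //.
have n1 := ler_nmD (fs j w - f w) (f w - f 0 - w *: d).
have n2 := ler_nmD (fs j 0 - f 0) (fs j w - fs j 0 - w *: ds j).
have Lw : L * nm w ^+ 2 <= e / 4 * nm w.
  rewrite expr2 mulrA ler_wpM2r // (@le_trans _ _ ((L + 1) * nm w)) ?ler_wpM2r ?lerDl //.
  rewrite mulrC -ler_pdivlMr ?ltr_wpDl // (le_trans we) // le_eqVlt; apply/orP; left; apply/eqP.
  by field; rewrite gt_eqF // ltr_wpDl.
lra.
Qed.

End Removable.

(** * Higher derivatives of holomorphic maps *)

Section DifferentiableNm.
Context {R : realType} {X Y : normedModType R[i]}.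
Local Notation K := R[i].

Lemma linear_nm_bounded (L : {linear X -> Y}) : continuous L ->
  exists2 B : R, 0 < B & forall h, nm (L h) <= B * nm h.
Proof.
move=> cL; have /pinfty_ex_gt0[M M0 H] :=
  (linear_boundedP L).1 ((linear_bounded_continuous L).2 cL).
case: M M0 H => M M'; rewrite ltcE /= => /andP[/eqP -> M0] H.
by exists M => // h; have := H h; rewrite !nmE complexr0 -rmorphM lecR.
Qed.

Lemma nm_bounded_continuous (L : {linear X -> Y}) (B : R) :
  (forall h, nm (L h) <= B * nm h) -> continuous L.
Proof.
move=> H; apply/linear_bounded_continuous/linear_boundedP; exists B%:C; split; first by apply/complex_realP; exists B.
move=> M /ltW BM h; apply: le_trans (_ : B%:C * `|h| <= _); last by rewrite ler_wpM2r.
by rewrite !nmE -rmorphM lecR.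
Qed.

Lemma nbhs0_nmP (P : set X) :
  (\forall h \near nbhs (0 : X), P h) <-> exists2 r : R, 0 < r & forall h, nm h < r -> P h.
Proof.
split=> [/nbhs_norm0P[r r0 H]|[r r0 H]].
  case: r r0 H => r r' /=; rewrite ltcE /= => /andP[/eqP -> r0] H.
  by exists r => // h hr; apply: H; rewrite /= nmE ltcR.
apply/nbhs_norm0P; exists r%:C; first by rewrite /= ltcR.
by move=> h /=; rewrite nmE ltcR; apply: H.
Qed.

Lemma differentiable_nm (F : X -> Y) x : differentiable F x ->
  forall e : R, 0 < e -> exists2 r : R, 0 < r &
    forall h, nm h < r -> nm (F (x + h) - F x - 'd F x h) <= e * nm h.
Proof.
move=> /diff_locallyP[_ /eqaddoP H] e e0.
have e0' : 0 < e%:C by rewrite ltcR.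
have /nbhs0_nmP[r r0 {}H] := H _ e0'; exists r => // h /H /=.
by rewrite !fctE /= opprD addrA addrC !nmE -rmorphM lecR [h + x]addrC addrC.
Qed.

Lemma linear_differentiable_nm (F : X -> Y) x (L : {linear X -> Y}) (B : R) :
  (forall h, nm (L h) <= B * nm h) ->
  (forall e : R, 0 < e -> exists2 r : R, 0 < r &
    forall h, nm h < r -> nm (F (x + h) - F x - L h) <= e * nm h) ->
  differentiable F x /\ 'd F x = L :> (X -> Y).
Proof.
move=> /nm_bounded_continuous cL H.
have o : F \o shift x = cst (F x) + L +o_ (0 : X) id.
  apply/eqaddoP => e; case: e => e e'; rewrite ltcE /= => /andP[/eqP -> e0].
  have [r r0 {}H] := H e e0; apply/nbhs0_nmP; exists r => // h /H.
  by rewrite !fctE /= opprD addrA !nmE complexr0 -rmorphM lecR [h + x]addrC.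
have E := diff_unique cL o.
by split => //; apply/diff_locallyP; rewrite E.
Qed.

Lemma cderiv_slice (F : X -> Y) x k z : differentiable F (x + z *: k) ->
  cderiv (fun s => F (x + s *: k)) z ('d F (x + z *: k) k).
Proof.
move=> dF e e0.
have [k0|k0] := eqVneq k 0.
  exists 1 => // h _; rewrite k0 !scaler0 addr0 subrr linear0 scaler0 subr0 nm0.
  by rewrite mulr_ge0 // ltW.
have nk : 0 < nm k by rewrite nm_gt0.
have [|r r0 H] := differentiable_nm dF (e := e / nm k); first by rewrite divr_gt0.
exists (r / nm k); first by rewrite divr_gt0.
move=> h; rewrite ltr_pdivlMr // => hr; have := H (h *: k).
rewrite nmZ => /(_ hr); rewrite linearZ /= scalerDl addrA.
by have -> : e / nm k * (nm h * nm k) = e * nm h by field; rewrite gt_eqF.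
Qed.

End DifferentiableNm.

Lemma cderiv_cmean (R : realType) (Y : normedModType R[i]) (G : R[i] -> R[i] -> Y)
    (D : R[i] -> Y) n c z :
  (forall t, nm t = nm c -> cderiv (G t) z (D t)) ->
  cderiv (fun s => cmean (fun t => G t s) n c) z (cmean D n c).
Proof.
move=> H; rewrite /cmean; apply: cderivZr.
rewrite big_mkord; have := @cderiv_sum R Y (2 ^ n) (fun k s => G (c * cexp (k%:R / 2 ^+ n * ipi2)) s) z
  (fun k => D (c * cexp (k%:R / 2 ^+ n * ipi2))) _.
move=> /(_ (fun k => H _ _))=> HH.
apply: eq_cderiv (HH _) => [s|k]; first by rewrite big_mkord.
by rewrite nmM nm_root_of_unity mulr1.
Qed.

(** * Cauchy estimates for Fréchet derivatives *)

Section FrechetCauchy.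
Context {R : realType} {X : normedModType R[i]} {Y : completeNormedModType R[i]}.
Local Notation K := R[i].
Variables (F : X -> Y) (x : X) (rho C : R).
Hypothesis rho0 : 0 < rho.
Hypothesis dF : forall y, nm (y - x) < rho -> differentiable F y.
Hypothesis FC : forall y, nm (y - x) < rho -> nm (F y) <= C.

Let slice_in (h : X) (z : K) : h != 0 -> nm z <= rho / (2 * nm h) ->
  nm (x + z *: h - x) < rho.
Proof.
rewrite -nm_gt0 => h0; rewrite ler_pdivlMr ?mulr_gt0 // => zr.
by rewrite addrC addKr nmZ; move: rho0; lra.
Qed.

(** The one-variable estimate for s |-> F (x + s h) on the disc of radius rho / (2 |h|). *)
Lemma frechet_le h : nm ('d F x h) <= 4 * C / rho * nm h.
Proof.
have rho1 := rho0.
have [->|h0] := eqVneq h 0; first by rewrite linear0 !nm0 mulr0.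
have nh : 0 < nm h by rewrite nm_gt0.
have r0 : 0 < rho / (2 * nm h) by rewrite divr_gt0 // mulr_gt0.
have in0 : nm (x - x) < rho by rewrite subrr nm0.
have -> : 4 * C / rho * nm h = 2 * C / (rho / (2 * nm h)) by field; rewrite !gt_eqF.
apply: (@cderiv_le _ _ (fun s => F (x + s *: h))) => //.
- move=> z /andP[_ /(slice_in h0) zr]; exists ('d F (x + z *: h) h).
  exact: cderiv_slice (dF zr).
- by have := @cderiv_slice _ _ _ F x h 0; rewrite scale0r addr0; apply; apply: dF.
- by move=> z zr; apply/FC/slice_in; rewrite ?zr.
- by rewrite scale0r addr0 FC.
Qed.

Lemma frechet_quadratic h : nm h <= rho / 4 ->
  nm (F (x + h) - F x - 'd F x h) <= 16 * C / rho ^+ 2 * nm h ^+ 2.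
Proof.
have rho1 := rho0.
move=> hr; have [->|h0] := eqVneq h 0.
  by rewrite linear0 addr0 subrr subr0 !nm0 expr0n mulr0.
have nh : 0 < nm h by rewrite nm_gt0.
have r0 : 0 < rho / (2 * nm h) by rewrite divr_gt0 // mulr_gt0.
have in0 : nm (x - x) < rho by rewrite subrr nm0.
have := @cderiv_quadratic _ _ (fun s => F (x + s *: h)) _ C ('d F x h) 1 r0.
rewrite !scale1r scale0r addr0 nm1 expr1n mulr1.
have -> : 4 * C / (rho / (2 * nm h)) ^+ 2 = 16 * C / rho ^+ 2 * nm h ^+ 2.
  by field; rewrite !gt_eqF.
apply.
- by rewrite !ler_pdivlMr ?mulr_gt0 //; lra.
- move=> z /andP[_ /(slice_in h0) zr]; exists ('d F (x + z *: h) h).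
  exact: cderiv_slice (dF zr).
- by have := @cderiv_slice _ _ _ F x h 0; rewrite scale0r addr0; apply; apply: dF.
- by move=> z zr; apply/FC/slice_in; rewrite ?zr.
Qed.

(** The map y |-> dF(y) h is the bounded pointwise limit of the means [g n] of difference quotients
    of [F], so it is differentiable along every line. The derivative in direction [k] is the limit
    of expressions linear in [k], and the remainder is quadratic in [k] with a constant independent
    of the direction; together these give a Fréchet derivative. *)
Lemma frechet_diff_dir h : differentiable (fun y => 'd F y h) x.
Proof.
have rho1 := rho0.
have [->|h0] := eqVneq h 0.
  rewrite (_ : (fun y => _) = cst 0); first exact: differentiable_cst.
  by apply/funext => y; rewrite linear0.
have nh : 0 < nm h by rewrite nm_gt0.
(* With tau |h| = rho / 4, the points y + t h stay in the ball of radius rho when y is within rho /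
   2 of x and |t| <= tau. *)
pose tau := rho / (4 * nm h).
have tau0 : 0 < tau by rewrite divr_gt0 // mulr_gt0.
pose c : K := tau%:C.
have nc : nm c = tau by rewrite nmr // ltW.
have c0 : c != 0 by rewrite -nm_gt0 nc.
have C0 : 0 <= C by rewrite (le_trans (nm_ge0 _) (@FC x _)) // subrr nm0.
have tauh : tau * nm h = rho / 4 by rewrite /tau; field; rewrite gt_eqF.
pose g n y := cmean (fun t => t^-1 *: (F (y + t *: h) - F y)) n c.
have in1 y : nm (y - x) < rho / 2 -> nm (y - x) < rho by lra.
have in2 y t : nm (y - x) < rho / 2 -> nm t <= tau -> nm (y + t *: h - x) < rho.
  move=> yr tr; rewrite addrAC (le_lt_trans (ler_nmD _ _)) // nmZ.
  have : nm t * nm h <= tau * nm h by rewrite ler_wpM2r.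
  lra.
have gphi y : nm (y - x) < rho / 2 -> g n y @[n --> \oo] --> 'd F y h.
  move=> yr; apply: cmean_mvp => //.
    move=> t /andP[t0]; rewrite nc => tr; eexists; apply: cderivZ.
      by apply: cderiv_inv; rewrite -nm_gt0.
    by apply: cderivB (cderiv_cst _ _); apply: cderiv_slice; apply/dF/in2.
  have := @cderiv_slice _ _ _ F y h 0; rewrite scale0r addr0 => /(_ (dF (in1 _ yr))).
  move=> /divided_diff_cvg H e e0; have [r r0 {}H] := H e e0; exists r => // t /H.
  by rewrite add0r scale0r addr0.
have gC n y : nm (y - x) < rho / 2 -> nm (g n y) <= 2 * C / tau.
  move=> yr; apply: cmean_le => t; rewrite nc => tr; rewrite nmZ nmV tr mulrC.
  rewrite ler_wpM2r ?invr_ge0 ?(ltW tau0) // (le_trans (ler_nmB _ _)) //.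
  rewrite mulr_natl mulr2n lerD // FC //; first by apply: in2 => //; rewrite tr.
  exact: in1.
pose M n k := cmean (fun t => t^-1 *: ('d F (x + t *: h) k - 'd F x k)) n c.
have dg n k z : nm (x + z *: k - x) < rho / 2 ->
    cderiv (fun s => g n (x + s *: k)) z
      (cmean (fun t => t^-1 *: ('d F (x + z *: k + t *: h) k - 'd F (x + z *: k) k)) n c).
  move=> zr; apply: cderiv_cmean => t; rewrite nc => tr.
  apply: cderivZr; apply: cderivB; last by apply: cderiv_slice; apply/dF/in1.
  have := @cderiv_slice _ _ _ F (x + t *: h) k z.
  rewrite addrAC => /(_ (dF (in2 _ _ zr _))); rewrite tr => /(_ (lexx _)).
  by apply: eq_cderiv => s; rewrite addrAC.
have key k : exists d, M n k @[n --> \oo] --> d /\ (forall w : K, nm w * nm k <= rho / 8 ->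
    nm ('d F (x + w *: k) h - 'd F x h - w *: d) <= 128 * C / (tau * rho ^+ 2) * (nm w * nm k) ^+ 2).
  have [->|k0] := eqVneq k 0.
    exists 0; split.
      rewrite (_ : (fun n => M n 0) = cst 0); first exact: cvg_cst.
      apply/funext => n; rewrite /M -[RHS](cmean_cst 0 n c); apply: eq_cmean => t _.
      by rewrite (linear0 ('d F (x + t *: h))) linear0 subrr scaler0.
    by move=> w _; rewrite !scaler0 addr0 subrr subr0 !nm0 mulr0 expr0n mulr0.
  have nk : 0 < nm k by rewrite nm_gt0.
  pose r := rho / (2 * nm k).
  have r0 : 0 < r by rewrite divr_gt0 // mulr_gt0.
  have zin z : nm z < r -> nm (x + z *: k - x) < rho / 2.
    by rewrite ltr_pdivlMr ?mulr_gt0 // addrC addKr nmZ; lra.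
  have [||||d [_ Md quad]] := @cderiv_pointwise_limit _ _ (fun n s => g n (x + s *: k))
      (fun s => 'd F (x + s *: k) h) r (2 * C / tau) (fun n => M n k) r0.
  - by move=> n z /zin zr; eexists; exact: dg.
  - by move=> n z /zin zr; apply: gC.
  - by move=> z /zin zr; apply: gphi.
  - move=> n; have := dg n k 0; rewrite scale0r addr0 subrr nm0 => /(_ (divr_gt0 rho0 _)).
    by apply.
  exists d; split => // w wr; have := quad w; rewrite scale0r addr0.
  have -> : 16 * (2 * C / tau) / r ^+ 2 * nm w ^+ 2 = 128 * C / (tau * rho ^+ 2) * (nm w * nm k) ^+ 2.
    by rewrite /r; field; rewrite !gt_eqF.
  by apply; rewrite /r !ler_pdivlMr ?mulr_gt0 //; lra.
have [L LP] := choice key.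
have linL : linear L.
  move=> a k k'; apply: (@cvg_unique _ (@norm_hausdorff _ Y) (M n (a *: k + k') @[n --> \oo])).
    exact: (LP (a *: k + k')).1.
  rewrite (_ : (fun n => _) = fun n => a *: M n k + M n k').
    exact: cvgD (cvgZl_tmp (k := a) (LP k).1) (LP k').1.
  apply/funext => n; rewrite /M -cmeanZ -cmeanD; apply: eq_cmean => t _.
  by rewrite !linearP /=; vmod K Y.
pose L' : {linear X -> Y} := HB.pack L (GRing.isLinear.Build K X Y _ L linL).
pose Q := 128 * C / (tau * rho ^+ 2).
have Q0 : 0 <= Q.
  by apply: divr_ge0; [apply: mulr_ge0|apply: mulr_ge0; [exact: ltW|exact: sqr_ge0]].
have quad k : nm k <= rho / 8 -> nm ('d F (x + k) h - 'd F x h - L k) <= Q * nm k ^+ 2.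
  by move=> kr; have := (LP k).2 1; rewrite !scale1r nm1 mul1r => /(_ kr).
(* [L] is bounded by applying the quadratic estimate to a vector rescaled to length rho / 8. *)
pose B := (4 * C / tau + Q * (rho / 8) ^+ 2) / (rho / 8).
have phiC y : nm (y - x) < rho / 2 -> nm ('d F y h) <= 2 * C / tau.
  by move=> yr; apply: (cvg_nm_le (gphi y yr)) => n; apply: gC.
have bdL k : nm (L k) <= B * nm k.
  have [->|k0] := eqVneq k 0; first by have -> : L 0 = 0 := linear0 L'; rewrite !nm0 mulr0.
  have nk : 0 < nm k by rewrite nm_gt0.
  have r8 : 0 < rho / 8 by rewrite divr_gt0.
  pose s := rho / 8 / nm k; have s0 : 0 < s by rewrite divr_gt0.
  have ns : nm (s%:C : K) = s by rewrite nmr // ltW.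
  have sk : s * nm k = rho / 8 by rewrite /s divfK // gt_eqF.
  have := (LP k).2 s%:C; rewrite ns sk => /(_ (lexx _)) H.
  have e1 : nm ('d F (x + s%:C *: k) h) <= 2 * C / tau.
    by apply: phiC; rewrite addrC addKr nmZ ns sk; lra.
  have e2 : nm ('d F x h) <= 2 * C / tau by apply: phiC; rewrite subrr nm0 divr_gt0.
  have e3 : s * nm (L k) <= 4 * C / tau + Q * (rho / 8) ^+ 2.
    rewrite -{1}ns -nmZ.
    have -> : s%:C *: L k = ('d F (x + s%:C *: k) h - 'd F x h) -
       ('d F (x + s%:C *: k) h - 'd F x h - s%:C *: L k) by vmod K Y.
    rewrite (le_trans (ler_nmB _ _)) // lerD // (le_trans (ler_nmB _ _)) //.
    by rewrite (le_trans (lerD e1 e2)) //; lra.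
  have -> : B * nm k = (4 * C / tau + Q * (rho / 8) ^+ 2) / s.
    by rewrite /B /s; move: (_ + _) => E; field; rewrite !gt_eqF.
  by rewrite ler_pdivlMr // mulrC.
apply: (@linear_differentiable_nm _ _ _ _ x L' B bdL _).1 => e e0.
exists (Num.min (rho / 8) (e / (Q + 1))).
  by rewrite lt_min !divr_gt0 // ltr_wpDl.
move=> k; rewrite lt_min => /andP[kr ke]; rewrite (le_trans (quad k (ltW kr))) //.
rewrite expr2 mulrA ler_wpM2r // (@le_trans _ _ ((Q + 1) * nm k)) ?ler_wpM2r ?lerDl //.
by rewrite mulrC -ler_pdivlMr ?ltr_wpDl // ltW.
Qed.

End FrechetCauchy.

(** * Existence of derivatives of all orders *)

Section NDeriv.
Context {R : realType} {X : normedModType R[i]} {Y : completeNormedModType R[i]}.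
Local Notation K := R[i].

Lemma differentiable_local (F G : X -> Y) x (r : R) : 0 < r ->
  (forall y, nm (y - x) < r -> F y = G y) -> differentiable G x ->
  differentiable F x /\ 'd F x = 'd G x :> (X -> Y).
Proof.
move=> r0 FG dG; have [B _ HB] := linear_nm_bounded (diff_continuous dG).
apply: (linear_differentiable_nm (L := 'd G x) HB) => e e0.
have [r' r'0 H] := differentiable_nm dG e0.
exists (Num.min r r'); first by rewrite lt_min r0.
move=> h; rewrite lt_min => /andP[hr /H].
by rewrite !FG // ?subrr ?nm0 // addrC addKr.
Qed.

Lemma vcons0 (V : Type) n (h : V) (v : 'I_n -> V) : vcons h v ord0 = h.
Proof. by rewrite /vcons unlift_none. Qed.

Lemma vconsS (V : Type) n (h : V) (v : 'I_n -> V) i : vcons h v (lift ord0 i) = v i.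
Proof. by rewrite /vcons liftK. Qed.

Lemma prod_nm n (v : 'I_n -> X) : \prod_(i < n) `|v i| = (\prod_(i < n) nm (v i))%:C.
Proof. by rewrite rmorph_prod /=; apply: eq_bigr => i _; rewrite nmE. Qed.

(** The induction hypothesis of the passage to order n + 1. Differentiability is stated for each
    fixed argument [v]; the bound, uniform in [v], upgrades it to that of the operator-valued
    map. *)
Definition nderiv_regular (F : X -> Y) n x := exists (rho C : R), 0 < rho /\ forall y, nm (y - x) < rho ->
  [/\ multilinear (nderiv F n y),
      forall v, nm (nderiv F n y v) <= C * \prod_(i < n) nm (v i) &
      forall v, differentiable (fun y => nderiv F n y v) y].

(** The constants in the Cauchy estimates are proportional to the bound on the map, here a multiple
    of the product of the norms of the arguments; this is the uniformity in [v] that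
    [is_frechet_derivative] demands. *)
Lemma nderiv_regular_frechet F n x : nderiv_regular F n x ->
  is_frechet_derivative (nderiv F n) x
    (fun w => 'd (fun y => nderiv F n y (fun i => w (lift ord0 i))) x (w ord0)).
Proof.
move=> [rho [C [rho0 H]]].
have in0 : nm (x - x) < rho by rewrite subrr nm0.
have dG v y : nm (y - x) < rho -> differentiable (fun y => nderiv F n y v) y.
  by move=> /H[].
have bG v y : nm (y - x) < rho -> nm (nderiv F n y v) <= C * \prod_(i < n) nm (v i).
  by move=> /H[].
split.
- move=> i w a u u' /=.
  case: (unliftP ord0 i) => [k ->|->]; last first.
    have tl u1 : (fun j : 'I_n => dfwith (T := fun=> X) w ord0 u1 (lift ord0 j)) =
       fun j => w (lift ord0 j).
      by apply/funext => j; rewrite dfwithout ?neq_lift.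
    by rewrite !tl !dfwithin linearP.
  have nk : lift ord0 k != ord0 by rewrite eq_sym neq_lift.
  rewrite !dfwithout //.
  have tl u1 : (fun j : 'I_n => dfwith (T := fun=> X) w (lift ord0 k) u1 (lift ord0 j)) =
     dfwith (T := fun=> X) (fun j => w (lift ord0 j)) k u1.
    apply/funext => j; have [->|jk] := eqVneq j k; first by rewrite !dfwithin.
    by rewrite !dfwithout // ?(inj_eq lift_inj) // eq_sym.
  rewrite !tl; set v := fun j : 'I_n => w (lift ord0 j); set h := w ord0.
  pose g u1 y := nderiv F n y (dfwith (T := fun=> X) v k u1).
  have dg u1 : differentiable (g u1) x by exact: dG.
  (* Linearity in the old arguments holds at all nearby points and can therefore be
     differentiated. *)
  have [||dd E] := @differentiable_local (g (a *: u + u')) (a *: g u + g u') x rho rho0.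
  + by move=> y /H[/(_ k v) lin _ _]; rewrite /g lin.
  + by apply: differentiableD => //; exact: differentiableZ.
  change ('d (g (a *: u + u')) x h = a *: 'd (g u) x h + 'd (g u') x h).
  have du := dg u; have du' := dg u'; have dau : differentiable (a *: g u) x := differentiableZ a du.
  apply: (etrans (congr1 (@^~ h) E)); apply: (etrans (congr1 (@^~ h) (diffD dau du'))).
  by congr (_ + _); apply: (etrans (congr1 (@^~ h) (diffZ a du))).
- exists (4 * C / rho)%:C => w; rewrite prod_nm nmE -rmorphM lecR.
  apply: (le_trans (frechet_le rho0 (fun y yr => dG _ y yr) (fun y yr => bG _ _ yr) _)).
  by rewrite big_ord_recl /= le_eqVlt; apply/orP; left; apply/eqP; ring.
move=> e; case: e => e e'; rewrite ltcE /= => /andP[/eqP -> e0].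
pose Q := 16 * C / rho ^+ 2.
apply/nbhs0_nmP; exists (Num.min (rho / 4) (e / (`|Q| + 1))).
  by rewrite lt_min !divr_gt0 // ltr_wpDl.
move=> h; rewrite lt_min => /andP[hr he] v.
rewrite prod_nm !nmE complexr0 -!rmorphM lecR vcons0.
have -> : (fun i => vcons h v (lift ord0 i)) = v by apply/funext => i; rewrite vconsS.
apply: (le_trans (frechet_quadratic rho0 (fun y yr => dG _ _ yr) (fun y yr => bG _ _ yr) (ltW hr))).
have -> : 16 * (C * \prod_(i < n) nm (v i)) / rho ^+ 2 * nm h ^+ 2 =
   Q * nm h * (nm h * \prod_(i < n) nm (v i)) by rewrite /Q; ring.
rewrite -[X in _ <= X]mulrA ler_wpM2r ?mulr_ge0 ?prodr_ge0 //.
apply: (@le_trans _ _ ((`|Q| + 1) * nm h)).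
  by rewrite ler_wpM2r // (le_trans (ler_norm _)) // lerDl.
by rewrite mulrC -ler_pdivlMr ?ltr_wpDl // ltW.
Qed.

Lemma nderiv_regularS F n x : nderiv_regular F n x -> nderiv_regular F n.+1 x.
Proof.
move=> [rho [C [rho0 H]]].
have E y : nm (y - x) < rho / 2 -> nderiv F n.+1 y =
    fun w => 'd (fun y => nderiv F n y (fun i => w (lift ord0 i))) y (w ord0).
  move=> yr; apply/nderivSE/nderiv_regular_frechet; exists (rho / 2), C; split; first by rewrite divr_gt0.
  move=> y' y'r; apply: H; have := nm_dist_tri y' y x; lra.
have r20 : 0 < rho / 2 by rewrite divr_gt0.
have Hin y y' : nm (y - x) < rho / 2 -> nm (y' - y) < rho / 2 -> nm (y' - x) < rho.
  by have := nm_dist_tri y' y x; lra.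
exists (rho / 2), (4 * C / (rho / 2)); split => // y yr; split.
- rewrite E //; have [] // := @nderiv_regular_frechet F n y _.
  by exists (rho / 2), C; split => // y' y'r; apply: H; apply: Hin y'r.
- move=> v; rewrite E //.
  apply: (le_trans (@frechet_le _ _ _ _ _ (rho / 2) (C * \prod_(i < n) nm (v (lift ord0 i))) r20 _ _ _)).
  + by move=> y' y'r; have [_ _] := H _ (Hin _ _ yr y'r); apply.
  + by move=> y' y'r; have [_ + _] := H _ (Hin _ _ yr y'r); apply.
  by rewrite big_ord_recl /= le_eqVlt; apply/orP; left; apply/eqP; ring.
move=> v.
pose G y := 'd (fun y => nderiv F n y (fun i => v (lift ord0 i))) y (v ord0).
have dG : differentiable G y.
  apply: (@frechet_diff_dir _ _ _ _ _ (rho / 2) (C * \prod_(i < n) nm (v (lift ord0 i))) r20).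
  + by move=> y' y'r; have [_ _] := H _ (Hin _ _ yr y'r); apply.
  + by move=> y' y'r; have [_ + _] := H _ (Hin _ _ yr y'r); apply.
have s0 : 0 < rho / 2 - nm (y - x) by lra.
apply: (differentiable_local s0 _ dG).1 => y' y'r; rewrite E //.
by have := nm_dist_tri y' y x; lra.
Qed.

Lemma nderiv_regular0 F x (r : R) : 0 < r -> (forall y, nm (y - x) < r -> differentiable F y) -> nderiv_regular F 0 x.
Proof.
move=> r0 dF; have [|r' r'0 H] := differentiable_nm (dF x _) (e := 1) ltr01.
  by rewrite subrr nm0.
have [|B B0 HB] := linear_nm_bounded (L := 'd F x) _.
  by apply: diff_continuous; apply: dF; rewrite subrr nm0.
pose s := Num.min r r'.
exists s, (nm (F x) + (B + 1) * s); split; first by rewrite lt_min r0.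
move=> y; rewrite /s lt_min => /andP[yr yr'].
have ys : nm (y - x) <= s by rewrite le_min !ltW.
split; first by move=> [].
- move=> v; rewrite big_ord0 mulr1 /=.
  have h1 := H (y - x) yr'; rewrite (addrC x) subrK mul1r in h1.
  have h2 := HB (y - x).
  have -> : F y = F x + ((F y - F x - 'd F x (y - x)) + 'd F x (y - x)) by vmod K Y.
  rewrite (le_trans (ler_nmD _ _)) // lerD2l (le_trans (ler_nmD _ _)) // addrC.
  rewrite (le_trans (lerD h2 h1)) //.
  have : (B + 1) * nm (y - x) <= (B + 1) * s by rewrite ler_pM2l // addr_gt0.
  by rewrite -/s; lra.
- by move=> v; apply: dF.
Qed.

Lemma nderiv_regular_all (F : X -> Y) n x (r : R) : 0 < r ->
  (forall y, nm (y - x) < r -> differentiable F y) -> nderiv_regular F n x.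
Proof. by move=> r0 dF; elim: n => [|n IH]; [exact: nderiv_regular0 dF|exact/nderiv_regularS/IH]. Qed.

(** The derivative is Lipschitz at [x] in operator norm, which is what controls the inverses of
    nearby derivatives. *)
Lemma diff_lipschitz (F : X -> Y) x (r : R) : 0 < r ->
  (forall y, nm (y - x) < r -> differentiable F y) ->
  exists L rho : R, [/\ 0 < rho, 0 <= L & forall h, nm h < rho -> forall v,
    nm ('d F (x + h) v - 'd F x v) <= L * nm h * nm v].
Proof.
move=> r0 dF; have [rho [C [rho0 H]]] := nderiv_regular_all 1 r0 dF.
have G y v : nm (y - x) < r -> nderiv F 1 y (fun=> v) = 'd F y v.
  by move=> yr; rewrite nderiv1E //; apply: dF.
exists (8 * `|C| / rho), (Num.min r (rho / 4)); split.
- by rewrite lt_min r0 divr_gt0.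
- by rewrite divr_ge0 ?mulr_ge0 // ltW.
move=> h; rewrite lt_min => /andP[hr hrho] v.
rewrite -(G x v) ?subrr ?nm0 // -(G (x + h) v); last by rewrite addrAC subrr add0r.
have dG y : nm (y - x) < rho -> differentiable (fun y => nderiv F 1 y (fun=> v)) y.
  by move=> yr; have [_ _] := H y yr; apply.
have GC y : nm (y - x) < rho -> nm (nderiv F 1 y (fun=> v)) <= `|C| * nm v.
  move=> yr; have [_ /(_ (fun=> v)) + _] := H y yr.
  by rewrite big_ord1 => /le_trans; apply; rewrite ler_wpM2r // ler_norm.
have q1 := frechet_quadratic rho0 dG GC (ltW hrho).
have q2 := frechet_le rho0 dG GC h.
set g := fun y => _ in dG q1 q2.
have -> : nderiv F 1 (x + h) (fun=> v) - nderiv F 1 x (fun=> v) = (g (x + h) - g x - 'd g x h) + 'd g x h.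
  by rewrite subrK.
rewrite (le_trans (ler_nmD _ _)) // (le_trans (lerD q1 q2)) //.
have nh := nm_ge0 h; have h2 : nm h ^+ 2 <= rho / 4 * nm h by rewrite expr2 ler_wpM2r // ltW.
have Q0 : 0 <= 16 * (`|C| * nm v) / rho ^+ 2.
  by apply: divr_ge0; [apply: mulr_ge0 => //; exact: mulr_ge0|exact: sqr_ge0].
have := ler_wpM2l Q0 h2.
have -> : 16 * (`|C| * nm v) / rho ^+ 2 * (rho / 4 * nm h) = 4 * `|C| / rho * nm h * nm v.
  by field; rewrite gt_eqF.
have -> : 4 * (`|C| * nm v) / rho * nm h = 4 * `|C| / rho * nm h * nm v by ring.
have -> : 8 * `|C| / rho * nm h * nm v = 2 * (4 * `|C| / rho * nm h * nm v) by ring.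
lra.
Qed.

Lemma nderiv_diff (F : X -> Y) n x v (r : R) : 0 < r -> (forall y, nm (y - x) < r -> differentiable F y) ->
  differentiable (fun y => nderiv F n y v) x /\
  (forall h, nderiv F n.+1 x (vcons h v) = 'd (fun y => nderiv F n y v) x h).
Proof.
move=> r0 dF; have nF := nderiv_regular_all n r0 dF.
split.
  have [rho [C [rho0 H]]] := nF; have [|_ _ dd] := H x; last exact: dd.
  by rewrite subrr nm0.
move=> h; rewrite (nderivSE (nderiv_regular_frechet nF)) vcons0; congr ('d _ x h).
by apply/funext => y; congr (nderiv _ _ _ _); apply/funext => i; rewrite vconsS.
Qed.

End NDeriv.

(** * The bounds *)

Section Caratheodory.
Context {R : realType}.
Local Notation K := R[i].
Local Notation Re := complex.Re.

Lemma ReD (x y : K) : Re (x + y) = Re x + Re y.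
Proof. by case: x y => [a b] [c d]. Qed.

Lemma ReN (x : K) : Re (- x) = - Re x.
Proof. by case: x. Qed.

Lemma Re_realM (t : R) (x : K) : Re (t%:C * x) = t * Re x.
Proof. by case: x => a b; rewrite /= mul0r subr0. Qed.

Lemma Re_realZ (t : R) (x : R[i]^o) : Re (t%:C *: x) = t * Re x.
Proof. exact: Re_realM. Qed.

Lemma nm_circle_point (c : K) (k n : nat) : nm (c * cexp (k%:R / 2 ^+ n * ipi2)) = nm c.
Proof. by rewrite nmM nm_root_of_unity mulr1. Qed.

Lemma Re_cmean_ge0 (f : K -> R[i]^o) n c : (forall z, nm z = nm c -> 0 <= Re (f z)) ->
  0 <= Re (cmean f n c).
Proof.
move=> H; have E : (2 ^+ n)^-1 = ((2 ^+ n)^-1)%:C :> K by rewrite fmorphV rmorphXn /= rmorph_nat.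
rewrite /cmean; set S := \sum_(_ <= _ < _) _; rewrite E Re_realZ mulr_ge0 ?invr_ge0 ?exprn_ge0 //.
rewrite /S; elim/big_rec: _ => [|k x _ IH]; first by [].
by rewrite ReD; apply: addr_ge0 => //; apply: H; exact: nm_circle_point.
Qed.

Lemma cvg_Re_ge0 (u : nat -> R[i]^o) (l : R[i]^o) : u n @[n --> \oo] --> l ->
  (forall n, 0 <= Re (u n)) -> 0 <= Re l.
Proof.
move=> /cvg_nmP ul H; apply/ler_addgt0Pr => e e0.
have [N /(_ N (leqnn N)) HN] := ul e e0.
have := ler_Re_nm (u N - l); rewrite ReD ReN; have := H N; lra.
Qed.

Lemma quad_limit_ge0 (a b c : R) :
  (forall r : R, 0 < r < 1 -> 0 <= a + b * r + c * r ^+ 2) -> 0 <= a + b + c.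
Proof.
move=> H; apply/ler_addgt0Pr => e e0.
pose M := `|b| + 2 * `|c| + 1.
have M0 : 0 < M by rewrite ltr_wpDl // addr_ge0 // mulr_ge0.
pose t := Num.min (1 / 2) (e / M).
have t0 : 0 < t by rewrite lt_min !divr_gt0.
have t2 : t <= 1 / 2 by rewrite ge_min lexx.
have tM : t * M <= e by rewrite -ler_pdivlMr // ge_min lexx orbT.
clearbody t.
have := H (1 - t) _; have -> : 0 < 1 - t < 1 by apply/andP; split; lra.
move=> /(_ isT) {}H.
have h1 : - b * t <= `|b| * t by rewrite ler_wpM2r ?(ltW t0) // -normrN ler_norm.
have h2 : - c * (2 * t - t ^+ 2) <= `|c| * (2 * t).
  rewrite (le_trans (ler_norm _)) // normrM normrN ler_wpM2l // ger0_norm; nra.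
have : t * M = `|b| * t + `|c| * (2 * t) + t by rewrite /M; ring.
have : a + b * (1 - t) + c * (1 - t) ^+ 2 = a + b + c - b * t - c * (2 * t - t ^+ 2) by ring.
lra.
Qed.

(** Take for [e] the unimodular number that makes e D = -|D|. *)
Lemma Re_bounds_nm (D : K) (M : R) : (forall e : K, nm e = 1 -> 0 <= M + Re (e * D)) -> nm D <= M.
Proof.
move=> H; have [D0|D0] := eqVneq D 0.
  by have := H 1 nm1; rewrite D0 nm0 mulr0 -[Re 0]/(0 : R) addr0.
have nD : 0 < nm D by rewrite nm_gt0.
have := H (- (nm D)%:C / D); rewrite nmM nmN nmV nmr ?(ltW nD) // divff ?gt_eqF //.
by move=> /(_ erefl); rewrite divfK // ReN /= subr_ge0.
Qed.

Lemma normc_conj (z : K) : z * z^* = (nm z ^+ 2)%:C.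
Proof. by rewrite -sqr_normc nmE rmorphXn. Qed.

Lemma conjcD (x y : K) : (x + y)^* = x^* + y^*.
Proof. exact: rmorphD. Qed.

Lemma conjcM (x y : K) : (x * y)^* = x^* * y^*.
Proof. exact: rmorphM. Qed.

(** This [b] minimises the quadratic expression on the left, which is evaluated there by completing
    the square; the two sides differ by a multiple of 1 - |e|^2. *)
Lemma caratheodory_square (beta : R) (w v e b : K) : beta != 0 -> nm e = 1 ->
  b = - ((2 * beta)^-1)%:C * (w^* + e * w) ->
  (2 * beta) * ((2 + nm b ^+ 2) * beta + Re ((b^* * e + b) * w) + Re (e * v)) =
  4 * beta ^+ 2 - nm w ^+ 2 + Re (e * (2 * beta%:C * v - w ^+ 2)).
Proof.
move=> beta0 e1 ->; have := normc_nm e; rewrite e1 expr1n !normc_nm.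
have E (z : K) : z = complex.Re z +i* complex.Im z by case: z.
have C (z : K) : z^* = complex.Re z -i* complex.Im z by case: z.
rewrite !C [w]E [e]E [v]E; move: (Re w) (complex.Im w) (Re e) (complex.Im e) (Re v) (complex.Im v).
move=> x y s t p q /= st; apply/eqP; rewrite -subr_eq0.
set lhs := (X in X == 0).
have -> : lhs = (1 - (s ^+ 2 + t ^+ 2)) * (x ^+ 2 + y ^+ 2) / 2.
  by rewrite /lhs !expr2 /=; field.
by rewrite -st subrr !mul0r.
Qed.

(* With p = beta + z g(z) and |al| = 1, the mean of
   Re p(r u) |al + b u + u^2|^2 over the unit circle is nonnegative; let r tend
   to 1 and choose b optimally. *)
Lemma caratheodory (beta : R) (g : K -> K) (g1 : R[i]^o) : 0 < beta ->
  (forall z, nm z < 1 -> exists d : R[i]^o, cderiv (g : K -> R[i]^o) z d) ->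
  cderiv (g : K -> R[i]^o) 0 g1 ->
  (forall z, nm z < 1 -> 0 <= beta + Re (z * g z)) ->
  nm (2 * beta%:C * g1 - g 0 ^+ 2) <= 4 * beta ^+ 2 - nm (g 0) ^+ 2.
Proof.
move=> beta0 dg dg0 pos.
have mean (al b : K) (r : R) : 0 < r < 1 -> nm al = 1 ->
    0 <= (2 + nm b ^+ 2) * beta + Re ((b^* * al + b) * g 0) * r + Re (al * g1) * r ^+ 2.
  move=> /andP[r0 r1] al1; pose c : K := r%:C.
  have nc : nm c = r by rewrite nmr // ltW.
  have c0 : c != 0 by rewrite -nm_gt0 nc.
  pose p z : K := beta%:C + z * g z.
  (* [A0], [B1], [B2] and their conjugates are the coefficients of |al + b u + u^2|^2 as a Laurent
     polynomial in u = z / c on the unit circle. *)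
  pose A0 : K := (2 + nm b ^+ 2)%:C.
  pose B1 : K := b * al^* + b^*; pose B2 : K := al^*.
  pose Q z : K := A0 + B1 * (z / c) + B2 * (z / c) ^+ 2 + B1^* * (z / c)^-1 + B2^* * (z / c) ^- 2.
  have QE z : nm z = r -> Q z = (nm (al + b * (z / c) + (z / c) ^+ 2) ^+ 2)%:C.
    move=> zr; set u := z / c.
    have u1 : nm u = 1 by rewrite nmM nmV nc zr divff // gt_eqF.
    have uu : u * u^* = 1 by rewrite normc_conj u1 expr1n.
    have u0 : u != 0 by rewrite -nm_gt0 u1.
    have uV : u^-1 = u^* by apply: (mulfI u0); rewrite mulfV // uu.
    have alal : al * al^* = 1 by rewrite normc_conj al1 expr1n.
    rewrite -normc_conj /Q /A0 /B1 /B2 -/u rmorphD /= rmorph_nat -normc_conj.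
    move: u1 => _; clearbody u.
    rewrite !(expr2, conjcD, conjcM, conjCK) -uV.
    move: (al^*) alal => al' alal; move: (b^*) => b'.
    have al0 : al != 0 by rewrite -nm_gt0 al1.
    have -> : al' = al^-1 by apply: (mulfI al0); rewrite alal mulfV.
    by field; rewrite u0 al0.
  have dgz z : 0 < nm z <= nm c -> exists d : R[i]^o, cderiv (g : K -> R[i]^o) z d.
    by rewrite nc => /andP[_ zr]; apply: dg; rewrite (le_lt_trans zr).
  have m0 : cmean (g : K -> R[i]^o) n c @[n --> \oo] --> (g 0 : R[i]^o).
    by apply: cmean_mvp => //; exact: cderiv_has_limit0 dg0.
  pose G z : R[i]^o := z^-1 * (g z - g 0).
  have m1 : cmean G n c @[n --> \oo] --> g1.
    apply: cmean_mvp => //.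
      move=> z zr; have [d hd] := dgz z zr; eexists; apply: cderivM.
        by apply: cderiv_inv; rewrite -nm_gt0; case/andP: zr.
      exact: cderivB hd (cderiv_cst _ _).
    have := divided_diff_cvg dg0 => H e e0; have [s s0 {}H] := H e e0.
    by exists s => // h /H; rewrite add0r.
  have mV : cmean (fun z => z^-1 : R[i]^o) n c @[n --> \oo] --> (0 : R[i]^o).
    have := @cmean_sub_inv R 0 c; rewrite nm0 nc => /(_ r0).
    by under eq_fun do under eq_fun do rewrite subr0.
  have mV2 : cmean (fun z => z^-1 ^+ 2 : R[i]^o) n c @[n --> \oo] --> (0 : R[i]^o).
    apply: cmean_decay => //.
      move=> z zc; have z0 : z != 0 by rewrite -nm_gt0 (lt_le_trans _ zc) // nc.
      exact: cderivX (cderiv_inv z0).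
    move=> e e0; exists (1 + e^-1) => z zM.
    have p0 : 0 < e^-1 by rewrite invr_gt0.
    have z1 : 1 <= nm z by lra.
    rewrite nmX nmV; apply: (@le_trans _ _ (nm z)^-1).
      by rewrite expr2 ler_piMl ?invr_ge0 // invf_le1 // (lt_le_trans ltr01).
    by rewrite -[e]invrK lef_pV2 ?posrE //; lra.
  have mp k : cmean (fun z => z ^+ k * p z : R[i]^o) n c @[n --> \oo] --> (0 ^+ k * beta%:C : R[i]^o).
    have E0 : (0 : K) ^+ k * p 0 = 0 ^+ k * beta%:C by rewrite /p mul0r addr0.
    have dd z : nm z < 1 -> exists d : R[i]^o, cderiv (fun z => z ^+ k * p z : R[i]^o) z d.
      move=> z1; have [d hd] := dg z z1; have [d' hd'] := cderivX k (cderiv_id z).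
      have hp := cderivD (@cderiv_cst R R[i]^o beta%:C z) (cderivM (cderiv_id z) hd).
      by eexists; exact: cderivM hd' hp.
    apply: cmean_mvp => //.
      by move=> z /andP[_ zr]; apply: dd; rewrite (le_lt_trans zr) // nc.
    have [|d hd] := dd 0; first by rewrite nm0.
    by have := cderiv_has_limit0 hd; rewrite E0.
  (* Only the constant term of [Q * p] survives: the coefficients of [Q] of degree 0, -1 and -2 meet
     the Taylor coefficients beta, g 0 and g1 of [p]. *)
  have lim : cmean (fun z => Q z * p z : R[i]^o) n c @[n --> \oo] -->
      (A0 * beta%:C + (B1^* * c * g 0 + B2^* * c ^+ 2 * g1) : R[i]^o).
    pose F0 (z : K) : R[i]^o := z ^+ 0 * p z.
    pose F1 (z : K) : R[i]^o := z ^+ 1 * p z.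
    pose F2 (z : K) : R[i]^o := z ^+ 2 * p z.
    pose V1 (z : K) : R[i]^o := z^-1.
    pose V2 (z : K) : R[i]^o := z^-1 ^+ 2.
    have -> : (fun n => cmean (fun z => Q z * p z : R[i]^o) n c) = (fun n =>
        A0 *: cmean F0 n c + ((B1 / c) *: cmean F1 n c + (B2 / c ^+ 2) *: cmean F2 n c)
        + ((B1^* * c) *: (beta%:C *: cmean V1 n c + cmean (g : K -> R[i]^o) n c)
        + (B2^* * c ^+ 2) *: (beta%:C *: cmean V2 n c + (cmean G n c + g 0 *: cmean V1 n c)))).
      apply/funext => n; rewrite -!cmeanZ -!cmeanD -!cmeanZ -!cmeanD.
      apply: eq_cmean => z zc; have z0 : z != 0 by rewrite -nm_gt0 zc nc.
      rewrite /Q /F0 /F1 /F2 /V1 /V2 /G /p -![_ *: _]/(_ * _ : K).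
      by move: (B1^*) (B2^*) => b1 b2; field; rewrite z0 c0.
    have cvg_eq (u : nat -> R[i]^o) (l l' : R[i]^o) : u n @[n --> \oo] --> l -> l = l' ->
      u n @[n --> \oo] --> l' by move=> ? <-.
    apply: (cvg_eq _ _ _ (cvgD (cvgD (cvgZl_tmp (mp 0%N)) (cvgD (cvgZl_tmp (mp 1%N)) (cvgZl_tmp (mp 2%N))))
      (cvgD (cvgZl_tmp (cvgD (cvgZl_tmp mV) m0))
         (cvgZl_tmp (cvgD (cvgZl_tmp mV2) (cvgD m1 (cvgZl_tmp mV))))))).
    rewrite -![_ *: _]/(_ * _ : K).
    by move: (B1^*) (B2^*) => b1 b2; ring.
  have Re_nonneg : 0 <= Re (A0 * beta%:C + (B1^* * c * g 0 + B2^* * c ^+ 2 * g1)).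
    apply: (cvg_Re_ge0 lim) => n; apply: Re_cmean_ge0 => z; rewrite nc => zr.
    rewrite QE // Re_realM mulr_ge0 ?sqr_ge0 // /p ReD /=.
    by apply: pos; rewrite zr.
  move: Re_nonneg; rewrite !ReD /A0 Re_realM /=.
  have -> : B1^* * c * g 0 = c * ((b^* * al + b) * g 0).
    by rewrite /B1 conjcD conjcM !conjCK; ring.
  have -> : B2^* * c ^+ 2 * g1 = (r ^+ 2)%:C * (al * g1).
    by rewrite /B2 conjCK rmorphXn /=; ring.
  by rewrite !Re_realM mulrC [r * _]mulrC [r ^+ 2 * _]mulrC addrA [beta * _]mulrC.
apply: Re_bounds_nm => e e1.
pose b : K := - ((2 * beta)^-1)%:C * ((g 0)^* + e * g 0).
have := @quad_limit_ge0 _ _ _ (fun r r01 => mean e b r r01 e1).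
by rewrite -(@caratheodory_square beta (g 0) g1 e b (lt0r_neq0 beta0) e1 erefl) => H; rewrite mulr_ge0 // mulr_ge0 // ltW.
Qed.

End Caratheodory.

(** * Optimisation of the Hermitian-Toeplitz determinant *)

Section ToeplitzBounds.
Context {R : realType}.
Local Notation K := R[i].
Local Notation Re := complex.Re.

Lemma det_mx22 (M : 'M[K]_2) : \det M = M 0 0 * M 1 1 - M 0 1 * M 1 0.
Proof.
rewrite (expand_det_row _ 0) !big_ord_recl big_ord0 addr0 /cofactor !det_mx11 !mxE /=.
rewrite expr0 expr1 mul1r mulN1r mulrN.
have -> : lift 0 0 = 1 :> 'I_2 by apply/val_inj.
by have -> : lift 1 0 = 0 :> 'I_2 by apply/val_inj.
Qed.

Lemma det_mx33 (M : 'M[K]_3) : \det M =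
    M 0 0 * (M 1 1 * M 2 2 - M 1 2 * M 2 1)
  - M 0 1 * (M 1 0 * M 2 2 - M 1 2 * M 2 0)
  + M 0 2 * (M 1 0 * M 2 1 - M 1 1 * M 2 0).
Proof.
rewrite (expand_det_row _ 0) !big_ord_recl big_ord0 addr0 /cofactor !det_mx22 !mxE /=.
have -> : lift 0 0 = 1 :> 'I_3 by apply/val_inj.
have -> : lift 0 (1 : 'I_2) = 2 :> 'I_3 by apply/val_inj.
have -> : lift 1 (0 : 'I_2) = 0 :> 'I_3 by apply/val_inj.
have -> : lift 1 (1 : 'I_2) = 2 :> 'I_3 by apply/val_inj.
have -> : lift ord0 (lift ord0 ord0) = 2 :> 'I_3 by apply/val_inj.
have -> : lift 2 (0 : 'I_2) = 0 :> 'I_3 by apply/val_inj.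
have -> : lift 2 (1 : 'I_2) = 1 :> 'I_3 by apply/val_inj.
rewrite -[ord0]/(0 : 'I_3) /bump /=.
ring.
Qed.

Lemma toeplitz_det (X : completeNormedModType K) (F : X -> X) (T : X -> K) x0 :
  hermitian_toeplitz31 F T x0 =
  ((1 - nm (coef F T x0 2) ^+ 2) ^+ 2 - nm (coef F T x0 3 - coef F T x0 2 ^+ 2) ^+ 2)%:C.
Proof.
rewrite /hermitian_toeplitz31 det_mx33 !mxE /=.
move: (coef F T x0 2) (coef F T x0 3) => a b.
have -> : ((1 - nm a ^+ 2) ^+ 2 - nm (b - a ^+ 2) ^+ 2)%:C =
    (1 - (nm a ^+ 2)%:C) ^+ 2 - (nm (b - a ^+ 2) ^+ 2)%:C by rewrite rmorphB rmorphXn rmorphB rmorph1.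
rewrite -!normc_conj !(expr2, conjcD, conjcM, rmorphN) /= conjcM.
ring.
Qed.

(** Here s = |A_2|^2 and d = |A_3 - A_2^2|. With the largest [d] allowed, the determinant is a
    convex quadratic in [s]; the bound is its value at the vertex s = beta^2 (7 + beta) / (4 (2 beta
    - 1) (beta + 1)). *)
Lemma toeplitz_lower (beta s d : R) : 1 <= beta <= 3 / 2 -> 0 <= s -> 0 <= d ->
  3 * beta * d <= beta ^+ 2 - (2 - beta) * s ->
  lower_bound31 (beta - 1 / 2) <= (1 - s) ^+ 2 - d ^+ 2.
Proof.
move=> /andP[b1 b2] s0 d0 H.
have b0 : 0 < beta by lra.
have lin : 0 <= beta ^+ 2 - (2 - beta) * s by rewrite (le_trans _ H) // !mulr_ge0 // ltW.
have d2 : d ^+ 2 <= (beta ^+ 2 - (2 - beta) * s) ^+ 2 / (9 * beta ^+ 2).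
  rewrite ler_pdivlMr ?mulr_gt0 ?exprn_gt0 //.
  have -> : d ^+ 2 * (9 * beta ^+ 2) = (3 * beta * d) ^+ 2 by ring.
  by rewrite ler_sqr ?nnegrE // !mulr_ge0 // ltW.
have h1 : 0 < beta - 1 / 2 by lra.
have h2 : 0 < beta + 1 by lra.
have -> : lower_bound31 (beta - 1 / 2) = (1 - s) ^+ 2 - (beta ^+ 2 - (2 - beta) * s) ^+ 2 / (9 * beta ^+ 2)
  - 4 * (beta + 1) * (2 * beta - 1) / (9 * beta ^+ 2) *
    (s - beta ^+ 2 * (7 + beta) / (4 * (2 * beta - 1) * (beta + 1))) ^+ 2.
  rewrite /lower_bound31; field.
  by apply/and4P; split; rewrite gt_eqF //; lra.
suff : 0 <= 4 * (beta + 1) * (2 * beta - 1) / (9 * beta ^+ 2) *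
    (s - beta ^+ 2 * (7 + beta) / (4 * (2 * beta - 1) * (beta + 1))) ^+ 2 by lra.
rewrite mulr_ge0 ?sqr_ge0 // divr_ge0 ?mulr_ge0 ?sqr_ge0 //; lra.
Qed.

(** For s <= beta the first square is at most 1. Beyond, the least [d] allowed leaves a convex
    function of [s] on [beta, beta^2], bounded by its end values (1 - beta)^2 <= 1 and [U]. The
    condition U <= 1 reads (8 beta + 1)^2 <= 153. *)
Lemma toeplitz_upper (beta s d : R) : 1 <= beta <= 3 / 2 -> 0 <= s <= beta ^+ 2 -> 0 <= d ->
  s - beta <= 3 * d ->
  (1 - s) ^+ 2 - d ^+ 2 <= upper_bound31 (beta - 1 / 2).
Proof.
move=> /andP[b1 b2] /andP[s0 sb] d0 H.
pose U := 1 + beta ^+ 2 * (8 * beta ^+ 2 + 2 * beta - 19) / 9.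
have UE : 1 + (1 + 2 * (beta - 1 / 2)) ^+ 2 * (4 * (beta - 1 / 2) ^+ 2 + 5 * (beta - 1 / 2) - 8) / 18 = U.
  by rewrite /U; field.
have max1 : (1 - s) ^+ 2 - d ^+ 2 <= Num.max 1 U.
  rewrite le_max; have [sb1|sb1] := leP s beta.
    by apply/orP; left; nra.
  have d2 : ((s - beta) / 3) ^+ 2 <= d ^+ 2 by rewrite ler_sqr ?nnegrE //; lra.
  have [s2|s2] := leP ((1 - s) ^+ 2 - ((s - beta) / 3) ^+ 2) 1; apply/orP; [left; lra|right].
  (* The slope of the chord from beta to [s]. If the value at [s] exceeds 1, this slope is positive,
     and so is the larger slope of the chord from [s] to beta^2. *)
  pose k := 8 / 9 * (s + beta) - 2 + 2 * beta / 9.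
  have k0 : 0 < k.
    have fb : (1 - beta) ^+ 2 <= 1 by nra.
    have E : (1 - s) ^+ 2 - ((s - beta) / 3) ^+ 2 = (1 - beta) ^+ 2 + (s - beta) * k by rewrite /k; field.
    have : 0 < (s - beta) * k by lra.
    by rewrite pmulr_rgt0 // subr_gt0.
  have bb : 0 <= beta ^+ 2 - beta by nra.
  have : 0 <= (beta ^+ 2 - s) * (k + 8 / 9 * (beta ^+ 2 - beta)).
    by rewrite mulr_ge0 ?subr_ge0 // addr_ge0 ?(ltW k0) // mulr_ge0.
  have -> : (beta ^+ 2 - s) * (k + 8 / 9 * (beta ^+ 2 - beta)) = U - ((1 - s) ^+ 2 - ((s - beta) / 3) ^+ 2).
    by rewrite /k /U; field.
  lra.
rewrite /upper_bound31 UE.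
have sq : Num.sqrt 153 ^+ 2 = 153 :> R by rewrite sqr_sqrtr.
have sq0 : 0 <= Num.sqrt 153 :> R by rewrite sqrtr_ge0.
have sq8 : (0 <= 8 * beta + 1) by lra.
case: ifP => [hl|/negbT]; rewrite -?ltNge.
  rewrite (le_trans max1) // ge_max lexx /= /U gerDl.
  have : (8 * beta + 1) ^+ 2 <= 153 by rewrite -sq ler_sqr ?nnegrE //; lra.
  move=> h; have : 8 * beta ^+ 2 + 2 * beta - 19 <= 0 by lra.
  have := sqr_ge0 beta; nra.
move=> hl; rewrite (le_trans max1) // ge_max lexx andbT /U lerDl.
have : 153 <= (8 * beta + 1) ^+ 2 by rewrite -sq ler_sqr ?nnegrE //; lra.
move=> h; have : 0 <= 8 * beta ^+ 2 + 2 * beta - 19 by lra.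
have := sqr_ge0 beta; nra.
Qed.

(** The hypothesis is the Caratheodory inequality for g 0 = 2 a and g1 = 6 b - 4 a^2. Since 12 beta
    (b - a^2) = D - 4 (beta - 1) a^2, the triangle inequality gives an upper and a lower estimate of
    |b - a^2|, one for each bound. *)
Lemma toeplitz_bounds (beta : R) (a b : K) : 1 <= beta <= 3 / 2 ->
  nm (2 * beta%:C * (6 * b - 4 * a ^+ 2) - (2 * a) ^+ 2) <= 4 * beta ^+ 2 - nm (2 * a) ^+ 2 ->
  lower_bound31 (beta - 1 / 2) <= (1 - nm a ^+ 2) ^+ 2 - nm (b - a ^+ 2) ^+ 2 /\
  (1 - nm a ^+ 2) ^+ 2 - nm (b - a ^+ 2) ^+ 2 <= upper_bound31 (beta - 1 / 2).
Proof.
move=> bb H; have /andP[b1 b2] := bb.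
have b0 : 0 < beta by lra.
set D := 2 * beta%:C * (6 * b - 4 * a ^+ 2) - (2 * a) ^+ 2 in H.
set s := nm a ^+ 2; have s0 : 0 <= s by exact: sqr_ge0.
have n2 : nm (2 : K) = 2 by rewrite -(rmorph_nat (real_complex R)) nmr.
have {}H : nm D <= 4 * beta ^+ 2 - 4 * s by move: H; rewrite nmM n2 exprMn /s; lra.
have sb : s <= beta ^+ 2 by have := nm_ge0 D; lra.
have n1 : nm ((4 * (beta - 1))%:C * a ^+ 2) = 4 * (beta - 1) * s.
  by rewrite nmM nmX nmr // mulr_ge0 //; lra.
have n12 : nm ((12 * beta)%:C * (b - a ^+ 2)) = 12 * beta * nm (b - a ^+ 2).
  by rewrite nmM nmr // mulr_ge0 // ltW.
have E : (12 * beta)%:C * (b - a ^+ 2) = D - (4 * (beta - 1))%:C * a ^+ 2.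
  by rewrite /D !rmorphM rmorphB rmorph1 /= !rmorph_nat; ring.
split.
  apply: toeplitz_lower => //.
  have := ler_nmB D ((4 * (beta - 1))%:C * a ^+ 2); rewrite -E n1 n12; lra.
apply: toeplitz_upper => //; first by rewrite s0.
have := nm_lower ((4 * (beta - 1))%:C * a ^+ 2) D; rewrite nm_distC -E n1 n12 => h.
have : 4 * beta * (s - beta) <= 4 * beta * (3 * nm (b - a ^+ 2)) by lra.
by rewrite ler_pM2l // mulr_gt0.
Qed.

End ToeplitzBounds.

(** * Differentiating the solution of a parametrised linear equation *)

Section InverseFamily.
Context {R : realType} {X : normedModType R[i]}.
Local Notation K := R[i].

(** Differentiating A(s) W(s) = b(s) formally gives A W' = b' - A' W. The increment of [W] is first
    bounded by a multiple of |h|: it occurs on both sides of the inequality, on the right with a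
    factor at most 1 / 2, and is absorbed. *)
Lemma cderiv_inverse_family (A : K -> {linear X -> X}) (Inv : {linear X -> X})
    (b W A' : _ -> X) (b' : X) (z : K) (L B r : R) :
  0 < r -> 0 <= L -> 0 < B ->
  cancel (A z) Inv -> (forall u, nm (Inv u) <= B * nm u) ->
  (forall h, nm h < r -> forall v, nm (A (z + h) v - A z v) <= L * nm h * nm v) ->
  (forall v, cderiv (fun s => A s v) z (A' v)) ->
  (forall h, nm h < r -> A (z + h) (W (z + h)) = b (z + h)) ->
  cderiv b z b' ->
  cderiv W z (Inv (b' - A' (W z))).
Proof.
move=> r0 L0 B0 AI bI lipA dA AW db.
have AW0 : A z (W z) = b z by have := AW 0; rewrite nm0 addr0; apply.
set w := W z in AW0 *.
have LA s u v : A s (u - v) = A s u - A s v := linearB (A s) u v.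
have E h : nm h < r -> W (z + h) - w = Inv ((b (z + h) - b z) -
    (A (z + h) w - A z w) - (A (z + h) (W (z + h) - w) - A z (W (z + h) - w))).
  move=> hr; rewrite -[LHS]AI -AW // -AW0; congr (Inv _).
  by rewrite !LA; vmod K X.
have [r1 r10 H1] := cderiv_lip db.
(* The Lipschitz constant left after absorption; the radius [r2] below ensures B L |h| <= 1 / 2. *)
pose M := 2 * (B * ((nm b' + 1) + L * nm w)).
have M0 : 0 <= M by rewrite !mulr_ge0 ?(ltW B0) // !addr_ge0 // mulr_ge0.
pose r2 := (2 * B * (L + 1))^-1.
have L1 : 0 < L + 1 by rewrite ltr_wpDl.
have r20 : 0 < r2 by rewrite invr_gt0 !mulr_gt0.
have bnd h : nm h < r -> nm h < r1 -> nm h <= r2 -> nm (W (z + h) - w) <= M * nm h.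
  move=> hr hr1 hr2; set d := nm (W (z + h) - w).
  have : d <= B * ((nm b' + 1) * nm h + L * nm h * nm w + L * nm h * d).
    rewrite /d {1}E // (le_trans (bI _)) // ler_wpM2l ?(ltW B0) //.
    rewrite (le_trans (ler_nmB _ _)) // lerD ?lipA // (le_trans (ler_nmB _ _)) // lerD ?lipA //.
    exact: H1.
  have small : B * (L * nm h) <= 1 / 2.
    have : nm h * (2 * B * (L + 1)) <= 1 by rewrite -ler_pdivlMr ?mulr_gt0 // mul1r.
    have : 0 <= nm h * B by rewrite mulr_ge0 // ltW.
    lra.
  have d0 : 0 <= d by exact: nm_ge0.
  have : B * (L * nm h) * d <= 1 / 2 * d by rewrite ler_wpM2r.
  rewrite /M; lra.
move=> e e0.
pose e1 := e / (4 * B); have e10 : 0 < e1 by rewrite divr_gt0 // mulr_gt0.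
have [r3 r30 H3] := db e1 e10.
have [r4 r40 H4] := dA w e1 e10.
pose r5 := e / (2 * B * (L * M + 1)).
have LM1 : 0 < L * M + 1 by rewrite ltr_wpDl // mulr_ge0.
have r50 : 0 < r5 by rewrite divr_gt0 // !mulr_gt0.
exists (Num.min (Num.min r r1) (Num.min (Num.min r2 r3) (Num.min r4 r5))).
  by rewrite !lt_min r0 r10 r20 r30 r40.
move=> h; rewrite !lt_min => /andP[/andP[hr hr1] /andP[/andP[hr2 hr3] /andP[hr4 hr5]]].
have -> : W (z + h) - w - h *: Inv (b' - A' w) = Inv ((b (z + h) - b z - h *: b')
   - (A (z + h) w - A z w - h *: A' w) - (A (z + h) (W (z + h) - w) - A z (W (z + h) - w))).
  have LI u v : Inv (u - h *: v) = Inv u - h *: Inv v by rewrite linearB linearZ.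
  by rewrite {1}E // -LI; congr (Inv _); vmod K X.
have h1 := H3 h hr3; have h2 := H4 h hr4.
have h3 : nm (A (z + h) (W (z + h) - w) - A z (W (z + h) - w)) <= L * nm h * (M * nm h).
  rewrite (le_trans (lipA _ hr _)) // ler_wpM2l ?mulr_ge0 // bnd // ltW //.
have h4 : L * nm h * (M * nm h) <= e / (2 * B) * nm h.
  have : nm h * (2 * B * (L * M + 1)) <= e by rewrite -ler_pdivlMr ?mulr_gt0 // ltW.
  move=> hh; have -> : L * nm h * (M * nm h) = (nm h * (L * M)) * nm h by ring.
  rewrite ler_wpM2r // ler_pdivlMr ?mulr_gt0 //.
  have : 0 <= nm h * B by rewrite mulr_ge0 // ltW.
  lra.
rewrite (le_trans (bI _)) //.
apply: (@le_trans _ _ (B * (e1 * nm h + e1 * nm h + e / (2 * B) * nm h))).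
  rewrite ler_wpM2l ?(ltW B0) // (le_trans (ler_nmB _ _)) // lerD ?(le_trans h3) //.
  by rewrite (le_trans (ler_nmB _ _)) // lerD.
rewrite le_eqVlt; apply/orP; left; apply/eqP; rewrite /e1; field; rewrite gt_eqF //.
Qed.

End InverseFamily.

(** * Restriction to a complex line and the two inequalities *)

Section Forward.
Context {R : realType} {X : completeNormedModType R[i]}.
Local Notation K := R[i].
Local Notation Re := complex.Re.

Lemma norm_lt1 (x : X) : (`|x| < 1) = (nm x < 1).
Proof. by rewrite nmE -[1 in LHS]/(1%:C) ltcR. Qed.

Lemma norm_eq1 (x : X) : `|x| = 1 -> nm x = 1.
Proof. by rewrite /nm => ->. Qed.

Lemma nmK1 (x : X) : nm x = 1 -> `|x| = 1.
Proof. by rewrite nmE => ->. Qed.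

Lemma diff_invP (F : X -> X) x : bijective ('d F x : X -> X) ->
  cancel ('d F x) (diff_inv F x) /\ cancel (diff_inv F x) ('d F x).
Proof.
move=> bij; split=> u; rewrite /diff_inv.
  by rewrite pinvKV ?inE // => a b _ _; exact: (bij_inj bij).
apply: pinvK; rewrite inE; have [g gK Kg] := bij.
by exists (g u); rewrite ?Kg.
Qed.

Lemma diff_inv_linear (F : X -> X) x : bijective ('d F x : X -> X) -> linear (diff_inv F x).
Proof.
move=> bij a u v; have [KI IK] := diff_invP bij.
apply: (bij_inj bij); rewrite linearP !IK //.
Qed.

Lemma cderiv_linear (Y : normedModType K) (T : {linear X -> Y}) (f : K -> X) z d :
  continuous T -> cderiv f z d -> cderiv (fun s => T (f s)) z (T d).
Proof.
move=> /linear_nm_bounded[B B0 HB] fd e e0.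
have [|r r0 H] := fd (e / B); first by rewrite divr_gt0.
exists r => // h /H {}H.
have -> : T (f (z + h)) - T (f z) - h *: T d = T (f (z + h) - f z - h *: d).
  have TB u v : T (u - v) = T u - T v := linearB T u v.
  by rewrite !TB (linearZ_LR T).
rewrite (le_trans (HB _)) // -ler_pdivlMl // (le_trans H) //.
by rewrite mulrA [_ / B]mulrC.
Qed.

(** A unimodular factor carries a functional supporting x0 to one supporting z x0. The condition on
    the whole line is thus expressed through the single functional [T], which keeps it holomorphic
    in [z]. *)
Lemma supporting_rotate (T : {linear X -> R[i]^o}) x0 (z : K) : z != 0 -> nm x0 = 1 ->
  supporting x0 T -> exists2 T' : {linear X -> R[i]^o}, supporting (z *: x0) T' &
    forall u, T' u = (nm z)%:C / z * T u.
Proof.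
move=> z0 x01 [cT Tx opT].
have nz : 0 < nm z by rewrite nm_gt0.
pose k := (nm z)%:C / z.
have nk : nm k = 1 by rewrite nmM nmV nmr // divff // gt_eqF.
have lin : linear (fun u => k * T u : R[i]^o).
  by move=> a u v; rewrite linearP mulrDr -![_ *: _]/(_ * _ : K) mulrCA.
pose T' : {linear X -> R[i]^o} := HB.pack (fun u => k * T u : R[i]^o)
  (GRing.isLinear.Build K X R[i]^o _ (fun u => k * T u : R[i]^o) lin).
exists T'; [split|by []].
- have [B B0 HB] := linear_nm_bounded cT.
  by apply: (@nm_bounded_continuous _ _ _ T' B) => h; rewrite /= nmM nk mul1r.
- rewrite /= linearZ /= Tx nmK1 // -[_ *: _]/(_ * _ : K) mulr1 /k divfK //.
  by rewrite nmE nmZ x01 mulr1.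
have NT y : nm (T' y) = nm (T y) by rewrite /= nmM nk mul1r.
rewrite -opT /opnorm; congr sup; apply/seteqP; split=> _ [y y1 <-]; exists y => //.
  exact: esym (NT y).
exact: NT.
Qed.

Section Slices.
Variables (F : X -> X) (x0 : X).
Hypothesis dF : forall y : X, nm y < 1 -> differentiable F y.
Hypothesis x01 : nm x0 = 1.

Lemma ball_around x : nm x < 1 -> exists2 r : R, 0 < r & forall y, nm (y - x) < r -> differentiable F y.
Proof.
move=> x1; exists (1 - nm x); first by rewrite subr_gt0.
by move=> y yr; apply: dF; rewrite -[y](subrK x) (le_lt_trans (ler_nmD _ _)) //; lra.
Qed.

Lemma cderiv_nderiv_slice n x z : nm (z *: x) < 1 ->
  cderiv (fun s => nderiv F n (s *: x) (fun=> x)) z (nderiv F n.+1 (z *: x) (fun=> x)).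
Proof.
move=> zx; have [r r0 dr] := ball_around zx.
have [dd E] := nderiv_diff ((fun=> x) : 'I_n -> X) r0 dr.
have -> : (fun=> x) = vcons x (fun=> x) :> ('I_n.+1 -> X).
  by apply/funext => i; rewrite /vcons; case: unlift.
rewrite E.
have := @cderiv_slice _ _ _ (fun y => nderiv F n y (fun=> x)) 0 x z.
rewrite add0r => /(_ dd); apply: eq_cderiv => s; by rewrite add0r.
Qed.

(** In [nderiv F 2] the direction of the last differentiation occupies slot 0. *)
Lemma diff_dir_slice z v : nm z < 1 ->
  cderiv (fun s => 'd F (s *: x0) v) z (nderiv F 2 (z *: x0) (vcons x0 (fun=> v))).
Proof.
move=> z1; have zx : nm (z *: x0) < 1 by rewrite nmZ x01 mulr1.
have [r r0 dr] := ball_around zx.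
have [dd E] := nderiv_diff ((fun=> v) : 'I_1 -> X) r0 dr.
rewrite E.
have := @cderiv_slice _ _ _ (fun y => nderiv F 1 y (fun=> v)) 0 x0 z.
rewrite add0r => /(_ dd); apply: (@cderiv_local _ _ _ _ _ _ (1 - nm z)); first by rewrite subr_gt0.
move=> h hz; rewrite add0r nderiv1E //; apply: dF; rewrite nmZ x01 mulr1.
by rewrite (le_lt_trans (ler_nmD _ _)) //; lra.
Qed.

Lemma nderiv2_scale x (a : K) h : nm x < 1 ->
  nderiv F 2 x (fun=> a *: h) = a ^+ 2 *: nderiv F 2 x (fun=> h).
Proof.
move=> x1; have [r r0 dr] := ball_around x1.
have vE (u : X) : (fun=> u) = vcons u (fun=> u) :> ('I_2 -> X).
  by apply/funext => i; rewrite /vcons; case: unlift.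
have [dd E] := nderiv_diff ((fun=> h) : 'I_1 -> X) r0 dr.
have [_ Ea] := nderiv_diff ((fun=> a *: h) : 'I_1 -> X) r0 dr.
rewrite vE Ea [in RHS]vE E.
have [|_ Eq] := @differentiable_local _ _ _ (fun y => nderiv F 1 y (fun=> a *: h))
  (a *: (fun y => nderiv F 1 y (fun=> h))) x r r0 _ (differentiableZ a dd).
  move=> y yr; rewrite -[RHS]/(a *: nderiv F 1 y (fun=> h)) !(nderiv1E (dr y yr)).
  exact: linearZ.
apply: (etrans (congr1 (@^~ (a *: h)) Eq)).
apply: (etrans (congr1 (@^~ (a *: h)) (diffZ a dd))).
by rewrite /= linearZ /= scalerA.
Qed.

End Slices.

(** With g(z) = T (DF(z x0)^-1 D^2F(z x0)(x0, x0)), membership in the class at z x0 reads Re (1 + z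
    g(z)) >= 1/2 - lam, that is, beta + Re (z g(z)) >= 0 with beta = 1/2 + lam. Moreover g(0) = 2
    A_2 and g'(0) = 6 A_3 - 4 A_2^2. *)
Lemma forward_bounds (F : X -> X) (lam : R) x0 (T : {linear X -> R[i]^o}) :
  2^-1 <= lam <= 1 ->
  locally_biholomorphic F -> scalar_type_coefficients F -> Fhat lam F ->
  `|x0| = 1 -> supporting x0 T ->
  (lower_bound31 lam)%:C <= hermitian_toeplitz31 F T x0 /\
  hermitian_toeplitz31 F T x0 <= (upper_bound31 lam)%:C.
Proof.
move=> hlam [holo lbi] scal [[F0 DF0] _ pos] /norm_eq1 x01 sT.
have [cT Tx0 _] := sT.
have {}Tx0 : T x0 = 1 by rewrite Tx0 nmK1.
have dF y : nm y < 1 -> differentiable F y by rewrite -norm_lt1; exact: holo.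
have {}lbi y : nm y < 1 -> bijective ('d F y : X -> X) /\ continuous (diff_inv F y).
  by rewrite -norm_lt1; exact: lbi.
have zx z : nm z < 1 -> nm (z *: x0) < 1 by rewrite nmZ x01 mulr1.
pose f n z := nderiv F n (z *: x0) (fun=> x0).
have df n z : nm z < 1 -> cderiv (f n) z (f n.+1 z).
  by move=> z1; exact: cderiv_nderiv_slice dF _ _ _ (zx z z1).
have f1 z : nm z < 1 -> f 1%N z = 'd F (z *: x0) x0.
  by move=> z1; rewrite /f nderiv1E //; exact/dF/zx.
pose W1 z := diff_inv F (z *: x0) (f 2%N z).
pose A' z v := nderiv F 2 (z *: x0) (vcons x0 (fun=> v)).
have dW1 z : nm z < 1 -> cderiv W1 z (diff_inv F (z *: x0) (f 3%N z - A' z (W1 z))).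
  move=> z1; have [bij cI] := lbi _ (zx z z1).
  have [KI IK] := diff_invP bij.
  pose Inv : {linear X -> X} := HB.pack (diff_inv F (z *: x0))
    (GRing.isLinear.Build K X X _ (diff_inv F (z *: x0)) (diff_inv_linear bij)).
  have [B B0 HB] := @linear_nm_bounded _ _ _ Inv cI.
  have [r r0 dr] := ball_around dF (zx z z1).
  have [L [rho [rho0 L0 lip]]] := diff_lipschitz r0 dr.
  have z10 : 0 < 1 - nm z by rewrite subr_gt0.
  apply: (@cderiv_inverse_family _ _ (fun s => 'd F (s *: x0)) Inv (f 2%N) W1 (A' z) (f 3%N z) z
    L B (Num.min rho (1 - nm z))) => //.
  - by rewrite lt_min rho0.
  - move=> h; rewrite lt_min => /andP[hr _] v; rewrite scalerDl.
    by have := lip (h *: x0); rewrite nmZ x01 mulr1; apply.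
  - by move=> v; exact: diff_dir_slice.
  - move=> h; rewrite lt_min => /andP[_ hr].
    have zh : nm (z + h) < 1 by rewrite (le_lt_trans (ler_nmD _ _)) //; lra.
    by have [_ IKh] := diff_invP (lbi _ (zx _ zh)).1; exact: IKh.
  - exact: df.
have nm0K : nm (0 : K) < 1 by rewrite nm0.
have nm0X : nm (0 : X) < 1 by rewrite nm0.
have inv0 u : diff_inv F (0 *: x0) u = u.
  have [_ IK] := diff_invP (lbi _ (zx 0 nm0K)).1.
  by have := IK u; rewrite scale0r DF0.
have [H1 _ H1E] := scal 1%N isT; have [H2 _ H2E] := scal 2%N isT.
set a := H1 x0; set b := H2 x0.
have f20 : f 2%N 0 = (2 * a) *: x0.
  rewrite /f scale0r; have := H1E x0; rewrite -/a => /(congr1 (fun u => (2 : K) *: u)).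
  by rewrite !scalerA mulfV ?scale1r // pnatr_eq0.
have f30 : f 3%N 0 = (6 * b) *: x0.
  rewrite /f scale0r; have := H2E x0; rewrite -/b => /(congr1 (fun u => (6 : K) *: u)).
  by rewrite !scalerA mulfV ?scale1r // pnatr_eq0.
have W10 : W1 0 = (2 * a) *: x0 by rewrite /W1 inv0 f20.
(* [W1 0] is a multiple of x0 by the hypothesis on the coefficients, so this mixed second derivative
   is the derivative of a multiple of z |-> dF(z x0) x0. *)
have A'0 : A' 0 (W1 0) = (2 * a) *: ((2 * a) *: x0).
  have D1 := diff_dir_slice dF x01 (W1 0) nm0K.
  have D2 := cderivZr (2 * a) (df 1%N 0 nm0K); rewrite f20 in D2.
  apply: cderiv_unique D1 _; apply: (cderiv_local ltr01 _ D2) => h h1.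
  by rewrite add0r f1 // W10 linearZ.
pose g z : K := T (W1 z).
have dg z : nm z < 1 -> exists d : R[i]^o, cderiv (g : K -> R[i]^o) z d.
  by move=> z1; eexists; exact: cderiv_linear cT (dW1 z z1).
have g0 : g 0 = 2 * a by rewrite /g W10 linearZ /= Tx0 [_ *: _]mulr1.
have dg0 : cderiv (g : K -> R[i]^o) 0 (6 * b - 4 * a ^+ 2 : R[i]^o).
  have := cderiv_linear cT (dW1 0 nm0K); rewrite inv0 A'0 f30 scalerA -scalerBl linearZ /= Tx0.
  rewrite [_ *: _]mulr1; congr cderiv; ring.
have beta0 : 0 < 2^-1 + lam by case/andP: hlam; lra.
have posg z : nm z < 1 -> 0 <= 2^-1 + lam + Re (z * g z).
  move=> z1; have [->|z0] := eqVneq z 0; first by rewrite mul0r addr0 ltW.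
  have [T' sT' T'E] := supporting_rotate z0 x01 sT.
  have x0n : z *: x0 != 0 by rewrite -nm_gt0 nmZ x01 mulr1 nm_gt0.
  have := pos _ x0n; rewrite norm_lt1 => /(_ (zx z z1) _ sT').
  have [KI IK] := diff_invP (lbi _ (zx z z1)).1.
  have linI := diff_inv_linear (lbi _ (zx z z1)).1.
  rewrite (nderiv2_scale dF) ?zx // linearZ -/(f 2%N z) /=.
  rewrite (linI (z ^+ 2)) T'E KI (linearD T) !(linearZ_LR T) Tx0 -/(W1 z) -/(g z) nmE nmZ x01 mulr1.
  rewrite -![_ *: _]/(_ * _ : K).
  have -> : ((nm z)%:C)^-1 * ((nm z)%:C / z * (z ^+ 2 * g z + z * 1)) = z * g z + 1%:C.
    have nz : (nm z)%:C != 0 :> K by rewrite -nm_gt0 nmr // nm_gt0.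
    by field; rewrite z0 nz.
  by rewrite ReD /=; lra.
have := caratheodory beta0 dg dg0 posg; rewrite g0 => C.
have bb : 1 <= 2^-1 + lam <= 3 / 2 by case/andP: hlam => *; apply/andP; split; lra.
have := toeplitz_bounds bb C; rewrite (_ : 2^-1 + lam - 1 / 2 = lam); last by field.
rewrite toeplitz_det !lecR.
have -> : coef F T x0 2 = a.
  by have E := congr1 T (H1E x0); rewrite !(linearZ_LR T) Tx0 [RHS]mulr1 in E; exact: E.
have -> : coef F T x0 3 = b.
  by have E := congr1 T (H2E x0); rewrite !(linearZ_LR T) Tx0 [RHS]mulr1 in E; exact: E.
by [].
Qed.

End Forward.

(** * Supporting functionals *)

Section HahnBanach.
Context {R : realType} {X : completeNormedModType R[i]}.
Local Notation K := R[i].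
Local Notation Re := complex.Re.
Implicit Types (p q : X -> R) (x y : X).

(** Inequalities for t > 0 are what infima preserve; homogeneity is recovered by applying them to t
    and 1 / t. *)
Definition sublinear p := (forall x y, p (x + y) <= p x + p y) /\
  (forall (t : R) x, 0 < t -> p (t%:C *: x) <= t * p x).

Lemma sublinear_nm : sublinear (fun x : X => nm x).
Proof.
split; first exact: ler_nmD.
by move=> t x t0; rewrite nmZ nmr // ltW.
Qed.

Lemma sublinearZ p (t : R) x : sublinear p -> 0 < t -> p (t%:C *: x) = t * p x.
Proof.
move=> [_ H] t0; apply/le_anti; rewrite H //=.
have tC : t%:C != 0 :> K by rewrite -nm_gt0 nmr // ltW.
have := H t^-1 (t%:C *: x); rewrite invr_gt0 => /(_ t0).
by rewrite fmorphV scalerA mulVf // scale1r ler_pdivlMl.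
Qed.

Lemma sublinear0 p : sublinear p -> p 0 = 0.
Proof. by move=> sp; have := sublinearZ 0 sp (ltr0n R 2); rewrite scaler0; lra. Qed.

Lemma sublinear_opp p x : sublinear p -> - p (- x) <= p x.
Proof. by move=> sp; have := sp.1 x (- x); rewrite subrr sublinear0 //; lra. Qed.

(* A sublinear functional below [q]; when [q] is minimal they agree, which makes
   [q] additive. *)
Definition shrink q y x := inf [set q (x + t%:C *: y) - t * q y | t in [set t : R | 0 <= t]].

Lemma shrink_le q y x (t : R) : sublinear q -> 0 <= t -> shrink q y x <= q (x + t%:C *: y) - t * q y.
Proof.
move=> sq t0; apply: ge_inf; last by exists t.
exists (- q (- x)) => _ [s /= s0 <-].
have h : q (s%:C *: y) = s * q y.
  have [->|sn] := eqVneq s 0; first by rewrite scale0r mul0r sublinear0.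
  by rewrite sublinearZ // lt_def sn.
have := sq.1 (x + s%:C *: y) (- x); rewrite addrC addKr h; lra.
Qed.

Lemma shrink_ge q y x (m : R) : (forall t : R, 0 <= t -> m <= q (x + t%:C *: y) - t * q y) ->
  m <= shrink q y x.
Proof.
move=> H; apply: lb_le_inf; first by exists (q (x + 0%:C *: y) - 0 * q y), 0 => //=.
by move=> _ [t /= t0 <-]; apply: H.
Qed.

Lemma shrink_le_self q y x : sublinear q -> shrink q y x <= q x.
Proof.
by move=> sq; have := shrink_le y x sq (lexx 0); rewrite scale0r addr0 mul0r subr0.
Qed.

Lemma shrink_sublinear q y : sublinear q -> sublinear (shrink q y).
Proof.
move=> sq; split=> [x x'|t x t0].
  rewrite -lerBlDr; apply: shrink_ge => t t0; rewrite lerBlDr -lerBlDl.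
  apply: shrink_ge => s s0; rewrite lerBlDl.
  apply: (le_trans (shrink_le y (x + x') sq (addr_ge0 t0 s0))).
  have -> : x + x' + (t + s)%:C *: y = (x + t%:C *: y) + (x' + s%:C *: y).
    by rewrite rmorphD /=; vmod K X.
  by have := sq.1 (x + t%:C *: y) (x' + s%:C *: y); lra.
rewrite -ler_pdivrMl //; apply: shrink_ge => s s0; rewrite ler_pdivrMl //.
have := shrink_le y (t%:C *: x) sq (mulr_ge0 (ltW t0) s0).
rewrite rmorphM -scalerA -scalerDr (sublinearZ (x + s%:C *: y) sq t0); lra.
Qed.

(** Zorn's lemma. The infimum of a chain is finite because p(x) >= - p0(-x) for every sublinear p
    below p0. *)
Lemma minimal_sublinear p0 : sublinear p0 -> exists q, [/\ sublinear q, forall x, q x <= p0 x &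
  forall q', sublinear q' -> (forall x, q' x <= q x) -> q' = q].
Proof.
move=> sp0.
pose T := {p : X -> R | sublinear p /\ forall x, p x <= p0 x}.
(* The order is reversed, so that a maximal element is a minimal functional. *)
pose r (a b : T) := `[< forall x, sval b x <= sval a x >].
have [|a b c /asboolP ab /asboolP bc|a b /asboolP ab /asboolP ba|A totA|t tmin] := @Zorn T r.
- by move=> a; apply/asboolP.
- by apply/asboolP => x; exact: le_trans (bc x) (ab x).
- case: a b ab ba => [p hp] [p' hp'] /= ab ba.
  have E : p = p' by apply/funext => x; apply/le_anti; rewrite ab ba.
  by move: hp; rewrite E => hp; congr exist; exact: Prop_irrelevance.
- have [A0|/set0P [a0 Aa0]] := eqVneq A set0.
    have h0 : sublinear p0 /\ forall x, p0 x <= p0 x by [].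
    by exists (exist _ p0 h0) => s; rewrite A0.
  pose m x := inf [set sval a x | a in A].
  have lb x : has_lbound [set sval a x | a in A].
    exists (- p0 (- x)) => _ [a Aa <-].
    have := sublinear_opp x (svalP a).1; have := (svalP a).2 (- x); lra.
  have mle a x : A a -> m x <= sval a x by move=> Aa; apply: ge_inf => //; exists a.
  have mge x (u : R) : (forall a, A a -> u <= sval a x) -> u <= m x.
    by move=> H; apply: lb_le_inf; [exists (sval a0 x), a0|move=> _ [a Aa <-]; exact: H].
  have sm : sublinear m.
    split=> [x y|t x t0].
      rewrite -lerBlDr; apply: (mge) => a Aa; rewrite lerBlDr -lerBlDl.
      apply: (mge) => b Ab; rewrite lerBlDl.
      (* Subadditivity of the infimum needs one functional below both [a] and [b]; the chain
         provides it. *)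
      have [/asboolP ab|/asboolP ba] := totA a b Aa Ab.
        apply: (le_trans (mle b _ Ab)); apply: (le_trans ((svalP b).1.1 x y)).
        by rewrite lerD2r; exact: ab.
      apply: (le_trans (mle a _ Aa)); apply: (le_trans ((svalP a).1.1 x y)).
      by rewrite lerD2l; exact: ba.
    rewrite -ler_pdivrMl //; apply: (mge) => a Aa; rewrite ler_pdivrMl //.
    by apply: (le_trans (mle a _ Aa)); exact: (svalP a).1.2.
  have hm : sublinear m /\ forall x, m x <= p0 x.
    by split => // x; apply: (le_trans (mle a0 _ Aa0)); exact: (svalP a0).2.
  by exists (exist _ m hm) => s As; apply/asboolP => x; exact: mle.
exists (sval t); split; [exact: (svalP t).1|exact: (svalP t).2|].
move=> q' sq' q't.
have h : sublinear q' /\ forall x, q' x <= p0 x.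
  by split => // x; apply: (le_trans (q't x)); exact: (svalP t).2.
by have := tmin (exist _ q' h) (asboolT q't) => <-.
Qed.

(** Minimality forces [shrink q y = q]; the term t = 1 of the infimum then gives q x <= q (x + y) -
    q y. *)
Lemma minimal_additive q : sublinear q ->
  (forall q', sublinear q' -> (forall x, q' x <= q x) -> q' = q) ->
  forall x y, q (x + y) = q x + q y.
Proof.
move=> sq qmin x y; apply/le_anti; rewrite sq.1 /=.
have E := qmin _ (shrink_sublinear y sq) (fun x => shrink_le_self y x sq).
have := shrink_le y x sq ler01; rewrite E scale1r mul1r; lra.
Qed.

(** A minimal sublinear functional below the norm is real linear, and x |-> q x - i q (i x) is its
    complex linear extension with the same bound. *)
Lemma supporting_exists x0 : nm x0 = 1 -> exists T : {linear X -> R[i]^o},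
  supporting x0 T /\ forall x, nm (T x) <= nm x.
Proof.
move=> x01; pose N : X -> R := fun x => nm x.
(* Starting from the norm shrunk along x0 forces q (-x0) <= |-x0 + x0| - |x0| = -1, hence q x0 =
   1. *)
have sp0 := shrink_sublinear x0 sublinear_nm.
have [q [sq qp qmin]] := minimal_sublinear sp0.
have qD := minimal_additive sq qmin.
have qN x : q (- x) = - q x.
  by have := qD x (- x); rewrite subrr sublinear0 //; lra.
have qR (t : R) x : q (t%:C *: x) = t * q x.
  have [t0|t0|<-] := ltgtP 0 t; first exact: sublinearZ.
    have -> : t%:C *: x = - ((- t)%:C *: x) by rewrite rmorphN scaleNr opprK.
    by rewrite qN sublinearZ ?oppr_gt0 // mulNr opprK.
  by rewrite scale0r mul0r sublinear0.
have qnm x : q x <= nm x by apply: (le_trans (qp x)); exact: shrink_le_self sublinear_nm.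
have q1 : q x0 = 1.
  apply/le_anti; rewrite -{1}x01 qnm /=.
  have := le_trans (qp (- x0)) (shrink_le x0 (- x0) sublinear_nm ler01).
  by rewrite scale1r addNr nm0 x01 qN; lra.
pose T0 x : R[i]^o := q x +i* - q ('i *: x).
have linT0 : linear T0.
  move=> [s t] x y; rewrite /T0 -[_ *: (_ : R[i]^o)]/(_ * _ : K).
  have E (z : X) : (s +i* t) *: z = s%:C *: z + t%:C *: ('i *: z).
    by rewrite scalerA -scalerDl; congr (_ *: _); apply/eqP; rewrite eq_complex /= !mulr0 !mul0r !mulr1 !subr0 !addr0 add0r !eqxx.
  have ii (z : X) : 'i *: ('i *: z) = - z by rewrite scalerA -expr2 sqr_i scaleN1r.
  have EI : 'i *: (s%:C *: x + t%:C *: ('i *: x)) = s%:C *: ('i *: x) - t%:C *: x.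
    rewrite scalerDr !scalerA (mulrC 'i s%:C) (mulrC 'i t%:C) -!scalerA ii.
    by rewrite scalerN.
  rewrite E scalerDr EI !qD qN !qR; simpc.
  by congr (_ +i* _); ring.
pose T : {linear X -> R[i]^o} := HB.pack T0 (GRing.isLinear.Build K X R[i]^o _ T0 linT0).
have ReT x : Re (T x) = q x by [].
have Tnm x : nm (T x) <= nm x.
  have [Tx0|Tx0] := eqVneq (T x) 0; first by rewrite Tx0 nm0.
  have nT : 0 < nm (T x) by rewrite nm_gt0.
  (* Rotating [x] by [e] makes the value of [T] real, where the bound on [q] applies. *)
  pose e : K := (nm (T x))%:C / T x.
  have ne : nm e = 1 by rewrite nmM nmV nmr // divff // gt_eqF.
  have : Re (T (e *: x)) <= nm (e *: x) by exact: qnm.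
  have eT : T (e *: x) = (nm (T x))%:C.
    by rewrite (linearZ_LR T) -[LHS]/(e * (T x : K)) /e divfK.
  by rewrite nmZ ne mul1r eT.
exists T; split=> //; split.
- by apply: (@nm_bounded_continuous _ _ _ T 1) => h; rewrite mul1r.
- rewrite nmE x01; apply/eqP; rewrite eq_complex ReT q1 eqxx /=.
  have : nm (T x0) ^+ 2 <= 1 by rewrite expr_le1 // -x01.
  rewrite normc_nm ReT q1 expr1n gerDl => h; rewrite -sqrf_eq0.
  by apply/eqP/le_anti; rewrite h sqr_ge0.
- rewrite /opnorm; apply/le_anti; apply/andP; split.
    apply: ge_sup; first by exists (Re `|T x0|), x0 => //=; rewrite nmE x01.
    move=> _ [y /= y1 <-]; apply: (le_trans (Tnm y)).
    by rewrite -lecR -nmE.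
  apply: ub_le_sup.
    exists 1 => _ [y /= y1 <-]; apply: (le_trans (Tnm y)).
    by rewrite -lecR -nmE.
  exists x0; first by rewrite /= nmE x01.
  rewrite -[LHS]/(nm (T x0)).
  apply/le_anti/andP; split; first by rewrite (le_trans (Tnm x0)) // x01.
  by have := ler_Re_nm (T x0 : K); rewrite ReT q1.
Qed.

End HahnBanach.

Lemma dyadic_small (R : realType) (A e : R) : 0 < e -> 0 <= A ->
  exists N, forall n, (N <= n)%N -> A / 2 ^+ n <= e.
Proof.
move=> e0 A0; have A1 : 0 < A + 1 by rewrite ltr_wpDl.
have [N HN] := exp_half_lt (divr_gt0 e0 A1).
exists N => n hn; apply: le_trans (_ : (A + 1) / 2 ^+ N <= _).
  apply: ler_pM => //; rewrite ?invr_ge0 ?exprn_ge0 ?lerDl //.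
  by rewrite lef_pV2 ?posrE ?exprn_gt0 // ler_eXn2l // ltr1n.
by move: HN; rewrite exprVn ltr_pdivlMr // mulrC => /ltW.
Qed.

(** * Primitives, logarithms and powers *)

Section DyadicMean.
Context {R : realType} {V : normedModType R[i]}.
Local Notation K := R[i].
Implicit Types (f g : R -> V) (s d : R).

Fixpoint dmean f n s d : V :=
  if n is m.+1 then 2^-1 *: (dmean f m s (d / 2) + dmean f m (s + d / 2) (d / 2)) else f s.

Lemma dmeanD f g n s d : dmean (fun t => f t + g t) n s d = dmean f n s d + dmean g n s d.
Proof. by elim: n s d => [//|n IH] s d /=; rewrite !IH -scalerDr addrACA. Qed.

Lemma dmeanZ (a : K) f n s d : dmean (fun t => a *: f t) n s d = a *: dmean f n s d.
Proof. by elim: n s d => [//|n IH] s d /=; rewrite !IH -scalerDr !scalerA mulrC. Qed.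

Lemma nm_half2 (v w : V) (C : R) : nm v <= C -> nm w <= C -> nm ((2^-1 : K) *: (v + w)) <= C.
Proof.
move=> hv hw; rewrite nmZ nmV.
have -> : nm (2 : K) = 2 by rewrite -(@nmr R 2) // rmorph_nat.
by rewrite ler_pdivrMl //; have := ler_nmD v w; lra.
Qed.

Lemma dmean_near f n s d v (C : R) : 0 <= d ->
  (forall t, s <= t <= s + d -> nm (f t - v) <= C) -> nm (dmean f n s d - v) <= C.
Proof.
elim: n s d => [|n IH] s d d0 H /=; first by apply: H; rewrite lexx lerDl.
have -> : 2^-1 *: (dmean f n s (d / 2) + dmean f n (s + d / 2) (d / 2)) - v =
  (2^-1 : K) *: ((dmean f n s (d / 2) - v) + (dmean f n (s + d / 2) (d / 2) - v)).
  by vmod K V by (by field).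
by apply: nm_half2; apply: IH; try lra; move=> t ht; apply: H; lra.
Qed.

Lemma dmean_cauchy f n m s d (L : R) : 0 <= d ->
  (forall t t', s <= t <= s + d -> s <= t' <= s + d -> nm (f t - f t') <= L * `|t - t'|) ->
  0 <= L -> nm (dmean f (n + m) s d - dmean f n s d) <= L * d / 2 ^+ n.
Proof.
move=> d0 H L0; elim: n s d d0 H => [|n IH] s d d0 H.
  rewrite add0n expr0 divr1 /=; apply: dmean_near => // t ht.
  apply: le_trans (H _ _ _ _) _ => //; first by lra.
  by rewrite ler_wpM2l // ger0_norm; lra.
rewrite addSn /= -scalerBr opprD addrACA.
apply: nm_half2; rewrite exprS invfM mulrA -[_ * d / 2]mulrA; apply: IH; try lra;
  move=> t t' ? ?; apply: H; lra.
Qed.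

(** The 2^n steps contribute an error C (d / 2^n)^2 each. *)
Lemma dmean_primitive f (phi : R -> V) n s d (C : R) : 0 <= d ->
  (forall t h, s <= t -> 0 <= h -> t + h <= s + d ->
     nm (phi (t + h) - phi t - h%:C *: f t) <= C * h ^+ 2) ->
  nm (phi (s + d) - phi s - d%:C *: dmean f n s d) <= C * d ^+ 2 / 2 ^+ n.
Proof.
elim: n s d => [|n IH] s d d0 H /=.
  by rewrite expr0 divr1; apply: H; rewrite ?lexx.
have d20 : 0 <= d / 2 by lra.
have h1 : nm (phi (s + d / 2) - phi s - (d / 2)%:C *: dmean f n s (d / 2)) <= C * (d / 2) ^+ 2 / 2 ^+ n.
  by apply: (IH) => // t h ? ? ?; apply: H => //; lra.
have h2 : nm (phi (s + d / 2 + d / 2) - phi (s + d / 2) - (d / 2)%:C *: dmean f n (s + d / 2) (d / 2))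
    <= C * (d / 2) ^+ 2 / 2 ^+ n.
  by apply: (IH) => // t h ? ? ?; apply: H => //; lra.
have -> : s + d = s + d / 2 + d / 2 by lra.
set a := dmean _ _ _ _ in h1 *; set b := dmean _ _ _ _ in h2 *.
have e2 : (d / 2)%:C = d%:C / 2 :> K by rewrite rmorphM fmorphV rmorph_nat.
rewrite e2 in h1 h2.
have -> : phi (s + d / 2 + d / 2) - phi s - d%:C *: (2^-1 *: (a + b)) =
  (phi (s + d / 2) - phi s - (d%:C / 2) *: a) +
  (phi (s + d / 2 + d / 2) - phi (s + d / 2) - (d%:C / 2) *: b) by vmod K V by (by field).
apply: le_trans (ler_nmD _ _) _; apply: le_trans (lerD h1 h2) _.
have E : (2 ^+ n.+1)^-1 = 2^-1 * (2 ^+ n)^-1 :> R by rewrite exprS invfM.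
rewrite le_eqVlt; apply/orP; left; apply/eqP; rewrite E.
by generalize ((2 ^+ n)^-1 : R) => q; field.
Qed.

Lemma cderiv_dmean (f f' : R -> K -> V) n s d z : 0 <= d ->
  (forall t, s <= t <= s + d -> cderiv (f t) z (f' t z)) ->
  cderiv (fun w => dmean (f^~ w) n s d) z (dmean (f'^~ z) n s d).
Proof.
elim: n s d => [|n IH] s d d0 H /=; first by apply: H; rewrite lexx lerDl.
by apply: cderivZr; apply: cderivD; apply: IH; try lra; move=> t ht; apply: H; lra.
Qed.

End DyadicMean.

Section Primitive.
Context {R : realType} {V : completeNormedModType R[i]}.
Local Notation K := R[i].

(** Every point of the smaller disc has room [r] around it: Cauchy's estimate handles |h| <= r / 2,
    and crude bounds handle larger increments. *)
Lemma disc_taylor (P P' : K -> V) (rho C r : R) : 0 < r ->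
  (forall z, nm z <= rho + r -> cderiv P z (P' z)) ->
  (forall z, nm z <= rho + r -> nm (P z) <= C) ->
  forall w, nm w <= rho -> nm (P' w) <= 2 * C / r /\
    forall h, nm (w + h) <= rho -> nm (P (w + h) - P w - h *: P' w) <= 12 * C / r ^+ 2 * nm h ^+ 2.
Proof.
move=> r0 dP PC w hw.
have C0 : 0 <= C by apply: le_trans (PC w _); rewrite ?nm_ge0 //; lra.
pose p s := P (w + s).
have dp s : nm s <= r -> cderiv p s (P' (w + s)).
  move=> hs; have := ler_nmD w s => h.
  have := @cderiv_affine R V w 1 P s (P' (w + s)); rewrite mulr1 => H.
  rewrite -[P' _]scale1r; apply: eq_cderiv (H _); first by move=> u; rewrite mulr1.
  by apply: dP; lra.
have pC s : nm s <= r -> nm (p s) <= C.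
  by move=> hs; apply: PC; have := ler_nmD w s; lra.
have p0 : p 0 = P w by rewrite /p addr0.
have dp0 : cderiv p 0 (P' w) by have := dp 0; rewrite nm0 addr0; apply; exact: ltW.
have dle : nm (P' w) <= 2 * C / r.
  apply: (cderiv_le r0 _ dp0) => [z /andP[_ hz]|z hz|].
  - by exists (P' (w + z)); exact: dp.
  - by apply: pC; rewrite hz.
  - by apply: pC; rewrite nm0 ltW.
split=> // h hh.
have [hr|hr] := lerP (nm h) (r / 2).
  have := @cderiv_quadratic R V p r C (P' w) h r0 hr.
  rewrite p0 => H; apply: (le_trans (H _ dp0 _)).
  - by move=> z /andP[_ hz]; exists (P' (w + z)); exact: dp.
  - by move=> z hz; apply: pC; rewrite hz.
  - by rewrite ler_wpM2r ?sqr_ge0 // ler_wpM2r ?invr_ge0 ?sqr_ge0 // ler_wpM2r //; lra.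
have PwhC : nm (P (w + h)) <= C by apply: PC; lra.
have PwC : nm (P w) <= C by apply: PC; lra.
apply: (le_trans (ler_nmB _ _)); rewrite nmZ.
apply: (@le_trans _ _ (2 * C + nm h * (2 * C / r))).
  by apply: lerD; [have := ler_nmB (P (w + h)) (P w); lra|rewrite ler_wpM2l].
(* The constant 12 is the least one with 2 + 2 x <= 12 x^2 for all x >= 1 / 2. *)
pose x := nm h / r; have x2 : 1 / 2 <= x by rewrite /x ler_pdivlMr //; lra.
have -> : nm h * (2 * C / r) = 2 * C * x by rewrite /x; field; exact: lt0r_neq0.
have -> : 12 * C / r ^+ 2 * nm h ^+ 2 = 12 * C * x ^+ 2 by rewrite /x; field; exact: lt0r_neq0.
have : 0 <= C * (12 * x ^+ 2 - 2 - 2 * x) by rewrite mulr_ge0 //; nra.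
by lra.
Qed.

(* [G z] is the mean of [t |-> P (t z)] over [0, 1], so that [z G(z)] is the
   primitive of [P]. *)
Lemma disc_primitive (P P' : K -> V) :
  (forall z, nm z < 1 -> cderiv P z (P' z)) ->
  (forall r : R, r < 1 -> exists C : R, forall z, nm z <= r -> nm (P z) <= C) ->
  exists G G' : K -> V, G 0 = P 0 /\
    forall z, nm z < 1 -> cderiv G z (G' z) /\ G z + z *: G' z = P z.
Proof.
move=> dP bP.
have loc (rho : R) : 0 <= rho -> rho < 1 -> exists L M : R, [/\ 0 <= L, 0 <= M,
    forall w, nm w <= rho -> nm (P' w) <= L &
    forall w h, nm w <= rho -> nm (w + h) <= rho -> nm (P (w + h) - P w - h *: P' w) <= M * nm h ^+ 2].
  move=> rho0 rho1; pose r := (1 - rho) / 2; have r0 : 0 < r by rewrite /r; lra.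
  have rr : rho + r < 1 by rewrite /r; lra.
  have [C PC] := bP _ rr.
  have C0 : 0 <= C by apply: le_trans (PC 0 _); rewrite ?nm_ge0 // nm0 /r; lra.
  have dr z : nm z <= rho + r -> cderiv P z (P' z).
    by move=> hz; apply: dP; apply: (le_lt_trans hz); rewrite /r; lra.
  have H := disc_taylor r0 dr PC.
  exists (2 * C / r), (12 * C / r ^+ 2); split.
  - by apply: divr_ge0; [lra|exact: ltW].
  - by apply: divr_ge0; [lra|exact: sqr_ge0].
  - by move=> w /H[].
  - by move=> w h /H[_]; apply.
pose Gn n z := dmean (fun t : R => P (t%:C * z)) n 0 1.
pose Gn' n z := dmean (fun t : R => t%:C *: P' (t%:C * z)) n 0 1.
have tz (t : R) (z : K) : 0 <= t <= 0 + 1 -> nm (t%:C * z) <= nm z.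
  by move=> ht; rewrite nmM nmr ?ler_piMl //; lra.
have cvgG z : nm z < 1 -> exists l : V, Gn n z @[n --> \oo] --> l.
  move=> z1; have [L [M [L0 M0 HL HM]]] := loc (nm z) (nm_ge0 _) z1.
  apply: (@nm_cauchy_cvg R V (Gn^~ z)) => e e0.
  have lip t t' : 0 <= t <= 0 + 1 -> 0 <= t' <= 0 + 1 ->
      nm (P (t%:C * z) - P (t'%:C * z)) <= (L + M) * `|t - t'|.
    move=> ht ht'; pose h := (t - t')%:C * z.
    have E : t%:C * z = t'%:C * z + h by rewrite /h rmorphB /=; ring.
    have := HM (t'%:C * z) h (tz _ _ ht'); rewrite -E => /(_ (tz _ _ ht)) A.
    have B := HL _ (tz _ z ht').
    have hh : nm h <= `|t - t'| by rewrite nmM nm_real ler_piMr // ltW.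
    have h1 : `|t - t'| <= 1 by rewrite ler_norml; lra.
    have -> : P (t%:C * z) - P (t'%:C * z) =
      (P (t%:C * z) - P (t'%:C * z) - h *: P' (t'%:C * z)) + h *: P' (t'%:C * z) by rewrite subrK.
    apply: (le_trans (ler_nmD _ _)); rewrite nmZ.
    rewrite mulrDl addrC; apply: lerD; first by rewrite mulrC ler_pM.
    apply: (le_trans A); rewrite ler_wpM2l //; apply: le_trans (hh).
    by rewrite expr2 ler_piMr // (le_trans hh).
  have LM0 : 0 <= L + M by lra.
  have e20 : 0 < e / 2 by lra.
  have [N HN] := dyadic_small e20 LM0.
  exists N => n m hn hm.
  have near k : (N <= k)%N -> nm (Gn k z - Gn N z) <= e / 2.
    move=> /subnKC <-; apply: (le_trans (dmean_cauchy N _ ler01 lip LM0)).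
    by rewrite mulr1 HN.
  apply: (le_trans (nm_dist_tri _ (Gn N z) _)); rewrite (splitr e) lerD ?near //.
  by rewrite nm_distC near.
have /choice[G HG] (z : K) : exists l : V, nm z < 1 -> Gn n z @[n --> \oo] --> l.
  by have [/cvgG[l Hl]|] := boolP (nm z < 1); [exists l|exists 0].
have dGn n z : nm z < 1 -> cderiv (Gn n) z (Gn' n z).
  move=> z1; apply: (@cderiv_dmean R V (fun t w => P (t%:C * w)) (fun t w => t%:C *: P' (t%:C * w))) => // t ht.
  have := @cderiv_affine R V 0 t%:C P z (P' (t%:C * z)); rewrite add0r mulrC => H.
  by apply: eq_cderiv (H _) => [w|]; [rewrite add0r mulrC|apply: dP; apply: le_lt_trans (tz _ _ ht) z1].
have dG z : nm z < 1 -> exists2 d, cderiv G z d & Gn' n z @[n --> \oo] --> d.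
  move=> z1; pose rho := (1 - nm z) / 2; have rho0 : 0 < rho by rewrite /rho; lra.
  have in1 s : nm s < rho -> nm (z + s) < nm z + rho by move=> hs; have := ler_nmD z s; lra.
  have in2 : nm z + rho < 1 by rewrite /rho; lra.
  have [C PC] := bP _ in2.
  have [//|j s hs|j s hs|s hs|j|d [Hd cvd _]] := @cderiv_pointwise_limit R V (fun n s => Gn n (z + s)) (fun s => G (z + s)) rho C (Gn'^~ z).
  - exists (Gn' j (z + s)).
    have := @cderiv_affine R V z 1 (Gn j) s (Gn' j (z + s)); rewrite mulr1 scale1r => H.
    apply: eq_cderiv (H _) => [w|]; first by rewrite mulr1.
    by apply: dGn; apply: lt_trans (in1 _ hs) in2.
  - rewrite -[Gn _ _]subr0; apply: dmean_near => // t ht; rewrite subr0; apply: PC.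
    by apply: (le_trans (tz _ _ ht)); apply: ltW; exact: in1.
  - by apply: HG; apply: lt_trans (in1 _ hs) in2.
  - have := @cderiv_affine R V z 1 (Gn j) 0 (Gn' j z); rewrite mul0r addr0 scale1r => H.
    by apply: eq_cderiv (H _) => [w|]; [rewrite mulr1|apply: dGn].
  - exists d => // e e0; have [r r0 H] := Hd e e0; exists r => // h /H.
    by rewrite add0r addr0.
have /choice[G' HG'] (z : K) : exists d : V, nm z < 1 ->
    cderiv G z d /\ Gn' n z @[n --> \oo] --> d.
  by have [/dG[l ? ?]|] := boolP (nm z < 1); [exists l|exists 0].
exists G, G'; split.
  apply: (@cvg_unique _ (@norm_hausdorff _ V) (Gn n 0 @[n --> \oo])).
    by apply: HG; rewrite nm0.
  rewrite (_ : (fun n => _) = cst (P 0)); first exact: cvg_cst.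
  apply/funext => n; rewrite /Gn; elim: n (0 : R) (1 : R) => [|n IH] s d /=; first by rewrite mulr0.
  by rewrite !IH /=; vmod K V by (by field).
move=> z z1; split; first by case: (HG' z z1).
have [L [M [L0 M0 HL HM]]] := loc (nm z) (nm_ge0 _) z1.
have lim1 : Gn n z + z *: Gn' n z @[n --> \oo] --> G z + z *: G' z.
  by apply: cvgD; [exact: HG|apply: cvgZr; case: (HG' z z1)].
apply: (cvg_unique (@norm_hausdorff _ V) lim1).
apply/cvg_nmP => e e0.
have LM0 : 0 <= L + M by lra.
have [N HN] := dyadic_small e0 LM0.
exists N => n hn.
rewrite /Gn /Gn' -dmeanZ -dmeanD nm_distC.
(* The derivative of t P(t z) is P(t z) + t z P'(t z); the mean of the latter over [0, 1] is G(z) +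
   z G'(z) in the limit, and phi 1 - phi 0 = P(z). *)
pose phi (t : R) := t%:C *: P (t%:C * z).
have := @dmean_primitive R V (fun t => P (t%:C * z) + z *: (t%:C *: P' (t%:C * z))) phi n 0 1 (L + M) ler01.
rewrite add0r /phi scale0r subr0 !scale1r mul1r expr1n mulr1 => H; apply: (le_trans (H _)) (HN _ hn).
  move=> t h t0 h0 th; pose u := h%:C * z.
  have ht : 0 <= t <= 0 + 1 by lra.
  have hth : 0 <= t + h <= 0 + 1 by lra.
  have E : (t + h)%:C * z = t%:C * z + u by rewrite /u rmorphD mulrDl.
  have := HM (t%:C * z) u (tz _ _ ht); rewrite -E => /(_ (tz _ _ hth)) A.
  have B := HL _ (tz _ z ht).
  have -> : (t + h)%:C *: P ((t + h)%:C * z) - t%:C *: P (t%:C * z) -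
    h%:C *: (P (t%:C * z) + z *: (t%:C *: P' (t%:C * z))) =
    (t + h)%:C *: (P ((t + h)%:C * z) - P (t%:C * z) - u *: P' (t%:C * z))
    + (h%:C * u) *: P' (t%:C * z).
    by rewrite /u rmorphD /=; vmod K V.
  have uh : nm u <= h by rewrite nmM nmr // ler_piMr // ltW.
  apply: (le_trans (ler_nmD _ _)); rewrite !nmZ nmM (nmr h0) nmr ?addr_ge0 //.
  have -> : (L + M) * h ^+ 2 = 1 * (M * h ^+ 2) + h * h * L by ring.
  apply: lerD; apply: ler_pM; rewrite ?mulr_ge0 ?addr_ge0 //.
    by apply: (le_trans A); rewrite ler_wpM2l // lerXn2r ?nnegrE.
  by rewrite ler_wpM2l.
Qed.

End Primitive.

(** * The logarithm on the right half-plane *)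

Section Log.
Context {R : realType}.
Local Notation K := R[i].
Local Notation Re := complex.Re.
Local Notation Im := complex.Im.

Definition clog (w : K) : K := ln (nm w) +i* atan (Im w / Re w).

Lemma Re_gt0_nm (w : K) : 0 < Re w -> 0 < nm w.
Proof. by move=> w0; exact: lt_le_trans w0 (ler_Re_nm w). Qed.

Lemma clogK (w : K) : 0 < Re w -> cexp (clog w) = w.
Proof.
move=> w0; have nw := Re_gt0_nm w0.
set t := Im w / Re w.
have t1 : 0 < 1 + t ^+ 2 by rewrite ltr_wpDr // sqr_ge0.
have s0 : 0 < Num.sqrt (1 + t ^+ 2) by rewrite sqrtr_gt0.
have E : nm w = Re w * Num.sqrt (1 + t ^+ 2).
  apply/eqP; rewrite -(@eqrXn2 _ 2) ?mulr_ge0 ?(ltW w0) ?(ltW s0) //.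
  rewrite normc_nm exprMn sqr_sqrtr ?(ltW t1) //.
  by apply/eqP; rewrite /t; field; rewrite gt_eqF.
have cE : cos (atan t) = (Num.sqrt (1 + t ^+ 2))^-1 by exact: cos_atan.
have c0 : cos (atan t) != 0 by rewrite cE invr_eq0 gt_eqF.
have sE : sin (atan t) = t * (Num.sqrt (1 + t ^+ 2))^-1.
  by rewrite -cE -[X in X * _](atanK t) /tan divfK.
rewrite /cexp /clog /= lnK ?posrE // -/t cE sE E; simpc.
apply/eqP; rewrite eq_complex /=; apply/andP; split; apply/eqP.
  by rewrite mulfK // gt_eqF.
by rewrite /t; field; rewrite !gt_eqF.
Qed.

Lemma Im_clog (w : K) : - (pi / 2) < Im (clog w) < pi / 2.
Proof. by rewrite /= atan_gtNpi2 atan_ltpi2. Qed.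

Lemma clog1 : clog 1 = 0.
Proof. by rewrite /clog nm1 ln1 /= mul0r atan0. Qed.

Lemma real_deriv_lip (f : R -> R) (x d : R) : is_derive x 1 f d ->
  exists2 r : R, 0 < r & forall h, `|h| < r -> `|f (x + h) - f x| <= (`|d| + 1) * `|h|.
Proof.
move=> df; have [r r0 H] := real_deriv_eps df ltr01.
exists r => // h /H{}H; have := ler_normD (f (x + h) - f x - h * d) (h * d).
by rewrite subrK normrM mulrDl mul1r; lra.
Qed.

Lemma clog_cont (w : K) : 0 < Re w -> forall e : R, 0 < e ->
  exists2 r : R, 0 < r & forall h, nm h < r -> nm (clog (w + h) - clog w) <= e.
Proof.
move=> w0 e e0; have nw := Re_gt0_nm w0.
have [r1 r10 H1] := real_deriv_lip (is_derive1_ln nw).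
have [r2 r20 H2] := real_deriv_lip (is_derive1_atan (Im w / Re w)).
set d1 := `|_| + 1 in H1; set d2 := `|_| + 1 in H2.
have d10 : 0 < d1 by rewrite ltr_wpDl.
have d20 : 0 < d2 by rewrite ltr_wpDl.
pose m := 4 * nm w / Re w ^+ 2.
have m0 : 0 < m by rewrite divr_gt0 ?exprn_gt0 // mulr_gt0.
have e20 : 0 < e / 2 by lra.
pose r := Num.min (Num.min (Re w / 2) (Num.min r1 (r2 / m))) (Num.min (e / 2 / d1) (e / 2 / (d2 * m))).
exists r; first by rewrite /r !lt_min r10 (divr_gt0 w0) ?(divr_gt0 r20) ?(divr_gt0 e20) ?(mulr_gt0 d20).
move=> h; rewrite /r !lt_min => /andP[/andP[ha /andP[hb hc]] /andP[hd he]].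
apply: (le_trans (nm_le_ReIm _)); rewrite (splitr e) /clog /=; apply: lerD.
  have hh : `|nm (w + h) - nm w| <= nm h.
    have a := nm_lower (w + h) w; have b := nm_lower w (w + h).
    by move: a b; rewrite (nm_distC w) addrAC subrr add0r ler_norml; lra.
  have := H1 _ (le_lt_trans hh hb); rewrite subrKC => H; apply: (le_trans H).
  apply: (@le_trans _ _ (d1 * nm h)); first by rewrite ler_wpM2l // ltW.
  by move: hd; rewrite ltr_pdivlMr // mulrC => /ltW.
have hR : `|Re h| <= nm h by exact: nm_ge_Re.
have hI : `|Im h| <= nm h by exact: nm_ge_Im.
have wI : `|Im w| <= nm w by exact: nm_ge_Im.
have wR : `|Re w| <= nm w by exact: nm_ge_Re.
have R2 : Re w / 2 <= Re w + Re h by move: hR; rewrite ler_norml; lra.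
have R3 : 0 < Re w + Re h by lra.
have hh : `|Im (w + h) / Re (w + h) - Im w / Re w| <= m * nm h.
  have -> : Re (w + h) = Re w + Re h by case: (w) (h) => [? ?] [].
  have -> : Im (w + h) = Im w + Im h by case: (w) (h) => [? ?] [].
  have -> : (Im w + Im h) / (Re w + Re h) - Im w / Re w =
    (Im h * Re w - Im w * Re h) / ((Re w + Re h) * Re w) by field; rewrite !gt_eqF.
  have D0 : 0 < (Re w + Re h) * Re w by rewrite mulr_gt0.
  rewrite normrM normfV (gtr0_norm D0) ler_pdivrMr //.
  have D1 : Re w ^+ 2 / 2 <= (Re w + Re h) * Re w by nra.
  apply: (@le_trans _ _ (m * nm h * (Re w ^+ 2 / 2))); last first.
    by rewrite ler_wpM2l // mulr_ge0 // ltW.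
  have -> : m * nm h * (Re w ^+ 2 / 2) = nm h * nm w + nm w * nm h.
    by rewrite /m; field; rewrite gt_eqF.
  apply: (le_trans (ler_normB _ _)); rewrite !normrM.
  by apply: lerD; apply: ler_pM.
have := H2 _ (le_lt_trans hh _); rewrite subrKC => H.
apply: (le_trans (H _)); first by move: hc; rewrite ltr_pdivlMr // mulrC.
apply: (@le_trans _ _ (d2 * (m * nm h))); first by rewrite ler_wpM2l // ltW.
have dm : 0 < d2 * m by rewrite mulr_gt0.
by move: he; rewrite (ltr_pdivlMr _ _ dm); lra.
Qed.

(** The inverse function rule: continuity of [clog] makes the increment [u] small enough for the
    expansion of [cexp] at [clog w]. *)
Lemma cderiv_clog (w : K) : 0 < Re w -> cderiv (clog : K -> R[i]^o) w w^-1.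
Proof.
move=> w0 e e0; have nw := Re_gt0_nm w0.
(* The first entry gives |u| |w| <= 2 |h| by absorption; the second yields the required error. *)
pose e1 := Num.min (nm w / 2) (e * nm w ^+ 2 / 2).
have e10 : 0 < e1 by rewrite /e1 lt_min !divr_gt0 ?mulr_gt0 ?exprn_gt0.
have e1a : e1 <= nm w / 2 by rewrite /e1 ge_min lexx.
have e1b : e1 <= e * nm w ^+ 2 / 2 by rewrite /e1 ge_min lexx orbT.
clearbody e1.
have [r1 r10 H1] := cderiv_cexp (clog w) e10.
have r20 : 0 < r1 / 2 by lra.
have [r r0 Hr] := clog_cont w0 r20.
exists (Num.min r (Re w)); first by rewrite lt_min r0.
move=> h; rewrite lt_min => /andP[hr hw].
set u := clog (w + h) - clog w.
have wh : 0 < Re (w + h).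
  have -> : Re (w + h) = Re w + Re h by case: (w) (h) => [? ?] [].
  by have := nm_ge_Re h; rewrite ler_norml; lra.
have ur : nm u < r1 by apply: le_lt_trans (Hr _ hr) _; lra.
have := H1 _ ur; rewrite /u subrKC !clogK // (addrAC w h) subrr add0r -/u.
rewrite -[_ *: w]/(u * w) => {}H1.
have uw : nm u * nm w <= nm h + e1 * nm u.
  rewrite -nmM -[u * w](subKr h); apply: (le_trans (ler_nmB _ _)); rewrite lerD2l //.
have u2 : nm u * nm w <= 2 * nm h.
  by have := ler_wpM2r (nm_ge0 u) e1a; lra.
have wn : w != 0 by rewrite -nm_gt0.
rewrite -[_ *: w^-1]/(h * w^-1).
have -> : u - h * w^-1 = - ((h - u * w) / w) by field.
rewrite nmN nmM nmV ler_pdivrMr //; apply: (le_trans H1).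
apply: (@le_trans _ _ (e * nm w ^+ 2 / 2 * nm u)); first by rewrite ler_wpM2r.
have -> : e * nm w ^+ 2 / 2 * nm u = e * nm w / 2 * (nm u * nm w) by ring.
have -> : e * nm h * nm w = e * nm w / 2 * (2 * nm h) by field.
by rewrite ler_wpM2l // divr_ge0 // mulr_ge0 // ltW.
Qed.

End Log.

(** * Powers of the quadratic 1 - (u + v) z + z^2 *)

Section QuadraticLog.
Context {R : realType}.
Local Notation K := R[i].
Local Notation Re := complex.Re.
Local Notation Im := complex.Im.

Lemma Re1_gt0 (w : K) : nm w < 1 -> 0 < Re (1 - w).
Proof.
move=> w1; have -> : Re (1 - w) = 1 - Re w by case: w {w1}.
by have := ler_Re_nm w; lra.
Qed.

Lemma cderiv_linfac (a z : K) : cderiv (fun z => 1 - a * z : R[i]^o) z (- a).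
Proof.
have := cderivB (@cderiv_cst R R[i]^o 1 z) (cderivZr a (@cderiv_id R z)).
by rewrite sub0r [_ *: _]mulr1.
Qed.

Variables (u v : K).
Hypothesis (uv1 : u * v = 1) (nu : nm u = 1) (nv : nm v = 1).

Definition quad (z : K) := 1 - (u + v) * z + z ^+ 2.
(** The logarithm is taken factor by factor: 1 - u z and 1 - v z stay in the right half-plane,
    whereas their product may leave it. *)
Definition quad_log (z : K) : K := clog (1 - u * z) + clog (1 - v * z).

Let nmu z : nm (u * z) = nm z. Proof. by rewrite nmM nu mul1r. Qed.
Let nmv z : nm (v * z) = nm z. Proof. by rewrite nmM nv mul1r. Qed.

Lemma quad_factor z : quad z = (1 - u * z) * (1 - v * z).
Proof.
by transitivity (1 - (u + v) * z + (u * v) * z ^+ 2); [rewrite uv1 mul1r|ring].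
Qed.

Lemma cexp_quad_log z : nm z < 1 -> cexp (quad_log z) = quad z.
Proof. by move=> z1; rewrite cexpD !clogK -?quad_factor // Re1_gt0 ?nmu ?nmv. Qed.

Lemma quad_neq0 z : nm z < 1 -> quad z != 0.
Proof. by move=> z1; rewrite -cexp_quad_log // cexp_neq0. Qed.

Lemma quad_log0 : quad_log 0 = 0.
Proof. by rewrite /quad_log !mulr0 subr0 clog1 addr0. Qed.

Lemma Im_quad_log z : `|Im (quad_log z)| < pi.
Proof.
have -> : Im (quad_log z) = Im (clog (1 - u * z)) + Im (clog (1 - v * z)) by [].
by have := Im_clog (1 - u * z); have := Im_clog (1 - v * z); rewrite ltr_norml; lra.
Qed.

Lemma cderiv_quad_log z : nm z < 1 ->
  cderiv (quad_log : K -> R[i]^o) z ((2 * z - (u + v)) / quad z).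
Proof.
move=> z1; have hu : 0 < Re (1 - u * z) by rewrite Re1_gt0 ?nmu.
have hv : 0 < Re (1 - v * z) by rewrite Re1_gt0 ?nmv.
have := cderivD (cderiv_comp (cderiv_linfac u z) (cderiv_clog hu))
  (cderiv_comp (cderiv_linfac v z) (cderiv_clog hv)).
rewrite -![_ *: _]/(_ * _ : K); congr (cderiv _ _ _).
have nu0 : 1 - u * z != 0 by rewrite -nm_gt0 Re_gt0_nm.
have nv0 : 1 - v * z != 0 by rewrite -nm_gt0 Re_gt0_nm.
have -> : 2 * z - (u + v) = 2 * (u * v) * z - (u + v) by rewrite uv1 mulr1.
by rewrite quad_factor; field; rewrite nu0 nv0.
Qed.

Lemma nm_quad_ge (r : R) z : nm z <= r -> r < 1 -> (1 - r) ^+ 2 <= nm (quad z).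
Proof.
move=> zr r1; rewrite quad_factor nmM.
have a : 1 - r <= nm (1 - u * z) by have := nm_lower 1 (u * z); rewrite nm1 nmu; lra.
have b : 1 - r <= nm (1 - v * z) by have := nm_lower 1 (v * z); rewrite nm1 nmv; lra.
by rewrite expr2; apply: ler_pM => //; lra.
Qed.

(** The branch of [quad] to the power -b that equals 1 at 0. *)
Definition quad_pow (b : R) (z : K) : K := cexp (- (b%:C * quad_log z)).

Lemma quad_pow0 b : quad_pow b 0 = 1.
Proof. by rewrite /quad_pow quad_log0 mulr0 oppr0 cexp0. Qed.

Lemma quad_pow_neq0 b z : quad_pow b z != 0. Proof. exact: cexp_neq0. Qed.

Lemma cderiv_quad_pow b z : nm z < 1 -> cderiv (quad_pow b : K -> R[i]^o) z
  (b%:C * (u + v - 2 * z) / quad z * quad_pow b z).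
Proof.
move=> z1; have H := cderivN (cderivZr b%:C (cderiv_quad_log z1)).
have := cderiv_comp H (cderiv_cexp (- (b%:C * quad_log z))).
rewrite -[_ *: cexp _]/(_ * _ : K); congr (cderiv _ _ _); rewrite -/(quad_pow b z).
congr (_ * _); rewrite -[_ *: _]/(_ * _ : K) -mulrN -mulNr opprB mulrA //.
Qed.

Lemma quad_pow_bounded b (r : R) : 0 <= b -> r < 1 ->
  exists C : R, forall z, nm z <= r -> nm (quad_pow b z) <= C.
Proof.
move=> b0 r1; have r2 : 0 < (1 - r) ^+ 2 by rewrite exprn_gt0 // subr_gt0.
exists (expR (- (b * ln ((1 - r) ^+ 2)))) => z zr.
rewrite nm_cexp ler_expR.
have -> : Re (- (b%:C * quad_log z)) = - (b * Re (quad_log z)).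
  by case: (quad_log z) => x y /=; rewrite mul0r subr0.
rewrite lerN2 ler_wpM2l // -ler_expR lnK ?posrE // -nm_cexp cexp_quad_log ?(le_lt_trans zr) //.
exact: nm_quad_ge.
Qed.

(** The product is [quad] to the power 1 - b. Since |1 - b| <= 1 / 2 and the argument of [quad] is
    below pi in absolute value, its argument is below pi / 2. *)
Lemma Re_quad_pow b z : 1 <= b <= 3 / 2 -> nm z < 1 -> 0 < Re (quad_pow b z * quad z).
Proof.
move=> hb z1; rewrite -cexp_quad_log // -cexpD.
set L := quad_log z.
have -> : - (b%:C * L) + L = (1 - b)%:C * L by rewrite rmorphB /=; ring.
have E : Im ((1 - b)%:C * L) = (1 - b) * Im L by case: (L) => x y /=; rewrite mul0r addr0.
have ReE w : Re (cexp w : K) = expR (Re w) * cos (Im w) by rewrite /= mul0r subr0.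
rewrite ReE E.
rewrite mulr_gt0 ?expR_gt0 //; apply: cos_gt0_pihalf.
have h := Im_quad_log z; rewrite -/L in h.
have : `|(1 - b) * Im L| < pi / 2.
  have b1 : `|1 - b| <= 1 / 2 by rewrite ler_norml; lra.
  rewrite normrM; apply: (@le_lt_trans _ _ (1 / 2 * `|Im L|)); first by rewrite ler_wpM2r.
  lra.
by rewrite ltr_norml.
Qed.

End QuadraticLog.

(** * Paths along which the extremal functions are monotone *)

Section Paths.
Context {R : realType}.
Local Notation K := R[i].
Local Notation Re := complex.Re.
Local Notation Im := complex.Im.

Lemma is_derive_Re (F : K -> K) (s : R) d : cderiv (F : K -> R[i]^o) s%:C d ->
  is_derive s 1 (fun t : R => Re (F t%:C)) (Re d).
Proof.
move=> dF.
have H : h^-1 *: (Re (F (h *: (1 : R) + s)%:C) - Re (F s%:C)) @[h --> 0^'] --> Re d.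
  apply/cvgrPdist_le => e e0; have [r r0 Hr] := dF _ e0.
  near=> h.
  have h0 : h != 0 by near: h; exact: nbhs_dnbhs_neq.
  have hr : `|h| < r.
    near: h; apply: dnbhs0_lt => //.
  have E : (h *: (1 : R) + s)%:C = s%:C + h%:C :> K by rewrite [_ *: _]mulr1 addrC rmorphD.
  have := Hr h%:C; rewrite nm_real E => /(_ hr).
  set A := F _ - F _ - _; move=> HA.
  have -> : h^-1 *: (Re (F (s%:C + h%:C)) - Re (F s%:C)) = Re d + h^-1 * Re A.
    have -> : Re A = Re (F (s%:C + h%:C)) - Re (F s%:C) - h * Re d.
      rewrite /A -[_ *: _]/(_ * _ : K); case: (F _) (F _) (d) => [? ?] [? ?] [? ?] /=.
      by rewrite mul0r subr0.
    by rewrite -[_ *: _]/(_ * _ : R); field.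
  rewrite opprD addrA subrr add0r normrN normrM normfV ler_pdivrMl ?normr_gt0 //.
  by rewrite mulrC (le_trans _ HA) // nm_ge_Re.
apply: DeriveDef; first exact: cvgP H.
exact: cvg_lim H.
Unshelve. all: by end_near. Qed.

Lemma Re_increasing (F : K -> K) :
  (forall s : R, 0 <= s <= 1 -> exists2 d, cderiv (F : K -> R[i]^o) s%:C d & 0 < Re d) ->
  Re (F 0) < Re (F 1).
Proof.
move=> H.
have /choice[D HD] (s : R) : exists d, 0 <= s <= 1 -> cderiv (F : K -> R[i]^o) s%:C d /\ 0 < Re d.
  by have [/H[d ? ?]|] := boolP (0 <= s <= 1); [exists d|exists 0].
have der (s : R) : 0 <= s <= 1 -> is_derive s 1 (fun t : R => Re (F t%:C)) (Re (D s)).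
  by move=> /HD[? _]; exact: is_derive_Re.
have [||s s01 E] := @MVT R (fun t : R => Re (F t%:C)) (fun s => Re (D s)) 0 1 ltr01.
- by move=> s; rewrite in_itv /= => /andP[a b]; apply: der; rewrite !ltW.
- apply: derivable_within_continuous => s; rewrite in_itv /= => /der[]//.
- move: s01; rewrite in_itv /= => /andP[a b].
  have [_ D0] : cderiv (F : K -> R[i]^o) s%:C (D s) /\ 0 < Re (D s) by apply: HD; rewrite !ltW.
  by rewrite -subr_gt0 [X in 0 < X]E subr0 mulr1.
Qed.

(* The image of the segment [0, h z0] under the inverse of a primitive [h] of
   [1 / quad u v]. *)
Definition quad_path (u v z0 kappa : K) (gam : K -> K) :=
  [/\ kappa != 0, gam 0 = 0, gam 1 = z0 &
    forall s : R, 0 <= s <= 1 -> nm (gam s%:C) < 1 /\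
      cderiv (gam : K -> R[i]^o) s%:C (kappa * quad u v (gam s%:C))].

Lemma ratio_derivative (N D : K -> K) (z dN dD : K) : D z != 0 ->
  cderiv (N : K -> R[i]^o) z dN -> cderiv (D : K -> R[i]^o) z dD ->
  cderiv (fun w => N w / D w : R[i]^o) z ((dN * D z - N z * dD) / D z ^+ 2).
Proof.
move=> D0 HN HD; have := cderivM HN (cderivV D0 HD).
by congr (cderiv _ _ _); field.
Qed.

(** For u = v = 1 the primitive is h(z) = z / (1 - z), with inverse w / (1 + w). It maps the disc
    onto a half-plane, which contains the segment from 0 to a = h(z0). *)
Lemma quad_path_double z0 : nm z0 < 1 -> z0 != 0 -> exists kappa gam, quad_path 1 1 z0 kappa gam.
Proof.
move=> z1 z0n; have n1 : 1 - z0 != 0 by rewrite -nm_gt0 Re_gt0_nm // Re1_gt0.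
pose a := z0 / (1 - z0).
have key (s : R) : 0 <= s <= 1 -> nm (s%:C * a) < nm (1 + s%:C * a).
  move=> /andP[s0 s1].
  have -> : s%:C * a = s%:C * z0 / (1 - z0) by rewrite /a mulrA.
  have -> : 1 + s%:C * z0 / (1 - z0) = (1 - (1 - s)%:C * z0) / (1 - z0).
    by rewrite rmorphB /=; field.
  rewrite !nmM nmV ltr_pM2r ?invr_gt0 ?nm_gt0 // (nmr s0).
  have := nm_lower 1 ((1 - s)%:C * z0); rewrite nm1 nmM nmr ?subr_ge0 //; lra.
exists a, (fun w => w * a / (1 + w * a)); split.
- by rewrite mulf_neq0 // invr_eq0.
- by rewrite !mul0r.
- by rewrite !mul1r /a; field; rewrite n1 /= subrK oner_eq0.
move=> s hs; have k := key s hs.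
have D0 : 1 + s%:C * a != 0 by rewrite -nm_gt0 (le_lt_trans _ k).
split; first by rewrite nmM nmV ltr_pdivrMr ?nm_gt0 // mul1r.
have dN : cderiv (fun w => w * a : R[i]^o) s%:C a.
  by have := @cderivZl R R[i]^o id a s%:C 1 (@cderiv_id R s%:C); rewrite [_ *: _]mul1r.
have dD : cderiv (fun w => 1 + w * a : R[i]^o) s%:C a.
  by have := cderivD (@cderiv_cst R R[i]^o 1 s%:C) dN; rewrite add0r.
have := @ratio_derivative (fun w => w * a) (fun w => 1 + w * a) _ _ _ D0 dN dD; congr (cderiv _ _ _).
by rewrite /quad; field.
Qed.

(** A primitive is log ((1 - v z) / (1 - u z)) / (u - v), and z = (E - 1) / (E u - v) when E is the
    exponential of that logarithm. The disc corresponds to a strip for the logarithm, hence to a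
    convex set. *)
Lemma quad_path_arc (theta : R) z0 : 0 < theta < pi -> nm z0 < 1 -> z0 != 0 ->
  exists kappa gam, quad_path (cos theta +i* sin theta) (cos theta -i* sin theta) z0 kappa gam.
Proof.
move=> ht z1 z0n; have st : 0 < sin theta by apply: sin_gt0_pi.
pose u : K := cos theta +i* sin theta; pose v : K := cos theta -i* sin theta.
have uv1 : u * v = 1.
  apply/eqP; rewrite eq_complex /=; apply/andP; split; apply/eqP.
    by rewrite -(cos2Dsin2 theta); ring.
  by ring.
have nu : nm u = 1 by exact: nm_cis.
have nv : nm v = 1 by rewrite /v -cosN -sinN; exact: nm_cis.
have uv0 : u - v != 0.
  by rewrite eq_complex /= negb_and; apply/orP; right; rewrite opprK gt_eqF // addr_gt0.
(* The condition |z| < 1 becomes Im (E u) > 0, that is, sin (Im l + theta) > 0. *)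
have arc (E : K) : nm (E * u - v) ^+ 2 - nm (E - 1) ^+ 2 = 4 * sin theta * Im (E * u).
  rewrite !normc_nm; case: E => x y /=; apply/eqP; rewrite -subr_eq0.
  set a := cos _; set b := sin _; set lhs := (X in X == 0).
  have -> : lhs = (a ^+ 2 + b ^+ 2 - 1) * (x ^+ 2 + y ^+ 2 + 1 - 2 * x) by rewrite /lhs; ring.
  by rewrite cos2Dsin2 subrr mul0r.
have ImE w : Im (cexp w * u) = expR (Re w) * sin (Im w + theta).
  by case: w => x y; rewrite sinD /=; ring.
have hu : 0 < Re (1 - u * z0) by rewrite Re1_gt0 // nmM nu mul1r.
have hv : 0 < Re (1 - v * z0) by rewrite Re1_gt0 // nmM nv mul1r.
have nzu : 1 - u * z0 != 0 by rewrite -nm_gt0 Re_gt0_nm.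
pose l : K := clog (1 - v * z0) - clog (1 - u * z0).
have El : cexp l = (1 - v * z0) / (1 - u * z0) by rewrite cexpD cexpN !clogK.
have D1 : cexp l * u - v = (u - v) / (1 - u * z0) by rewrite El; field.
have N1 : cexp l - 1 = z0 * (cexp l * u - v) by rewrite D1 El; field.
have D1n : 0 < nm (cexp l * u - v) by rewrite D1 nmM nmV divr_gt0 // nm_gt0.
have sl : 0 < sin (Im l + theta).
  have : 0 < 4 * sin theta * Im (cexp l * u).
    rewrite -arc N1 nmM subr_gt0 ltrXn2r ?nnegrE ?mulr_ge0 //.
    by rewrite gtr_pMl.
  by rewrite pmulr_rgt0 ?mulr_gt0 // ImE pmulr_rgt0 // expR_gt0.
have Iml : `|Im l| < pi.
  have -> : Im l = Im (clog (1 - v * z0)) - Im (clog (1 - u * z0)) by [].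
  by have := Im_clog (1 - v * z0); have := Im_clog (1 - u * z0); rewrite ltr_norml; lra.
(* The sum lies in (-pi, 2 pi), where a positive sine leaves only (0, pi). *)
have lt : 0 < Im l + theta < pi.
  move: Iml; rewrite ltr_norml => Iml; apply/andP; split; rewrite ltNge; apply/negP => h.
    have : 0 <= sin (- (Im l + theta)) by apply: sin_ge0_pi; lra.
    by rewrite sinN; lra.
  have : 0 <= sin (Im l + theta - pi) by apply: sin_ge0_pi; lra.
  by rewrite sinB cospi sinpi; lra.
have key (s : R) : 0 <= s <= 1 -> nm (cexp (s%:C * l) - 1) < nm (cexp (s%:C * l) * u - v).
  move=> hs; rewrite -(@ltr_pXn2r _ 2) ?nnegrE // -subr_gt0 arc ImE.
  have -> : Im (s%:C * l) = s * Im l by case: (l) => x y /=; rewrite mul0r addr0.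
  rewrite !mulr_gt0 ?expR_gt0 //; apply: sin_gt0_pi.
  have conv (x y : R) : 0 < x -> 0 < y -> 0 < s * x + (1 - s) * y.
    move=> x0 y0; have [s0|s0] := ltrP 0 s.
      by apply: ltr_pwDl; [rewrite mulr_gt0|rewrite mulr_ge0 ?(ltW y0) //; lra].
    by have -> : s = 0 by [lra]; rewrite mul0r add0r subr0 mul1r.
  have [lt0 ltpi] := andP lt; have [t0 tpi] := andP ht.
  have c1 := conv _ _ lt0 t0.
  have := conv (pi - (Im l + theta)) (pi - theta); rewrite !subr_gt0 => /(_ ltpi tpi) c2.
  by apply/andP; split; lra.
have l0 : l != 0.
  apply/eqP => h; move: N1; rewrite h cexp0 subrr mul1r => /esym/eqP.
  by rewrite mulf_eq0 (negbTE z0n) (negbTE uv0).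
exists (l / (u - v)), (fun w => (cexp (w * l) - 1) / (cexp (w * l) * u - v)); split.
- by rewrite mulf_neq0 // invr_eq0.
- by rewrite !mul0r cexp0 subrr mul0r.
- by rewrite !mul1r N1 mulfK // -nm_gt0.
move=> s hs; have k := key s hs; set E := cexp (s%:C * l) in k *.
have D0 : E * u - v != 0 by rewrite -nm_gt0 (le_lt_trans _ k).
split; first by rewrite nmM nmV ltr_pdivrMr ?nm_gt0 // mul1r.
have dl : cderiv (fun w => w * l : R[i]^o) s%:C l.
  by have := @cderivZl R R[i]^o id l s%:C 1 (@cderiv_id R s%:C); rewrite [_ *: _]mul1r.
have dE : cderiv (fun w => cexp (w * l) : R[i]^o) s%:C (l * E).
  exact: cderiv_comp dl (cderiv_cexp _).
have dN : cderiv (fun w => cexp (w * l) - 1 : R[i]^o) s%:C (l * E).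
  by have := cderivB dE (@cderiv_cst R R[i]^o 1 s%:C); rewrite subr0.
have dD : cderiv (fun w => cexp (w * l) * u - v : R[i]^o) s%:C (l * E * u).
  have := cderivB (@cderivZl R R[i]^o _ u _ _ dE) (@cderiv_cst R R[i]^o v s%:C).
  by rewrite subr0.
have := @ratio_derivative (fun w => cexp (w * l) - 1) (fun w => cexp (w * l) * u - v) _ _ _ D0 dN dD; congr (cderiv _ _ _).
rewrite -/u -/v quad_factor // -/E.
by move: D0 uv0; generalize E u v => e x y D0 xy0; field; rewrite D0 xy0.
Qed.

End Paths.

(** * Extremal maps *)

Section Example.
Context {R : realType} {X : completeNormedModType R[i]}.
Local Notation K := R[i].
Local Notation Re := complex.Re.

Lemma cderiv_line (f g : K -> X) (x : X) z d : nm (z *: x) < 1 ->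
  (forall s, nm (s *: x) < 1 -> f s = g s) -> cderiv f z d -> cderiv g z d.
Proof.
move=> zx fg; have x1 : 0 < nm x + 1 by rewrite ltr_wpDl.
apply: (@cderiv_local _ _ _ _ _ _ ((1 - nm (z *: x)) / (nm x + 1))).
  by rewrite divr_gt0 // subr_gt0.
move=> h; rewrite ltr_pdivlMr // => hh; apply: fg; rewrite scalerDl.
apply: (le_lt_trans (ler_nmD _ _)); rewrite [X in _ + X]nmZ.
by have := nm_ge0 h; lra.
Qed.

Variables (T : {linear X -> R[i]^o}) (x0 : X) (g g1 P P1 : K -> K) (p2 : K) (lam : R).
Hypotheses (cT : continuous (T : X -> R[i]^o)) (Tnm : forall x, nm (T x) <= nm x).
Hypotheses (x01 : nm x0 = 1) (Tx0 : T x0 = 1).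
Hypothesis dg : forall z, nm z < 1 -> cderiv (g : K -> R[i]^o) z (g1 z).
Hypothesis gP : forall z, nm z < 1 -> g z + z * g1 z = P z.
Hypothesis g01 : g 0 = 1.
Hypothesis gn0 : forall z, nm z < 1 -> g z != 0.
Hypothesis Pn0 : forall z, nm z < 1 -> P z != 0.
Hypothesis dP : forall z, nm z < 1 -> cderiv (P : K -> R[i]^o) z (P1 z).
Hypothesis dP1 : cderiv (P1 : K -> R[i]^o) 0 p2.
Hypothesis RP : forall z, nm z < 1 -> 2^-1 - lam <= Re (1 + z * P1 z / P z).

Definition ray_map (x : X) : X := g (T x) *: x.

Let T1 x : nm x < 1 -> nm (T x) < 1. Proof. exact: le_lt_trans. Qed.

Let TZ (a : K) x : T (a *: x) = a * T x. Proof. exact: (linearZ_LR T). Qed.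

Definition ray_diff (x h : X) : X := g (T x) *: h + (g1 (T x) * T h) *: x.

Lemma ray_diff_linear x : linear (ray_diff x).
Proof.
by move=> a u v; rewrite /ray_diff (linearD T) TZ; vmod K X.
Qed.

Lemma ray_differentiable x : nm x < 1 ->
  differentiable ray_map x /\ 'd ray_map x = ray_diff x :> (X -> X).
Proof.
move=> x1; pose L : {linear X -> X} := HB.pack (ray_diff x)
  (GRing.isLinear.Build K X X _ (ray_diff x) (ray_diff_linear x)).
apply: (@linear_differentiable_nm _ _ _ _ _ L (nm (g (T x)) + nm (g1 (T x)) * nm x)).
  move=> h; apply: (le_trans (ler_nmD _ _)); rewrite !nmZ nmM mulrDl lerD2l.
  by rewrite mulrAC ler_wpM2l // mulr_ge0.
move=> e e0; have e20 : 0 < e / 2 by lra.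
have [r r0 H] := dg (T1 x1) e20.
have [r' r'0 H'] := cderiv_cont (dg (T1 x1)) e20.
exists (Num.min r r'); first by rewrite lt_min r0.
move=> h; rewrite lt_min => /andP[hr hr'].
have {}H := H _ (le_lt_trans (Tnm h) hr); have {}H' := H' _ (le_lt_trans (Tnm h) hr').
have -> : ray_map (x + h) - ray_map x - L h =
  (g (T x + T h) - g (T x) - T h * g1 (T x)) *: x + (g (T x + T h) - g (T x)) *: h.
  by rewrite /ray_map /= /ray_diff (linearD T); vmod K X.
apply: (le_trans (ler_nmD _ _)); rewrite !nmZ (splitr e) mulrDl; apply: lerD; last first.
  by rewrite ler_wpM2r.
apply: (@le_trans _ _ (e / 2 * nm (T h) * 1)); last first.
  by rewrite mulr1 ler_wpM2l // ltW.
by apply: ler_pM => //; exact: ltW.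
Qed.

(** Applying [T] to [ray_diff x h = y] gives P (T x) T h = T y by [gP]; substituting T h leaves an
    equation for [h] alone. Hence the role of the zeros of both [g] and [P]. *)
Definition ray_inv (x y : X) : X := (g (T x))^-1 *: (y - (g1 (T x) / P (T x) * T y) *: x).

Lemma ray_diffK x : nm x < 1 -> cancel (ray_diff x) (ray_inv x).
Proof.
move=> x1 h; have z1 := T1 x1; have a := gn0 z1; have b := Pn0 z1.
rewrite /ray_inv /ray_diff (linearD T) !TZ.
have -> : g (T x) * T h + g1 (T x) * T h * T x = P (T x) * T h.
  by rewrite -(gP z1); ring.
by vmod K X by (by field; rewrite a b).
Qed.

Lemma ray_invK x : nm x < 1 -> cancel (ray_inv x) (ray_diff x).
Proof.
move=> x1 y; have z1 := T1 x1; have a := gn0 z1; have b := Pn0 z1.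
have Tinv : T (ray_inv x y) = (P (T x))^-1 * T y.
  rewrite /ray_inv TZ (linearB T) TZ.
  transitivity ((g (T x))^-1 * (g (T x) / P (T x) * T y)); last by field; rewrite a b.
  have E : g (T x) = P (T x) - T x * g1 (T x) by rewrite -gP // addrK.
  by congr (_ * _); rewrite E; field.
rewrite /ray_diff Tinv /ray_inv.
by vmod K X by (by field; rewrite a b).
Qed.

Lemma ray_locally_biholomorphic : locally_biholomorphic ray_map.
Proof.
split=> x; rewrite norm_lt1 => x1; have [dF DF] := ray_differentiable x1 => //.
have bij : bijective ('d ray_map x : X -> X).
  by rewrite DF; exists (ray_inv x); [exact: ray_diffK|exact: ray_invK].
split=> //; have [KI IK] := diff_invP bij.
have E : diff_inv ray_map x = ray_inv x.
  apply/funext => y; apply: (bij_inj bij); rewrite IK DF.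
  by rewrite ray_invK.
pose Inv : {linear X -> X} := HB.pack (diff_inv ray_map x)
  (GRing.isLinear.Build K X X _ (diff_inv ray_map x) (diff_inv_linear bij)).
apply: (@nm_bounded_continuous _ _ _ Inv
  (nm (g (T x))^-1 * (1 + nm (g1 (T x) / P (T x)) * nm x))) => y /=.
rewrite E /ray_inv nmZ -[leRHS]mulrA ler_wpM2l // mulrDl mul1r.
apply: (le_trans (ler_nmB _ _)); rewrite lerD2l nmZ (nmM (g1 (T x) / _)) mulrAC.
by rewrite ler_wpM2l // mulr_ge0.
Qed.

Let dF x : nm x < 1 -> differentiable ray_map x. Proof. by move=> /ray_differentiable[]. Qed.

(** The derivative of order [n] of [P]. *)
Definition ray_coef n z : K := T (nderiv ray_map n.+1 (z *: x0) (fun=> x0)).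

Let line_bound z : nm z < 1 -> nm (z *: x0) < 1. Proof. by rewrite nmZ x01 mulr1. Qed.

Lemma cderiv_ray_coef n z : nm z < 1 -> cderiv (ray_coef n : K -> R[i]^o) z (ray_coef n.+1 z).
Proof.
by move=> z1; apply: cderiv_linear cT _; apply: (cderiv_nderiv_slice dF) (line_bound z1).
Qed.

Lemma ray_coef0 z : nm z < 1 -> ray_coef 0 z = P z.
Proof.
move=> z1.
have [d D] := ray_differentiable (line_bound z1).
rewrite /ray_coef (nderiv1E d) D /ray_diff (linearD T) !TZ Tx0 !mulr1 -gP //.
by rewrite (mulrC z).
Qed.

(** On the line through any [x] the map is s g(s T x) x, whose derivative in s is P(s T x) x; each
    further derivative brings a factor T x. At s = 0 this exhibits the coefficients as scalar
    polynomials times [x]. *)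
Lemma ray_nderiv n x s : nm (s *: x) < 1 ->
  nderiv ray_map n.+1 (s *: x) (fun=> x) = (T x ^+ n * ray_coef n (s * T x)) *: x.
Proof.
have Ts s' : nm (s' *: x) < 1 -> nm (s' * T x) < 1 by move=> /T1; rewrite TZ.
elim: n s => [|n IH] s sx.
  have [d D] := ray_differentiable sx.
  rewrite nderiv1E // D /ray_diff TZ mul1r ray_coef0 ?Ts // -gP ?Ts //.
  by vmod K X.
have H1 := cderiv_nderiv_slice dF n.+1 sx.
have := @cderiv_affine R R[i]^o 0 (T x) (ray_coef n) s (ray_coef n.+1 (s * T x)).
rewrite add0r => /(_ (cderiv_ray_coef n (Ts _ sx))) H2.
have {}H2 := cderivZl x (cderivZr (T x ^+ n) H2).
have := cderiv_unique H1 (cderiv_line sx _ H2) => -> => [|s' s'x].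
  by rewrite -![_ *: (_ : R[i]^o)]/(_ * _ : K) exprSr mulrA.
by rewrite add0r IH.
Qed.

Lemma ray_nderiv0 n x : nderiv ray_map n.+1 0 (fun=> x) = (T x ^+ n * ray_coef n 0) *: x.
Proof. by have := @ray_nderiv n x 0; rewrite scale0r mul0r nm0 => /(_ ltr01). Qed.

Lemma ray_coef1 z : nm z < 1 -> ray_coef 1 z = P1 z.
Proof.
move=> z1; apply: cderiv_unique (cderiv_ray_coef 0 z1) _.
have z10 : 0 < 1 - nm z by rewrite subr_gt0.
apply: (cderiv_local z10) (dP z1) => h hz; rewrite ray_coef0 //.
by rewrite (le_lt_trans (ler_nmD _ _)) //; lra.
Qed.

Lemma ray_coef2 : ray_coef 2 0 = p2.
Proof.
have z1 : nm (0 : K) < 1 by rewrite nm0.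
apply: cderiv_unique (cderiv_ray_coef 1 z1) _.
by apply: (cderiv_local ltr01) dP1 => h hz; rewrite add0r ray_coef1.
Qed.

Lemma multilinear_prod k (c : K) :
  multilinear (fun v : 'I_k -> X => c * \prod_(i < k) T (v i) : R[i]^o).
Proof.
move=> i v a u w /=.
have E y : \prod_(j < k) T (dfwith (T := fun=> X) v i y j) =
    T y * \prod_(j < k | j != i) T (v j).
  rewrite (bigD1 i) //= dfwithin; congr (_ * _).
  by apply: eq_bigr => j ji; rewrite dfwithout // eq_sym.
rewrite !E (linearD T) TZ -[_ *: (_ : R[i]^o)]/(_ * _ : K); ring.
Qed.

Lemma ray_scalar_type : scalar_type_coefficients ray_map.
Proof.
move=> k _; exists (fun x => (k.+1`!%:R)^-1 * ray_coef k 0 * \prod_(i < k) T x).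
  exists (fun v => (k.+1`!%:R)^-1 * ray_coef k 0 * \prod_(i < k) T (v i)) => //.
  exact: multilinear_prod.
by move=> x; rewrite ray_nderiv0 scalerA prodr_const card_ord mulrA mulrAC.
Qed.

Lemma ray_normalized : normalized ray_map.
Proof.
have z1 : nm (0 : X) < 1 by rewrite nm0.
split; first by rewrite /ray_map scaler0.
have [_ ->] := ray_differentiable z1; apply/funext => h.
by rewrite /ray_diff (linear0 T) g01 scaler0 scale1r addr0.
Qed.

(** D^2F(x)(x, x) + DF(x) x is the image under DF(x) of w x with w = 1 + z P'(z) / P(z) and z = T x.
    The condition then involves only w, whichever functional supports [x]. *)
Lemma ray_Fhat : Fhat lam ray_map.
Proof.
split; [exact: ray_normalized|exact: ray_locally_biholomorphic|].
move=> x xn0 x1 T' [_ T'x _]; have x1' := x1; rewrite norm_lt1 in x1'.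
have [_ /(_ _ x1)[bij _]] := ray_locally_biholomorphic.
have [KI IK] := diff_invP bij.
have zx := T1 x1'.
have sx : nm ((1 : K) *: x) < 1 by rewrite scale1r.
have E1 := @ray_nderiv 0 x 1 sx; have E2 := @ray_nderiv 1 x 1 sx.
rewrite scale1r !mul1r ray_coef0 // in E1; rewrite scale1r mul1r ray_coef1 // expr1 in E2.
have dx : 'd ray_map x x = P (T x) *: x by rewrite -E1 (nderiv1E (dF x1')).
set w := 1 + T x * P1 (T x) / P (T x).
have -> : nderiv ray_map 2 x (fun=> x) + 'd ray_map x x = 'd ray_map x (w *: x).
  rewrite (linearZ_LR ('d ray_map x)) dx E2 /w.
  rewrite -[RHS]/(_ *: (_ *: _)); have pn := Pn0 zx; by vmod K X by (by field).
have nx : `|x| != 0 by rewrite normr_eq0.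
by rewrite KI !(linearZ_LR T') T'x -![_ *: _]/(_ * _ : K) mulrCA mulVf // mulr1 RP.
Qed.

Lemma ray_coef_values : coef ray_map T x0 2 = P1 0 / 2 /\ coef ray_map T x0 3 = p2 / 6.
Proof.
have z1 : nm (0 : K) < 1 by rewrite nm0.
rewrite /coef !ray_nderiv0 !TZ Tx0 !expr1n !mulr1 !mul1r ray_coef1 // ray_coef2.
by split; rewrite mulrC.
Qed.

Lemma ray_map_admissible :
  [/\ locally_biholomorphic ray_map, scalar_type_coefficients ray_map & Fhat lam ray_map].
Proof. by split; [exact: ray_locally_biholomorphic|exact: ray_scalar_type|exact: ray_Fhat]. Qed.

End Example.

(** * Equality in the two bounds *)

Section Extremal.
Context {R : realType} {X : completeNormedModType R[i]}.
Local Notation K := R[i].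
Local Notation Re := complex.Re.

Lemma quad_path_exists (theta : R) z0 : 0 <= theta < pi -> nm z0 < 1 -> z0 != 0 ->
  exists kappa gam, quad_path (cos theta +i* sin theta) (cos theta -i* sin theta) z0 kappa gam.
Proof.
move=> /andP[t0 tpi] z1 z0n; have [<-|tn] := eqVneq 0 theta; last first.
  by apply: quad_path_arc => //; rewrite tpi andbT lt_neqAle tn.
by rewrite cos0 sin0 oppr0; exact: quad_path_double.
Qed.

Lemma Re_cayley_gt0 (w : K) : nm w < 1 -> 0 < Re ((1 + w) / (1 - w)).
Proof.
move=> w1; have n1 : 1 - w != 0 by rewrite -nm_gt0 Re_gt0_nm // Re1_gt0.
set A := _ / _.
have E : A - 1 = w * (A + 1) by rewrite /A; field.
have A1 : A + 1 = 2 / (1 - w) by rewrite /A; field.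
have A0 : 0 < nm (A + 1) by rewrite nm_gt0 A1 mulf_neq0 ?invr_eq0 // pnatr_eq0.
have : nm (A - 1) ^+ 2 < nm (A + 1) ^+ 2.
  by rewrite ltrXn2r ?nnegrE // E nmM gtr_pMl.
by rewrite !normc_nm; case: (A) => x y /=; rewrite subr0 addr0; lra.
Qed.

(** By partial fractions the ratio is the average of the Cayley transforms (1 + w) / (1 - w) at w =
    u z and w = v z. *)
Lemma Re_quad_ratio (u v z : K) : u * v = 1 -> nm u = 1 -> nm v = 1 -> nm z < 1 ->
  0 < Re ((1 - z ^+ 2) / quad u v z).
Proof.
move=> uv1 nu nv z1.
have wu : nm (u * z) < 1 by rewrite nmM nu mul1r.
have wv : nm (v * z) < 1 by rewrite nmM nv mul1r.
have nzu : 1 - u * z != 0 by rewrite -nm_gt0 Re_gt0_nm // Re1_gt0.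
have nzv : 1 - v * z != 0 by rewrite -nm_gt0 Re_gt0_nm // Re1_gt0.
have -> : (1 - z ^+ 2) / quad u v z =
    (1 / 2)%:C * ((1 + u * z) / (1 - u * z) + (1 + v * z) / (1 - v * z)).
  have -> : (1 / 2)%:C = 1 / 2 :> K by rewrite rmorphM fmorphV rmorph_nat.
  have -> : 1 - z ^+ 2 = 1 - (u * v) * z ^+ 2 by rewrite uv1 mul1r.
  by rewrite quad_factor //; field; rewrite nzu nzv.
by rewrite Re_realM ReD; have := Re_cayley_gt0 wu; have := Re_cayley_gt0 wv; lra.
Qed.

Variables (T : {linear X -> R[i]^o}) (x0 : X).
Hypotheses (sT : supporting x0 T) (Tnm : forall x, nm (T x) <= nm x) (x01 : nm x0 = 1).

Let cT : continuous (T : X -> R[i]^o). Proof. by case: sT. Qed.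
Let Tx0 : T x0 = 1. Proof. by case: sT => _ -> _; rewrite nmK1. Qed.

(** The map with c = 2 r and r = cos theta has A_2 = b r and A_3 - A_2^2 = (b / 3) ((2 - b) r^2 -
    1). The value r = 1 is the case of a double root. *)
Lemma quad_example (lam r : R) : 2^-1 <= lam <= 1 -> -1 < r <= 1 ->
  let b := 2^-1 + lam in
  exists F : X -> X, [/\ locally_biholomorphic F, scalar_type_coefficients F & Fhat lam F] /\
    hermitian_toeplitz31 F T x0 =
    ((1 - b ^+ 2 * r ^+ 2) ^+ 2 - (b / 3 * ((2 - b) * r ^+ 2 - 1)) ^+ 2)%:C.
Proof.
move=> hlam hr b.
have hb : 1 <= b <= 3 / 2 by rewrite /b; lra.
have b0 : 0 <= b by lra.
pose theta := acos r.
have r1 : -1 <= r <= 1 by lra.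
have ht : 0 <= theta < pi by rewrite acos_ge0 // acos_ltpi.
have cr : cos theta = r by rewrite acosK // in_itv.
pose u : K := cos theta +i* sin theta; pose v : K := cos theta -i* sin theta.
have uv1 : u * v = 1.
  apply/eqP; rewrite eq_complex /=; apply/andP; split; apply/eqP.
    by rewrite -(cos2Dsin2 theta); ring.
  by ring.
have nu : nm u = 1 by exact: nm_cis.
have nv : nm v = 1 by rewrite /v -cosN -sinN; exact: nm_cis.
have uv : u + v = (2 * r)%:C.
  by apply/eqP; rewrite eq_complex /= subrr eqxx andbT cr; apply/eqP; ring.
have path z0 : nm z0 < 1 -> z0 != 0 -> exists kappa gam, quad_path u v z0 kappa gam.
  exact: quad_path_exists.
clearbody u v.
pose P := quad_pow u v b.
pose P1 z := b%:C * (u + v - 2 * z) / quad u v z * P z.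
have dP z : nm z < 1 -> cderiv (P : K -> R[i]^o) z (P1 z) by exact: cderiv_quad_pow.
(* The primitive is taken in the complete space [X], along x0, and [T] brings it back to scalars. *)
have [||G [G' [G0 HG]]] := @disc_primitive R X (fun z => P z *: x0) (fun z => P1 z *: x0).
- by move=> z /dP H; exact: cderivZl.
- move=> s s1; have [C HC] := quad_pow_bounded uv1 nu nv b0 s1.
  by exists C => z /HC; rewrite nmZ x01 mulr1.
pose g z : K := T (G z); pose g1 z : K := T (G' z).
have dg z : nm z < 1 -> cderiv (g : K -> R[i]^o) z (g1 z).
  by move=> /HG[H _]; exact: cderiv_linear cT H.
have gP z : nm z < 1 -> g z + z * g1 z = P z.
  move=> /HG[_ /(congr1 T)]; rewrite (linearD T) !(linearZ_LR T) Tx0.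
  by rewrite -![_ *: (_ : R[i]^o)]/(_ * _ : K) mulr1.
have g01 : g 0 = 1.
  rewrite /g G0 (linearZ_LR T) Tx0 -[_ *: _]/(_ * _ : K) mulr1; exact: quad_pow0.
have gn0 z0 : nm z0 < 1 -> g z0 != 0.
  move=> z1; have [->|z0n] := eqVneq z0 0; first by rewrite g01 oner_eq0.
  have [kappa [gam [k0 gam0 gam1 Hg]]] := path _ z1 z0n.
  have := @Re_increasing R (fun s => kappa^-1 * (gam s * g (gam s))).
  rewrite gam0 gam1 mul0r mulr0 => H.
  apply/eqP => gz; move: H; rewrite gz !mulr0 ltxx => H; suff: false by [].
  apply: H => s /Hg[gs dgam].
  have df : cderiv (fun w => w * g w : R[i]^o) (gam s%:C) (P (gam s%:C)).
    by have := cderivM (@cderiv_id R (gam s%:C)) (dg _ gs); rewrite mul1r gP.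
  eexists; first exact: (cderivZr kappa^-1 (cderiv_comp dgam df)).
  (* The factor [kappa] of the speed of the path cancels, leaving P times [quad], of positive real
     part. *)
  have E (p q : K) : kappa^-1 *: ((kappa * q) *: (p : R[i]^o)) = p * q.
    by rewrite -![_ *: (_ : R[i]^o)]/(_ * _ : K); field.
  by rewrite E; exact: (Re_quad_pow uv1 nu nv hb gs).
have Pn0 z : nm z < 1 -> P z != 0 by move=> _; exact: quad_pow_neq0.
have qn0 z : nm z < 1 -> quad u v z != 0 by exact: quad_neq0.
have RP z : nm z < 1 -> 2^-1 - lam <= Re (1 + z * P1 z / P z).
  (* The constant 1 - b is the bound 1/2 - lam of the class; the rest has positive real part. *)
  move=> zd; have -> : 1 + z * P1 z / P z = (1 - b)%:C + b%:C * ((1 - z ^+ 2) / quad u v z).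
    rewrite rmorphB /= /P1; have := qn0 z zd; rewrite /quad => q0.
    by field; rewrite q0 Pn0.
  rewrite ReD Re_realM /=; have := Re_quad_ratio uv1 nu nv zd.
  by rewrite /b; nra.
have z1 : nm (0 : K) < 1 by rewrite nm0.
have P0 : P 0 = 1 by exact: quad_pow0.
have q0 : quad u v 0 = 1 by rewrite /quad mulr0 subr0 expr0n addr0.
pose c := u + v.
have dP1 : cderiv (P1 : K -> R[i]^o) 0 (b%:C * (c ^+ 2 - 2) + b%:C ^+ 2 * c ^+ 2).
  have dq : cderiv (quad u v : K -> R[i]^o) 0 (- c).
    have := cderivD (cderiv_linfac c 0) (cderivM (@cderiv_id R 0) (@cderiv_id R 0)).
    by rewrite mulr0 mul0r !addr0; apply: eq_cderiv => w; rewrite /quad expr2.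
  have dn : cderiv (fun z => c - 2 * z : R[i]^o) 0 (- 2).
    have := cderivB (@cderiv_cst R R[i]^o c 0) (cderivZr 2 (@cderiv_id R 0)).
    by rewrite sub0r [_ *: _]mulr1.
  have := cderivM (cderivM (cderivZr b%:C dn) (cderivV (qn0 0 z1) dq)) (dP 0 z1).
  congr (cderiv _ _ _); rewrite /P1 P0 q0 -/c -![_ *: _]/(_ * _ : K) mulr0 subr0.
  by field.
exists (ray_map T g); split.
  exact: (ray_map_admissible cT Tnm x01 Tx0 dg gP g01 gn0 Pn0 dP RP).
rewrite toeplitz_det.
have [-> ->] := ray_coef_values cT Tnm x01 Tx0 dg gP dP dP1.
have -> : P1 0 / 2 = (b * r)%:C.
  by rewrite /P1 P0 q0 uv !rmorphM /= rmorph_nat; field.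
have -> : (b%:C * (c ^+ 2 - 2) + b%:C ^+ 2 * c ^+ 2) / 6 - (b * r)%:C ^+ 2 =
    (b / 3 * ((2 - b) * r ^+ 2 - 1))%:C.
  by rewrite /c uv !(rmorphM, rmorphB, rmorphXn, fmorphV, rmorph_nat, rmorph1) /=; field.
by rewrite !nm_real !real_normK ?num_real // exprMn.
Qed.

Lemma identity_example (lam : R) : 2^-1 <= lam <= 1 ->
  exists F : X -> X, [/\ locally_biholomorphic F, scalar_type_coefficients F & Fhat lam F] /\
    hermitian_toeplitz31 F T x0 = 1%:C.
Proof.
move=> hlam.
have c0 (a z : K) : nm z < 1 -> cderiv (fun=> a : R[i]^o) z (0 : K) by move=> _; exact: cderiv_cst.
have gP (z : K) : nm z < 1 -> 1 + z * 0 = 1 by rewrite mulr0 addr0.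
have n1 (z : K) : nm z < 1 -> (1 : K) != 0 by rewrite oner_eq0.
have RP (z : K) : nm z < 1 -> 2^-1 - lam <= Re (1 + z * 0 / 1) by rewrite mulr0 mul0r addr0 /=; lra.
have z1 : nm (0 : K) < 1 by rewrite nm0.
exists (ray_map T (fun=> 1)); split.
  exact: (@ray_map_admissible R X T x0 (fun=> 1) (fun=> 0) (fun=> 1) (fun=> 0) lam
    cT Tnm x01 Tx0 (c0 1) gP erefl n1 n1 (c0 1) RP).
rewrite toeplitz_det.
have [-> ->] := @ray_coef_values R X T x0 (fun=> 1) (fun=> 0) (fun=> 1) (fun=> 0) 0
  cT Tnm x01 Tx0 (c0 1) gP (c0 1) (c0 0 0 z1).
by rewrite !mul0r !expr0n /= subr0 nm0 !expr0n /= !subr0 expr1n.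
Qed.

(** As s = b^2 r^2 for the example, r^2 = q puts s at the vertex found in [toeplitz_lower]. *)
Lemma lower_extremal (lam : R) : 2^-1 <= lam <= 1 ->
  exists F : X -> X, [/\ locally_biholomorphic F, scalar_type_coefficients F & Fhat lam F] /\
    hermitian_toeplitz31 F T x0 = (lower_bound31 lam)%:C.
Proof.
move=> hlam; pose b := 2^-1 + lam.
pose q := (7 + b) / (4 * (2 * b - 1) * (b + 1)).
have hb : 1 <= b <= 3 / 2 by rewrite /b; lra.
have d0 : 0 < 4 * (2 * b - 1) * (b + 1) by rewrite !mulr_gt0 //; lra.
have q0 : 0 <= q by apply: divr_ge0; [lra|exact: ltW].
(* Equivalent to (b - 1) (8 b + 11) >= 0. *)
have q1 : q <= 1 by rewrite /q ler_pdivrMr // mul1r; nra.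
have r1 : Num.sqrt q <= 1 by rewrite -sqrtr1 ler_sqrt.
have r0 := sqrtr_ge0 q.
have hr : -1 < Num.sqrt q <= 1 by lra.
have [F [H E]] := quad_example hlam hr; exists F; split=> //.
rewrite E sqr_sqrtr // -/b; congr _%:C.
have -> : lam = b - 2^-1 by rewrite /b; ring.
rewrite /lower_bound31 /q; field.
by apply/and3P; split; apply: lt0r_neq0; lra.
Qed.

(** Below the threshold the identity map gives 1; above it r = 1, where P = (1 - z)^(-2b), attains
    the end point s = b^2. *)
Lemma upper_extremal (lam : R) : 2^-1 <= lam <= 1 ->
  exists F : X -> X, [/\ locally_biholomorphic F, scalar_type_coefficients F & Fhat lam F] /\
    hermitian_toeplitz31 F T x0 = (upper_bound31 lam)%:C.
Proof.
move=> hlam; rewrite /upper_bound31; case: ifP => _; first exact: identity_example.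
have hr : -1 < (1 : R) <= 1 by lra.
have [F [H E]] := quad_example hlam hr; exists F; split=> //.
by rewrite E; congr _%:C; field.
Qed.

End Extremal.

Theorem theorem5p2 (R : realType) (X : completeNormedModType R[i])
  (X_neq0 : exists x : X, x != 0) (lam : R) (hlam : 2^-1 <= lam <= 1) :
  [/\ (forall F : X -> X,
         locally_biholomorphic F -> scalar_type_coefficients F -> Fhat lam F ->
         forall x0 : X, `|x0| = 1 -> forall T, supporting x0 T ->
         (lower_bound31 lam)%:C <= hermitian_toeplitz31 F T x0 /\
         hermitian_toeplitz31 F T x0 <= (upper_bound31 lam)%:C),
      (exists (F : X -> X) (x0 : X) (T : {linear X -> R[i]^o}),
         [/\ locally_biholomorphic F, scalar_type_coefficients F & Fhat lam F] /\
         [/\ `|x0| = 1, supporting x0 T &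
             hermitian_toeplitz31 F T x0 = (lower_bound31 lam)%:C]) &
      (exists (F : X -> X) (x0 : X) (T : {linear X -> R[i]^o}),
         [/\ locally_biholomorphic F, scalar_type_coefficients F & Fhat lam F] /\
         [/\ `|x0| = 1, supporting x0 T &
             hermitian_toeplitz31 F T x0 = (upper_bound31 lam)%:C])].
Proof.
have [x xn] := X_neq0; pose x0 := (nm x)^-1%:C *: x.
have x01 : nm x0 = 1.
  by rewrite nmZ nmr ?invr_ge0 // mulVf // nm_eq0.
have [T [sT Tnm]] := supporting_exists x01.
split; first by move=> F lb sc Fh y0 y01 S sS; exact: forward_bounds.
  have [F [H E]] := lower_extremal sT Tnm x01 hlam.
  by exists F, x0, T; split=> //; split=> //; exact: nmK1.
have [F [H E]] := upper_extremal sT Tnm x01 hlam.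
by exists F, x0, T; split=> //; split=> //; exact: nmK1.
Qed.
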